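(* Let $\mathfrak{k}=(K_{\mathfrak{k}},\le_{\mathfrak{k}})$ be an abstract elementary class. (1) Assume $\kappa>\theta>\mathrm{LST}_{\mathfrak{k}}$, $\theta$ is a measurable cardinal and $\kappa$ is weakly compact. Then $\mathfrak{k}$ has $(\kappa,\theta)$-amalgamation bases. (2) Assume $\kappa,\theta$ are measurable cardinals $>\mathrm{LST}_{\mathfrak{k}}$ and $\mu>\kappa+\theta$ is a strong limit singular cardinal of cofinality $\kappa$. Then $\mathfrak{k}$ has $(\mu,\theta)$-amalgamation bases. (3) If $\kappa>\theta>\mathrm{LST}_{\mathfrak{k}}$, $\theta$ is a measurable cardinal and $\{M\in K^{\mathfrak{k}}_\kappa: M$ is a $(\chi_1,\chi_2)$-amalgamation base$\}$ is $\le_{\mathfrak{k}}$-dense in $K^{\mathfrak{k}}_\kappa$ (i.e. every $M \in K^{\mathfrak k}_\kappa$ has a $\le_{\mathfrak k}$-extension in this set), then $\mathfrak{k}$ has $((\chi_1,\chi_2),\kappa,\theta)$-amalgamation bases.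
   Context: $\mathfrak{k}=(K_{\mathfrak{k}},\le_{\mathfrak{k}})$ is an abstract elementary class (a.e.c.) in a vocabulary $\tau_{\mathfrak{k}}$; an empty model, which is $\le_{\mathfrak{k}}$ every member, is allowed. $\mathrm{LST}_{\mathfrak{k}}$ is its Löwenheim–Skolem–Tarski number (taken to be $\ge|\tau_{\mathfrak{k}}|+\aleph_0$). $K^{\mathfrak{k}}_\lambda=\{M\in K_{\mathfrak{k}}:\|M\|=\lambda\}$. $M_0\in K_{\mathfrak{k}}$ is a $(\chi_1,\chi_2)$-amalgamation base (where $\chi_1,\chi_2\ge\|M_0\|$) if whenever $M_0\le_{\mathfrak{k}}M_\ell\in K^{\mathfrak{k}}_{\chi_\ell}$ for $\ell=1,2$, there is $M_3\in K_{\mathfrak{k}}$ with $M_0\le_{\mathfrak{k}}M_3$ such that both $M_1$ and $M_2$ can be $\le_{\mathfrak{k}}$-embedded into $M_3$ over $M_0$. For a regular cardinal $\theta$, the $\theta$-majority of $M\in K^{\mathfrak{k}}_\lambda$ satisfies a property $\psi$ if there is a function $F$ such that: (a) $\mathrm{Dom}(F)=\{M\in K_{\mathfrak{k}}: M$ has universe an ordinal in $[\lambda,\lambda^+)\}$; (b) if $M\in\mathrm{Dom}(F)$ then $M\le_{\mathfrak{k}}F(M)\in\mathrm{Dom}(F)$; (c) if $\langle M_\alpha:\alpha\le\theta\rangle$ is $\le_{\mathfrak{k}}$-increasing continuous, each $M_\alpha\in\mathrm{Dom}(F)$, and $M_{2\alpha+2}=F(M_{2\alpha+1})$ for every $\alpha<\theta$,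 then $M_\theta$ satisfies $\psi$. $\mathfrak{k}$ has $((\chi_1,\chi_2),\lambda,\theta)$-amalgamation bases if the $\theta$-majority of $M\in K^{\mathfrak{k}}_\lambda$ are $(\chi_1,\chi_2)$-amalgamation bases; $\mathfrak{k}$ has $(\lambda,\theta)$-amalgamation bases if it has $((\lambda,\lambda),\lambda,\theta)$-amalgamation bases. *)

(* Defs.v *)
(* Mathematical Components, with the classical-logic files of
   MathComp-Analysis; set theory is carried out in the type ZF below. *)
From mathcomp Require Import all_boot all_classical.

Set Implicit Arguments.
Unset Strict Implicit.
Unset Printing Implicit Defensive.

Local Open Scope classical_set_scope.
Local Open Scope card_scope.

(* The universe of sets: Aczel's well-founded trees modulo extensional
   equality.  With the classical axioms of boolp it satisfies ZFC (with
   second-order replacement), and its elements are compared by Leibniz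
   equality.  Proper classes are predicates on ZF. *)
Inductive tree : Type := Sup (A : Type) (f : A -> tree).

Fixpoint teq (s t : tree) : Prop :=
  match s, t with
  | Sup A f, Sup B g =>
      (forall a, exists b, teq (f a) (g b)) /\
      (forall b, exists a, teq (f a) (g b))
  end.

Lemma teq_refl s : teq s s.
Proof. by elim: s => A f IH /=; split=> a; exists a. Qed.

Lemma teq_sym s t : teq s t -> teq t s.
Proof.
elim: s t => A f IH [B g] /= [fg gf]; split.
  by move=> b; have [a /IH] := gf b; exists a.
by move=> a; have [b /IH] := fg a; exists b.
Qed.

Lemma teq_trans s t u : teq s t -> teq t u -> teq s u.
Proof.
elim: s t u => A f IH [B g] [C h] /= [fg gf] [gh hg]; split.
  move=> a; have [b fgb] := fg a; have [c ghc] := gh b.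
  by exists c; exact: IH fgb ghc.
move=> c; have [b ghc] := hg c; have [a fgb] := gf b.
by exists a; exact: IH fgb ghc.
Qed.

Definition ZF : Type := {P : set tree | exists t, P = teq t}.

Definition cls (t : tree) : ZF := exist _ (teq t) (ex_intro _ t erefl).

Lemma cls_eq s t : cls s = cls t <-> teq s t.
Proof.
split=> [[/(congr1 (fun P => P t)) ->]|st]; first exact: teq_refl.
apply: eq_exist; apply/predeqP => u; split; last exact: teq_trans.
exact/teq_trans/teq_sym.
Qed.

Lemma clsP (x : ZF) : exists t, x = cls t.
Proof. by case: x => P [t Pt]; exists t; apply: eq_exist. Qed.

Definition elts (y : ZF) : set ZF :=
  [set x | exists (A : Type) (f : A -> tree) (a : A),
             y = cls (Sup f) /\ x = cls (f a)].

Coercion elts : ZF >-> set.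

Notation "x ∈ y" := (elts y x) (at level 70, no associativity).

Lemma in_cls A (f : A -> tree) x : x ∈ cls (Sup f) <-> exists a, x = cls (f a).
Proof.
split=> [[B [g [b [/cls_eq/= [fg gf] ->]]]]|[a ->]]; last by exists A, f, a.
by have [a fgb] := gf b; exists a; apply/cls_eq/teq_sym.
Qed.

Lemma ZF_ext (x y : ZF) : (forall z, z ∈ x <-> z ∈ y) -> x = y.
Proof.
have [[A f] ->] := clsP x; have [[B g] ->] := clsP y => xy.
apply/cls_eq; split=> [a|b].
- have /xy/in_cls[b /cls_eq] : cls (f a) ∈ cls (Sup f) by apply/in_cls; exists a.
  by exists b.
- have /xy/in_cls[a /cls_eq/teq_sym] : cls (g b) ∈ cls (Sup g).
    by apply/in_cls; exists b.
  by exists a.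
Qed.

Lemma mem_wf : well_founded (fun x y : ZF => x ∈ y).
Proof.
move=> x; have [t ->] := clsP x; elim: t => A f IH.
by constructor=> y /in_cls[a ->].
Qed.

Lemma ZF_small (A : Type) (F : A -> ZF) :
  exists x : ZF, forall y, y ∈ x <-> exists a, y = F a.
Proof.
have [f Ff] := choice (fun a => clsP (F a)).
exists (cls (Sup f)) => y; rewrite in_cls.
by split=> -[a ->]; exists a; rewrite Ff.
Qed.

Definition empty : ZF := cls (Sup (fun v : void => match v with end)).

(* The set of all y in the class P; empty when P is a proper class. *)
Definition setof (P : set ZF) : ZF :=
  if pselect (exists x : ZF, forall y, y ∈ x <-> P y) is left xP
  then projT1 (cid xP) else empty.

Lemma in_setof (A : Type) (F : A -> ZF) (P : set ZF) :
  (forall y, P y <-> exists a, y = F a) -> forall y, y ∈ setof P <-> P y.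
Proof.
move=> PF; have [x xF] := ZF_small F; rewrite /setof.
case: pselect => [xP|[]]; first exact: (projT2 (cid xP)).
by exists x => y; rewrite xF PF.
Qed.

Definition succ (x : ZF) : ZF := setof [set y | y ∈ x \/ y = x].

Lemma in_succ x y : y ∈ succ x <-> y ∈ x \/ y = x.
Proof.
have [[A f] xE] := clsP x.
apply: (in_setof (F := fun o => if o is Some a then cls (f a) else x)) => {}y /=.
rewrite [in y ∈ x]xE in_cls; split=> [[[a ->]|->]|[[a|] ->]].
- by exists (Some a).
- by exists None.
- by left; exists a.
- by right.
Qed.

(* 2 * a, that is, a copies of 2: double a is the union of the
   double b + 2 over b in a, so it is an even ordinal and double d = d for
   every limit d. *)
Definition double : ZF -> ZF :=
  Fix mem_wf (fun _ => ZF) (fun a rec =>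
    setof [set z | exists b (ba : b ∈ a), z ∈ succ (succ (rec b ba))]).

Lemma in_double a z :
  z ∈ double a <-> exists b, b ∈ a /\ z ∈ succ (succ (double b)).
Proof.
rewrite {1}/double Fix_eq -/double; last first.
  move=> x f g fg; congr setof; apply/predeqP => y /=.
  by split=> -[b [bx yb]]; exists b, bx; move: yb; rewrite fg.
have [[A f] aE] := clsP a.
have [h hE] := choice (fun x : A => clsP (succ (succ (double (cls (f x)))))).
have H : forall x : A, exists Bg : {B : Type & B -> tree},
    h x = Sup (projT2 Bg).
  by move=> x; case: (h x) => B g; exists (existT _ B g).
have [k kE] := choice H.
rewrite (in_setof (F := fun p : {x : A & projT1 (k x)} =>
  cls (projT2 (k (projT1 p)) (projT2 p)))) /=.
  by split=> [[b [ba zb]]|[b [ba zb]]]; [exists b|exists b, ba].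
move=> y; split.
  move=> [b [+ yb]]; rewrite {1}aE => /in_cls[x bE].
  by move: yb; rewrite bE hE kE => /in_cls[c ->]; exists (existT _ x c).
move=> [[x c] ->] /=; have xa : cls (f x) ∈ a by rewrite aE; apply/in_cls; exists x.
by exists (cls (f x)), xa; rewrite hE kE; apply/in_cls; exists c.
Qed.

Definition transitive_set (x : ZF) : Prop := forall y, y ∈ x -> y `<=` x.

Definition ordinal (x : ZF) : Prop :=
  transitive_set x /\ forall y, y ∈ x -> transitive_set y.

Definition limit (d : ZF) : Prop :=
  [/\ ordinal d, exists a, a ∈ d & forall a, a ∈ d -> succ a ∈ d].

Definition card_lt T U (A : set T) (B : set U) : Prop := ~~ (B #<= A).
Notation "A '#<' B" := (card_lt A B) (at level 70, no associativity).

(* The disjoint union of A and B, whose cardinality is |A| + |B|. *)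
Definition dsum T U (A : set T) (B : set U) : set (T + U) :=
  [set z | match z with inl a => A a | inr b => B b end].
Notation "A '⊎' B" := (dsum A B) (at level 50, left associativity).

Definition cardinal (l : ZF) : Prop :=
  ordinal l /\ forall a, a ∈ l -> a #< l.

(* a < l^+, where l^+ is the least cardinal above l. *)
Definition lt_succ_card (a l : ZF) : Prop :=
  forall m, cardinal m -> l ∈ m -> a ∈ m.

Definition cofinal_map (a d : ZF) (f : ZF -> ZF) : Prop :=
  (forall x, x ∈ a -> f x ∈ d) /\
  (forall y, y ∈ d -> exists2 x, x ∈ a & y ∈ f x \/ y = f x).

Definition cofinality (d c : ZF) : Prop :=
  [/\ ordinal c, exists f, cofinal_map c d f &
      forall a f, ordinal a -> cofinal_map a d f -> c `<=` a].

Definition regular (l : ZF) : Prop :=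
  [/\ cardinal l, infinite_set l & cofinality l l].

Definition singular (l : ZF) : Prop :=
  [/\ cardinal l, infinite_set l & exists2 c, cofinality l c & c ∈ l].

Definition strong_limit (l : ZF) : Prop :=
  [/\ cardinal l, infinite_set l &
      forall a, a ∈ l -> [set X : set ZF | X `<=` a] #< l].

Definition complete_filter (l : ZF) T (D : set_system T) : Prop :=
  forall S : set (set T), S #< l -> S `<=` D -> D (\bigcap_(X in S) X).

Definition measurable_cardinal (l : ZF) : Prop :=
  [/\ cardinal l, ~ countable l &
      exists D : set_system (set_type l),
        [/\ UltraFilter D, complete_filter l D & forall x, ~ D [set x]]].

(* Uncountable, with the partition property l -> (l)^2_2: c is a colouring
   of the pairs a < b of ordinals below l. *)
Definition weakly_compact (l : ZF) : Prop :=
  [/\ cardinal l, ~ countable l &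
      forall c : ZF -> ZF -> bool,
        exists (H : set ZF) (i : bool),
          [/\ H `<=` l, H #= l &
              forall a b, H a -> H b -> a ∈ b -> c a b = i]].

Record vocabulary : Type := Vocabulary {
  fsym : Type; farity : fsym -> nat;
  rsym : Type; rarity : rsym -> nat }.

Record structure (tau : vocabulary) : Type := Structure {
  univ : ZF;
  fint : forall s : fsym tau, ('I_(farity s) -> set_type univ) -> set_type univ;
  rint : forall r : rsym tau, ('I_(rarity r) -> set_type univ) -> Prop }.

Coercion univ : structure >-> ZF.

Section Structures.
Variable tau : vocabulary.
Implicit Types M N U : structure tau.

Definition embedding (f : ZF -> ZF) M N : Prop :=
  [/\ set_fun M N f, set_inj M f,
      forall (s : fsym tau) (a : 'I_(farity s) -> set_type M) b,
        (forall i, val (b i) = f (val (a i))) ->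
        val (@fint tau N s b) = f (val (@fint tau M s a)) &
      forall (r : rsym tau) (a : 'I_(rarity r) -> set_type M) b,
        (forall i, val (b i) = f (val (a i))) ->
        @rint tau N r b <-> @rint tau M r a].

Definition isomorphism (f : ZF -> ZF) M N : Prop :=
  embedding f M N /\ set_surj M N f.

Definition substructure M N : Prop := embedding id M N.

(* U is the union of the chain (M i), i < d. *)
Definition is_union (d : ZF) (M : ZF -> structure tau) U : Prop :=
  (forall x, x ∈ U <-> exists2 i, i ∈ d & x ∈ M i) /\
  (forall i, i ∈ d -> substructure (M i) U).

(* (M i), i < d, is le-increasing and continuous; the values of M outside d
   are irrelevant. *)
Definition inc_continuous (le : structure tau -> structure tau -> Prop)
    (d : ZF) (M : ZF -> structure tau) : Prop :=
  (forall i j, j ∈ d -> i ∈ j -> le (M i) (M j)) /\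
  (forall j, j ∈ d -> limit j -> is_union j M (M j)).

Definition lst_bound (K : structure tau -> Prop)
    (le : structure tau -> structure tau -> Prop) (l : ZF) : Prop :=
  [/\ cardinal l,
      [set: fsym tau] ⊎ [set: rsym tau] ⊎ [set: nat] #<= l &
      forall N (A : set ZF), K N -> A `<=` N ->
        exists M, [/\ le M N, A `<=` M & M #<= l ⊎ A]].

End Structures.

(* The last axiom is the convention that an empty model is allowed, but only
   as a model that is below every other one. *)
Record aec (tau : vocabulary) : Type := AEC {
  K : structure tau -> Prop;
  le : structure tau -> structure tau -> Prop;
  K_iso : forall f M N, K M -> isomorphism f M N -> K N;
  le_iso : forall f M M' N N', le M N ->
    isomorphism f N N' -> isomorphism f M M' -> le M' N';
  le_sub : forall M N, le M N -> [/\ K M, K N & substructure M N];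
  le_refl : forall M, K M -> le M M;
  le_trans : forall M N P, le M N -> le N P -> le M P;
  le_union : forall d M U, limit d -> inc_continuous le d M ->
    is_union d M U -> forall i, i ∈ d -> le (M i) U;
  union_le : forall d M U N, limit d -> inc_continuous le d M ->
    is_union d M U -> (forall i, i ∈ d -> le (M i) N) -> le U N;
  le_coherent : forall M0 M1 N,
    substructure M0 M1 -> le M0 N -> le M1 N -> le M0 M1;
  ex_lst_bound : exists l, lst_bound K le l;
  empty_le : forall M N, K M -> K N -> (M : set ZF) = set0 -> le M N }.

Section AEC.
Variables (tau : vocabulary) (k : aec tau).
Implicit Types M N : structure tau.

Definition LST_number (l : ZF) : Prop :=
  lst_bound (K k) (le k) l /\
  forall m, lst_bound (K k) (le k) m -> l `<=` m.

Definition K_card (l : ZF) M : Prop := K k M /\ M #= l.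

Definition le_embedding (f : ZF -> ZF) M N : Prop :=
  exists2 M', isomorphism f M M' & le k M' N.

Definition embeds_over M0 M N : Prop :=
  exists2 f, le_embedding f M N & forall x, x ∈ M0 -> f x = x.

(* The notion is only considered for chi1, chi2 >= ||M0||, which is therefore
   part of the definition; likewise for the regularity of theta below. *)
Definition amalgamation_base (chi1 chi2 : ZF) M0 : Prop :=
  [/\ K k M0, M0 #<= chi1, M0 #<= chi2 &
      forall M1 M2, le k M0 M1 -> K_card chi1 M1 ->
        le k M0 M2 -> K_card chi2 M2 ->
        exists M3, [/\ le k M0 M3, embeds_over M0 M1 M3 &
                       embeds_over M0 M2 M3]].

(* The universe of M is an ordinal in [l, l^+). *)
Definition majority_dom (l : ZF) M : Prop :=
  [/\ K k M, ordinal M, l `<=` M & lt_succ_card M l].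

Definition majority (theta l : ZF) (psi : structure tau -> Prop) : Prop :=
  regular theta /\
  exists F : structure tau -> structure tau,
    (forall M, majority_dom l M -> le k M (F M) /\ majority_dom l (F M)) /\
    (forall M : ZF -> structure tau,
       inc_continuous (le k) (succ theta) M ->
       (forall a, a ∈ succ theta -> majority_dom l (M a)) ->
       (forall a, a ∈ theta ->
          M (succ (succ (double a))) = F (M (succ (double a)))) ->
       psi (M theta)).

Definition has_amalgamation_bases2 (chi1 chi2 l theta : ZF) : Prop :=
  majority theta l (amalgamation_base chi1 chi2).

Definition has_amalgamation_bases (l theta : ZF) : Prop :=
  has_amalgamation_bases2 l l l theta.

End AEC.

(* Main.v *)
(** Reduced products of models.  Let [D] be a filter closed under
   intersections of [LST] many sets, and let [P i] be models.  A set of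
   functions [t] with [t i ∈ P i] that is closed under the vocabulary, and
   about which [D] decides every atomic statement, has a quotient modulo [D].
   If moreover these functions are organised in enumerations of length [LST]
   of small strong submodels of the [P i], then the quotient is a directed
   union of copies of such submodels, so it belongs to the class; no
   presentation theorem and no counting of small models is needed.
   Consequently, if larger and larger parts of [N1] and [N2] amalgamate over
   larger and larger parts of [M], then [N1] and [N2] amalgamate over [M].

   (3): [M_theta] is the union of amalgamation bases, and a [theta]-complete
   ultrafilter on [theta] glues the amalgams over them.

   (1), (2): by (3) it suffices that amalgamation bases are dense.  Every model
   extends to one that is existentially closed for its small submodels along a
   resolution of length [kappa]; over such a model any [N1] is approximated
   inside [N2], and the approximations are glued along [kappa].  When [kappa] is
   only weakly compact there is no ultrafilter, but the end segments of a set
   homogeneous for the lexicographic colouring decide [kappa] many statements. *)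

From mathcomp Require Import all_boot finmap all_classical wochoice.
Require Import Defs.

Set Implicit Arguments.
Unset Strict Implicit.
Unset Printing Implicit Defensive.

Local Open Scope classical_set_scope.
Local Open Scope card_scope.

(** * Cardinalities *)

(** A weakly compact [kappa] has filters that decide only [kappa] many sets, and the filter depends
    on these sets. The reduced product is therefore cut down to few functions before a filter is
    chosen: [nu] points have [nu] finite subsets, each finite subset contributes [l] functions, and
    [nu] functions have [nu] atomic statements. The relation [le] is not expressed by atomic
    statements. It passes to the quotient because the filter is closed under [l] intersections: the
    whole diagram of a tuple of length [l] is then the same in the quotient and at a single index,
    and [le] is copied from that index.

    In the density argument the strong limit hypothesis bounds by [c] the number of small extensions
    of a small model, so that all of them can be treated along a chain of length [c]. *)

Lemma choice_ex X Y (P : X -> Y -> Prop) :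
  (forall x, exists y, P x y) -> exists f, forall x, P x (f x).
Proof. by move=> /choice[f fP]; exists f. Qed.

(** A relation with functional converse replaces an explicit injection, so that callers need neither
    choose images nor define them off [A]. *)
Lemma card_le_rel T U (A : set T) (B : set U) (R : T -> U -> Prop) :
  (forall x, A x -> exists2 u, B u & R x u) ->
  (forall x y u, A x -> A y -> R x u -> R y u -> x = y) -> A #<= B.
Proof.
move=> AB Rinj; have [[x1 x1A]|A0] := pselect (A !=set0); last first.
  suff -> : A = set0 by exact: card_ge0.
  by apply/seteqP; split=> // x Ax; case: A0; exists x.
have [u0 _ _] := AB _ x1A.
have [f fP] : exists f, forall x, A x -> B (f x) /\ R x (f x).
  suff H : forall x, exists u, A x -> B u /\ R x u by have [f fP] := choice_ex H; exists f.
  move=> x.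
  have [/AB[u Bu Rxu]|nAx] := pselect (A x); first by exists u.
  by exists u0 => /nAx.
apply/card_leP/injfunPex.
exists (fun x : set_type A => SigSub (mem_set (fP _ (set_valP x)).1)) => //.
move=> x y _ _ /(congr1 val)/= fxy; apply/val_inj.
by apply: (Rinj _ _ (f (val x))); [exact: set_valP|exact: set_valP|
  exact: (fP _ (set_valP x)).2|rewrite fxy; exact: (fP _ (set_valP y)).2].
Qed.

Lemma card_le_inj T U (A : set T) (B : set U) (f : T -> U) :
  (forall x, A x -> B (f x)) ->
  (forall x y, A x -> A y -> f x = f y -> x = y) -> A #<= B.
Proof.
move=> AB fi; apply: (@card_le_rel _ _ A B (fun x u => f x = u)) => [x Ax|].
  by exists (f x) => //; exact: AB.
by move=> x y u Ax Ay <- /esym; exact: fi.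
Qed.

Lemma card_le_surj T U (A : set T) (B : set U) (f : U -> T) :
  (forall x, A x -> exists2 u, B u & f u = x) -> A #<= B.
Proof.
by move=> AB; apply: (@card_le_rel _ _ A B (fun x u => f u = x)) => // x y u _ _ -> .
Qed.

Lemma card_le_ex T U (u0 : U) (A : set T) (B : set U) : A #<= B ->
  exists2 f : T -> U, (forall x, A x -> B (f x)) &
    (forall x y, A x -> A y -> f x = f y -> x = y).
Proof.
move=> /card_leP/injfunPex[f _ fi].
exists (fun x => if pselect (A x) is left Ax then val (f (SigSub (mem_set Ax))) else u0).
  by move=> x Ax; case: pselect => // ?; exact: set_valP.
move=> x y Ax Ay; case: pselect => // ?; case: pselect => // ? /val_inj/fi.
by rewrite !inE => /(_ I I)/(congr1 val).
Qed.

Lemma card_le_onto T U (A : set T) (B : set U) : A #<= B -> A !=set0 ->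
  exists2 f : U -> T, (forall u, A (f u)) & (forall x, A x -> exists2 u, B u & f u = x).
Proof.
move=> /card_leP/injfunPex[f _ fi] [x0 Ax0].
(* The surjection has to be total with values in [A]: [x] is the preimage of [u] if there is one,
   and any point of [A] otherwise. *)
pose R (u : U) (x : T) := A x /\ ((exists a : set_type A, val (f a) = u) ->
  exists a : set_type A, val a = x /\ val (f a) = u).
have [g gP] : exists g, forall u, R u (g u).
  apply: choice_ex => u; have [[a ua]|nu] := pselect (exists a : set_type A, val (f a) = u).
    by exists (val a); split; [exact: set_valP|move=> _; exists a].
  by exists x0.
exists g => [u|x Ax]; first exact: (gP u).1.
pose a : set_type A := SigSub (mem_set Ax); exists (val (f a)); first exact: set_valP.
have [|b [bE]] := (gP (val (f a))).2; first by exists a.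
by move=> /val_inj/fi fab; rewrite -bE fab ?inE.
Qed.

Lemma card_eq_le2 T U (A : set T) (B : set U) : A #<= B -> B #<= A -> A #= B.
Proof. by move=> AB BA; apply/card_eqPle; rewrite AB BA. Qed.

Lemma card_eq_lel T U (A : set T) (B : set U) : A #= B -> A #<= B.
Proof. by rewrite card_eq_le => /andP[]. Qed.

Lemma card_eq_ler T U (A : set T) (B : set U) : A #= B -> B #<= A.
Proof. by rewrite card_eq_le => /andP[]. Qed.

Lemma card_lt_not T U (A : set T) (B : set U) : A #< B <-> ~ (B #<= A).
Proof. by split=> /negP. Qed.

Lemma card_le_lt T U V (A : set T) (B : set U) (C : set V) :
  A #<= B -> B #< C -> A #< C.
Proof.
by move=> AB /card_lt_not BC; apply/card_lt_not => CA; exact/BC/(card_le_trans CA AB).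
Qed.

Lemma dsum_lel T U (A : set T) (B : set U) : A #<= A ⊎ B.
Proof. by apply: (@card_le_inj _ _ _ _ inl) => // x y _ _ []. Qed.

Lemma dsum_ler T U (A : set T) (B : set U) : B #<= A ⊎ B.
Proof. by apply: (@card_le_inj _ _ _ _ inr) => // x y _ _ []. Qed.

Lemma setX_mono T U T' U' (A : set T) (B : set U) (A' : set T') (B' : set U') :
  A #<= A' -> B #<= B' -> A `*` B #<= A' `*` B'.
Proof.
move=> /card_leP/injfunPex[f _ fi] /card_leP/injfunPex[g _ gi].
pose R (z : T * U) (w : T' * U') :=
  (exists a : set_type A, val a = z.1 /\ val (f a) = w.1) /\
  (exists a : set_type B, val a = z.2 /\ val (g a) = w.2).
apply: (@card_le_rel _ _ _ _ R) => [[x y]/= [/= Ax Ay]|].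
  exists (val (f (SigSub (mem_set Ax))), val (g (SigSub (mem_set Ay)))).
    by split; exact: set_valP.
  by split; [exists (SigSub (mem_set Ax))|exists (SigSub (mem_set Ay))].
move=> [x1 x2] [y1 y2] [u1 u2] _ _ [/= [a [<- <-]] [b [<- <-]]] [/= [a' [<- /val_inj e1]]
  [b' [<- /val_inj e2]]].
by rewrite (fi _ _ _ _ e1) ?inE// (gi _ _ _ _ e2) ?inE.
Qed.

(** * Sets and ordinals *)

(** [setof] is [empty] on a proper class, so each use of it rests on this predicate. *)
Definition is_set (P : set ZF) := exists x : ZF, forall y, y ∈ x <-> P y.

Lemma setofE P : is_set P -> forall y, y ∈ setof P <-> P y.
Proof. by move=> xP; rewrite /setof; case: pselect => // e; exact: (projT2 (cid e)). Qed.

Lemma is_set_sub (x : ZF) (P : set ZF) : P `<=` x -> is_set P.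
Proof.
move=> Px; have [[A f] xE] := clsP x.
have [z zE] := ZF_small (fun a : {a : A | P (cls (f a))} => cls (f (projT1 a))).
exists z => y; rewrite zE; split=> [[[a Pa] ->]//|Py].
have := Px _ Py; rewrite xE => /in_cls[a aE]; rewrite aE in Py *.
by exists (exist _ a Py).
Qed.

Lemma is_set_image (x : ZF) (F : ZF -> ZF) : is_set (F @` x).
Proof.
have [[A f] xE] := clsP x.
have [z zE] := ZF_small (fun a => F (cls (f a))).
exists z => y; rewrite zE; split=> [[a ->]|[w]].
  by exists (cls (f a)) => //; rewrite xE in_cls; exists a.
by rewrite {1}xE => /in_cls[a ->] <-; exists a.
Qed.

Lemma is_set_subset P Q : P `<=` Q -> is_set Q -> is_set P.
Proof. by move=> PQ [x xQ]; apply: (@is_set_sub x) => y /PQ/xQ. Qed.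

(** Replacement for index types as large as [ZF], which are beyond the universe of [ZF_small]: the
    bound by a set [x] lets [x] serve as the index instead. *)
Lemma is_set_imageT T (X : set T) (x : ZF) (F : T -> ZF) : X #<= x -> is_set (F @` X).
Proof.
move=> Xx; have [x0|[x0 Xx0]] : F @` X `<=` set0 \/ X !=set0.
  have [[t Xt]|nX] := pselect (X !=set0); [by right; exists t|left => y [t Xt]].
  by case: nX; exists t.
  by apply: (@is_set_sub empty) => y /x0.
have FX : F @` X #<= x by apply: card_le_trans Xx; exact: card_image_le.
have [|g _ gP] := card_le_onto FX; first by exists (F x0), x0.
 apply: is_set_subset (is_set_image x g) => y /gP[u ux <-].
by exists u.
Qed.

Lemma is_set_bigcup (x : ZF) (F : ZF -> ZF) : is_set (\bigcup_(i in x) F i).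
Proof.
have [[A f] xE] := clsP x.
have [h hE] := choice (fun a : A => clsP (F (cls (f a)))).
have H (a : A) : exists Bg : {B : Type & B -> tree}, h a = Sup (projT2 Bg).
  by case: (h a) => B g; exists (existT _ B g).
have [k kE] := choice H.
have [z zE] := ZF_small (fun p : {a : A & projT1 (k a)} => cls (projT2 (k (projT1 p)) (projT2 p))).
exists z => y; rewrite zE; split=> [[[a b] ->]|[w]] /=.
  exists (cls (f a)); first by rewrite /= xE; apply/in_cls; exists a.
  by rewrite /= hE kE; apply/in_cls; exists b.
rewrite {1}xE => /in_cls[a ->]; rewrite hE kE => /in_cls[b ->].
by exists (existT _ a b).
Qed.

Lemma is_set2 x y : is_set [set x; y].
Proof.
have [z zE] := ZF_small (fun b : bool => if b then x else y).
exists z => w; rewrite zE; split=> [[[] ->]|[] ->]; [by left|by right| |].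
  by exists true.
by exists false.
Qed.

Lemma mem_irr x : ~ x ∈ x.
Proof. by elim/(well_founded_ind mem_wf): x => x IH xx; exact: (IH x). Qed.

Lemma mem_asym x y : x ∈ y -> ~ y ∈ x.
Proof.
by elim/(well_founded_ind mem_wf): x y => x IH y xy yx; exact: (IH y yx x yx xy).
Qed.

Lemma in_empty x : ~ x ∈ empty.
Proof. by move/in_cls => [[]]. Qed.

Lemma ord_in a b : ordinal a -> b ∈ a -> ordinal b.
Proof. by move=> [ta tta] ba; split; [exact: tta|move=> c cb; exact/tta/(ta _ ba)]. Qed.

Lemma ord_trans a b c : ordinal a -> c ∈ b -> b ∈ a -> c ∈ a.
Proof. by move=> [ta _] cb /ta; exact. Qed.

Lemma ord_total a b : ordinal a -> ordinal b -> [\/ a ∈ b, a = b | b ∈ a].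
Proof.
elim/(well_founded_ind mem_wf): a b => a IHa; elim/(well_founded_ind mem_wf) => b IHb oa ob.
have [?|nab] := pselect (a ∈ b); first by constructor 1.
have [?|nba] := pselect (b ∈ a); first by constructor 3.
constructor 2; apply: ZF_ext => c; split => [ca|cb].
  have [//|cE|bc] := IHa _ ca b (ord_in oa ca) ob.
    by rewrite cE in ca.
  by case: nba; exact: ord_trans bc ca.
have [ac|cE|//] := IHb _ cb oa (ord_in ob cb).
  by case: nab; exact: ord_trans ac cb.
by rewrite -cE in cb.
Qed.

Lemma ord_sub (a b : ZF) : ordinal a -> ordinal b -> a `<=` b -> a ∈ b \/ a = b.
Proof.
move=> oa ob ab; have [|->|/ab/mem_irr//] := ord_total oa ob; first by left.
by right.
Qed.

Lemma ord_in_sub a b : ordinal b -> a ∈ b -> (a : set ZF) `<=` b.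
Proof. by move=> [tb _]; exact: tb. Qed.

Lemma ord_nin_sub a b : ordinal a -> ordinal b -> ~ a ∈ b -> (b : set ZF) `<=` a.
Proof.
by move=> oa ob nab; have [//|->//|ba] := ord_total oa ob; exact: ord_in_sub.
Qed.

Lemma ord_succ a : ordinal a -> ordinal (succ a).
Proof.
move=> oa; split=> [y /in_succ[ya|->] z zy|y /in_succ[ya|->]].
- by apply/in_succ; left; exact: ord_trans zy ya.
- by apply/in_succ; left.
- exact: (ord_in oa ya).1.
- exact: oa.1.
Qed.

Lemma succ_self a : a ∈ succ a. Proof. by apply/in_succ; right. Qed.

Lemma succ_sub (a : ZF) : (a : set ZF) `<=` succ a.
Proof. by move=> x xa; apply/in_succ; left. Qed.

Lemma succ_inj a b : succ a = succ b -> a = b.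
Proof.
move=> ab; have : a ∈ succ b by rewrite -ab; exact: succ_self.
have : b ∈ succ a by rewrite ab; exact: succ_self.
by move=> /in_succ[ba /in_succ[/(mem_asym ba)|]|->].
Qed.

Lemma succ_in_le a b : ordinal b -> a ∈ b -> succ a ∈ b \/ succ a = b.
Proof.
move=> ob ab; apply: ord_sub => //; first exact/ord_succ/(ord_in ob).
by move=> x /in_succ[xa|->//]; exact: ord_trans xa ab.
Qed.

Lemma ord_succ_mono a b : ordinal b -> a ∈ b -> succ a ∈ succ b.
Proof. by move=> ob ab; apply/in_succ; exact: succ_in_le. Qed.

Lemma ord_cases a : ordinal a ->
  [\/ a = empty, exists2 b, ordinal b & a = succ b | limit a].
Proof.
move=> oa; have [->|a0] := pselect (a = empty); first by constructor 1.
have [[b ba sb]|nb] := pselect (exists2 b, b ∈ a & ~ succ b ∈ a).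
  by constructor 2; exists b; [exact: ord_in ba|have [//|] := succ_in_le oa ba].
constructor 3; split=> //.
  apply: contrapT => na; apply: a0; apply: ZF_ext => x.
  by split=> [xa|/in_empty//]; case: na; exists x.
by move=> b ba; apply: contrapT => sb; apply: nb; exists b.
Qed.

Lemma ord_empty : ordinal empty.
Proof. by split=> x /in_empty. Qed.

Lemma limit_not_succ b : ~ limit (succ b).
Proof. by move=> [_ _ /(_ b (succ_self b))/mem_irr]. Qed.

Lemma limit_not_empty : ~ limit empty.
Proof. by move=> [_ [x /in_empty]]. Qed.

Lemma limit_empty d : limit d -> empty ∈ d.
Proof.
by move=> [od [a ad] _]; have [//|dE|/in_empty//] := ord_total ord_empty od;
  rewrite -dE in ad; move/in_empty: ad.
Qed.

Lemma ord_least (P : set ZF) (a : ZF) : ordinal a -> P a ->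
  exists b, [/\ ordinal b, P b & forall c, c ∈ b -> ~ P c].
Proof.
elim/(well_founded_ind mem_wf): a => a IH oa Pa.
have [[b ba Pb]|nb] := pselect (exists2 b, b ∈ a & P b).
  exact: (IH b ba (ord_in oa ba) Pb).
by exists a; split=> // c ca Pc; apply: nb; exists c.
Qed.

Lemma ord_of_set (P : set ZF) : is_set P -> (forall x, P x -> ordinal x) ->
  (forall x y, P x -> y ∈ x -> P y) -> ordinal (setof P).
Proof.
move=> sP oP tP; split=> [y /(setofE sP) Py z zy|y /(setofE sP)/oP[]//].
by apply/setofE => //; exact: tP zy.
Qed.

Section Collapse.
Variables (T : Type) (lt : T -> T -> Prop) (bd : T -> ZF).
Hypothesis lt_wf : well_founded lt.
Hypothesis lt_small : forall y, [set z | lt z y] #<= bd y.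

(** Mostowski collapse. By [lt_small] the ranks below a point form a set, even if [T] is as large as
    [ZF]. *)
Definition rank : T -> ZF :=
  Fix lt_wf (fun _ => ZF) (fun y rec =>
    setof [set w | exists z (zy : lt z y), w = rec z zy]).

Lemma in_rank y w : w ∈ rank y <-> exists2 z, lt z y & w = rank z.
Proof.
rewrite {1}/rank Fix_eq -/rank; last first.
  move=> x f g fg; congr setof; apply/predeqP => v /=.
  by split=> -[z [zx ->]]; exists z, zx; rewrite fg.
rewrite setofE; first by split=> [[z [zy ->]]|[z zy ->]]; [exists z|exists z, zy].
apply: is_set_subset (is_set_imageT rank (lt_small y)) => v [z [zy ->]].
by exists z.
Qed.

Hypothesis lt_trans : forall x y z, lt x y -> lt y z -> lt x z.

Lemma rank_ord y : ordinal (rank y).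
Proof.
have tr x : transitive_set (rank x).
  move=> w /in_rank[z zx ->] v /in_rank[u uz ->].
  by apply/in_rank; exists u => //; exact: lt_trans zx.
by split=> // w /in_rank[z _ ->].
Qed.

Variable X : set T.
Hypothesis lt_total : forall x y, X x -> X y -> [\/ lt x y, x = y | lt y x].

Lemma rank_mono x y : lt x y -> rank x ∈ rank y.
Proof. by move=> xy; apply/in_rank; exists x. Qed.

Lemma rank_inj x y : X x -> X y -> rank x = rank y -> x = y.
Proof.
move=> Xx Xy xy; have [/rank_mono|//|/rank_mono] := lt_total Xx Xy.
  by rewrite xy => /mem_irr.
by rewrite xy => /mem_irr.
Qed.

Hypothesis lt_dom : forall x y, lt x y -> X x.

Lemma rank_image (Y : ZF) : X #<= Y ->
  exists2 a, ordinal a & forall w, w ∈ a <-> exists2 x, X x & w = rank x.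
Proof.
move=> XY; have sX := is_set_imageT rank XY.
exists (setof (rank @` X)); last first.
  by move=> w; rewrite setofE//; split=> [[x Xx <-]|[x Xx ->]]; exists x.
apply: ord_of_set => //.
  by move=> _ [x _ <-]; exact: rank_ord.
by move=> _ w [x Xx <-] /in_rank[z zx ->]; exists z => //; exact: lt_dom zx.
Qed.

End Collapse.

(** The principle supplies a unique least element in each nonempty set. Applied to sets of one, two
    and three points, it makes [R] reflexive, total, antisymmetric and transitive; the strict part
    is then the order wanted. *)
Lemma wo_rel (T : Type) : exists lt : T -> T -> Prop,
  [/\ well_founded lt, forall x y z, lt x y -> lt y z -> lt x z &
      forall x y, [\/ lt x y, x = y | lt y x]].
Proof.
have [R Rwo] := well_ordering_principle {classic T}.
have Rmin (P : set T) : P !=set0 ->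
    exists z, [/\ P z, forall x, P x -> R z x & forall y, P y -> (forall x, P x -> R y x) -> z = y].
  move=> [x Px]; have [|z [[zP lz] uz]] := Rwo [pred x : {classic T} | `[< P x >]].
    by exists x; apply/asboolP.
  exists z; split=> [|y Py|y Py ly]; first by move: zP => /asboolP.
    by apply: lz; apply/asboolP.
  apply: uz; split; first by apply/asboolP.
  by move=> w /asboolP; exact: ly.
have Rxx x : R x x by have [|z [->]] := Rmin [set x]; [exists x|move=> /(_ _ erefl)].
have Rtot x y : R x y \/ R y x.
  have [|z [+ zP _]] := Rmin [set x; y]; first by exists x; left.
  by move=> [zE|zE]; rewrite zE in zP; [left|right]; apply: zP; [right|left].
have Ranti x y : R x y -> R y x -> x = y.
  move=> xy yx; have [|z [_ _ uz]] := Rmin [set x; y]; first by exists x; left.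
  rewrite -(uz x); [|by left|by move=> w [] ->].
  by apply: uz; [right|move=> w [] ->].
exists (fun x y => R x y /\ x <> y); split.
- move=> x; apply: contrapT => nx.
  have [|z [nz zP _]] := Rmin [set x | ~ Acc (fun x y => R x y /\ x <> y) x]; first by exists x.
  apply: nz; constructor => y [yz yNz]; apply: contrapT => ny.
  exact/yNz/Ranti/zP.
- move=> x y z [xy xNy] [yz yNz].
  have [|m [+ mP _]] := Rmin [set x; y; z]; first by exists x; left; left.
  have [mx my mz] : [/\ R m x, R m y & R m z].
    by split; apply: mP; [left; left|left; right|right].
  move=> [[mE|mE]|mE]; rewrite {}mE {m mP} in mx my mz.
  + by split=> // xz; rewrite -xz in yz; apply: xNy; exact: Ranti.
  + by case: xNy; exact: Ranti.
  + by case: yNz; exact: Ranti.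
- move=> x y; have [->|xy] := pselect (x = y); first by constructor 2.
  have [Rxy|Ryx] := Rtot x y; first by constructor 1.
  by constructor 3; split=> // /esym.
Qed.

(** The order [R] puts [m] first, in its own order, so that the collapse is the identity on [m]. A
    model whose universe is an ordinal thus stays fixed when an extension of it is renamed to have
    an ordinal universe. *)
Lemma ordinal_numbering (m x : ZF) : ordinal m -> m `<=` x ->
  exists a (f : ZF -> ZF), [/\ ordinal a, forall y, y ∈ x -> f y ∈ a,
    forall y z, y ∈ x -> z ∈ x -> f y = f z -> y = z,
    forall w, w ∈ a -> exists2 y, y ∈ x & f y = w &
    forall y, y ∈ m -> f y = y].
Proof.
move=> om mx; have [lt [ltw ltt ltot]] := wo_rel ZF.
pose R y z := [/\ y ∈ x, z ∈ x & (z ∈ m /\ y ∈ z) \/ (~ z ∈ m /\ (y ∈ m \/ lt y z))].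
have Rw : well_founded R.
  have Am y : y ∈ m -> Acc R y.
    elim/(well_founded_ind mem_wf): y => y IH ym.
    by constructor=> z [_ _ [[_ zy]|[]//]]; apply: IH => //; exact: ord_trans ym.
  move=> y; have [/Am//|] := pselect (y ∈ m).
  elim/(well_founded_ind ltw): y => y IH ym.
  constructor=> z [_ _ [[/ym]//|[_ [/Am//|zy]]]].
  by have [/Am//|zm] := pselect (z ∈ m); exact: IH.
have Rs y : [set z | R z y] #<= x by apply: subset_card_le => z [].
have Rt y z w : R y z -> R z w -> R y w.
  move=> [yx zx yz] [_ wx zw]; split=> //.
  case: zw yz => [[wm zw]|[wm [zm|zw]]].
  - have zm : z ∈ m by exact: ord_trans wm.
    case=> [[_ yz]|[]//]; left; split=> //.
    by apply: ord_trans zw => //; exact: ord_in wm.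
  - by case=> [[_ yz]|[]//]; right; split=> //; left; exact: ord_trans zm.
  - case=> [[zm yz]|[zm [ym|yz]]]; right; split=> //.
    + by left; exact: ord_trans zm.
    + by left.
    + by right; exact: ltt zw.
have Rtot y z : y ∈ x -> z ∈ x -> [\/ R y z, y = z | R z y].
  move=> yx zx; have [ym|ym] := pselect (y ∈ m); have [zm|zm] := pselect (z ∈ m).
  - have [yz|->|zy] := ord_total (ord_in om ym) (ord_in om zm).
    + by constructor 1; split=> //; left.
    + by constructor 2.
    + by constructor 3; split=> //; left.
  - by constructor 1; split=> //; right; split=> //; left.
  - by constructor 3; split=> //; right; split=> //; left.
  - have [yz|->|zy] := ltot y z.
    + by constructor 1; split=> //; right; split=> //; right.
    + by constructor 2.
    + by constructor 3; split=> //; right; split=> //; right.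
have [|a oa aP] := rank_image Rw Rs Rt (X := x) _ (card_lexx x).
  by move=> y z [].
exists a, (rank Rw); split=> //.
- by move=> y yx; apply/aP; exists y.
- by move=> y z; exact: (rank_inj Rs Rtot).
- by move=> w /aP[y yx ->]; exists y.
- elim/(well_founded_ind mem_wf) => y IH ym; apply: ZF_ext => w; rewrite (in_rank Rw Rs).
  split=> [[z [zx _ [[_ zy]|[]//]] ->]|wy].
    by rewrite IH//; exact: ord_trans ym.
  have wm : w ∈ m by exact: ord_trans ym.
  exists w; last by rewrite IH.
  by split; [exact: mx|exact: mx|left].
Qed.

(** New elements of [A] are picked by recursion along [l], with [x0] as a default when none is left.
    Either this never stops and injects [l] into [A], or the values below some [a] in [l] exhaust
    [A]. *)
Lemma card_total T (l : ZF) (A : set T) : ordinal l ->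
  l #<= A \/ exists2 a, a ∈ l & A #<= a.
Proof.
move=> ol; have [[x0 Ax0]|A0] := pselect (A !=set0); last first.
  have -> : A = set0 by apply/seteqP; split=> // x Ax; case: A0; exists x.
  have [[a al]|nl] := pselect (l !=set0).
    by right; exists a => //; exact: card_ge0.
  left; rewrite (_ : (l : set ZF) = set0) ?card_ge0//.
  by apply/seteqP; split=> // x Ax; case: nl; exists x.
have [f fE] : exists f : ZF -> T, forall a,
    (exists2 x, A x & forall b, b ∈ a -> f b <> x) ->
    A (f a) /\ forall b, b ∈ a -> f b <> f a.
  pose step a (rec : forall b, b ∈ a -> T) (x : T) :=
    A x /\ forall b (ba : b ∈ a), rec b ba <> x.
  pose pick a (rec : forall b, b ∈ a -> T) : T :=
    if pselect (exists x, step a rec x) is left h then projT1 (cid h) else x0.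
  have [F FE] : exists F : ZF -> T, forall a, F a = pick a (fun b _ => F b).
    exists (Fix mem_wf (fun=> T) pick) => a; rewrite Fix_eq// => y g h gh.
    rewrite (_ : g = h)//; apply: functional_extensionality_dep => b.
    by apply: functional_extensionality_dep => by_; exact: gh.
  exists F => a [x Ax xP]; rewrite FE /pick.
  case: pselect => [h|[]]; last by exists x; split=> // b /xP.
  by have [? hP] := projT2 (cid h); split=> // b ba; exact: hP.
have [[a al na]|H] := pselect (exists2 a, a ∈ l &
    ~ exists2 x, A x & forall b, b ∈ a -> f b <> x).
  right; exists a => //; apply: (@card_le_surj _ _ _ _ f) => x Ax.
  apply: contrapT => nx; apply: na; exists x => // b ba bx; apply: nx.
  by exists b.
left; have {}H a : a ∈ l -> A (f a) /\ forall b, b ∈ a -> f b <> f a.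
  by move=> al; apply: fE; apply: contrapT => na; apply: H; exists a.
apply: (@card_le_inj _ _ _ _ f) => [a /H[]//|a b al bl fab].
have [ab|//|ba] := ord_total (ord_in ol al) (ord_in ol bl).
  by case: (H b bl) => _ /(_ _ ab).
by case: (H a al) => _ /(_ _ ba); rewrite fab.
Qed.

Lemma card_lt_bound T (l : ZF) (A : set T) : ordinal l -> A #< l ->
  exists2 a, a ∈ l & A #<= a.
Proof. by move=> ol /card_lt_not nA; have [/nA|//] := card_total A ol. Qed.

Lemma ord_card_eq (x : ZF) : exists2 a, ordinal a & x #= a.
Proof.
have [a [f [oa fa fi fs _]]] := ordinal_numbering ord_empty (x :=
  x) (fun y ye => False_ind _ (in_empty ye)).
exists a => //; apply: card_eq_le2; first exact: card_le_inj fi.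
by rewrite (_ : (a : set ZF) = f @` x) ?card_image_le//; apply/seteqP;
  split=> [w /fs//|_ [y /fa ? <-]].
Qed.

Lemma card_cardinal (x : ZF) : exists2 c, cardinal c & x #= c.
Proof.
have [a oa xa] := ord_card_eq x.
have [c [oc xc cmin]] := ord_least (P := fun c : ZF => x #= c) oa xa.
exists c => //; split=> // b bc; apply/card_lt_not => cb.
apply: (cmin _ bc); apply: card_eq_trans xc _; apply: card_eq_le2 => //.
by apply: subset_card_le; exact: ord_in_sub.
Qed.

Lemma cardinal_lt (c a : ZF) : cardinal c -> a ∈ c -> a #< c.
Proof. by move=> [_]; exact. Qed.

Lemma cardinal_in (c a : ZF) : cardinal c -> ordinal a -> a #< c -> a ∈ c.
Proof.
move=> [oc _] oa /card_lt_not ac; apply: contrapT => /(ord_nin_sub oa oc) ca.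
by apply: ac; exact: subset_card_le.
Qed.

Lemma cardinal_sub (c d : ZF) : cardinal c -> ordinal d -> c #<= d -> c `<=` d.
Proof.
move=> [oc cP] od cd; apply: ord_nin_sub => //= dc.
by have /card_lt_not[] := cP _ dc.
Qed.

Lemma infinite_le T U (A : set T) (B : set U) : infinite_set A -> A #<= B -> infinite_set B.
Proof. by move=> iA AB fB; apply: iA; exact: card_le_finite AB fB. Qed.

(** Hilbert's hotel: on a copy [f] of the natural numbers inside [m] every point moves up by one,
    and the new point [m] takes the place [f 0]. *)
Lemma succ_card_le (m : ZF) : infinite_set m -> succ m #<= m.
Proof.
move=> /infiniteP/(card_le_ex empty)[f fm fi].
pose R x y := [\/ x = m /\ y = f 0%N, exists2 n, x = f n & y = f n.+1 |
  [/\ x = y, x ∈ m & forall n, x <> f n]].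
apply: (@card_le_rel _ _ _ _ R) => [x /in_succ[xm|->]|x y u _ _].
- have [[n xE]|nx] := pselect (exists n, x = f n).
    by exists (f n.+1); [exact: fm|constructor 2; exists n].
  by exists x => //; constructor 3; split=> // n xE; apply: nx; exists n.
- by exists (f 0%N); [exact: fm|constructor 1].
case=> [[-> ->]|[n -> ->]|[<- xm xn]]; case=> [[->]|[k ->]|[-> ym yn]] //.
- by move=> /(fi _ _ I I).
- by case: (yn 0%N).
- by move=> /(fi _ _ I I).
- by move=> /(fi _ _ I I) [->].
- by case: (yn n.+1).
- by move=> /xn.
- by move=> /xn.
Qed.

Lemma infinite_cardinal_limit (c : ZF) : cardinal c -> infinite_set c -> limit c.
Proof.
move=> cc ic; have [oc cP] := cc; split=> //; first by have [a] := infinite_setN0 ic; exists a.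
move=> m mc; have [//|smc] := succ_in_le oc mc.
have im : infinite_set m.
  move=> fm; apply: ic; rewrite -smc.
  rewrite (_ : elts (succ m) = m `|` [set m]); first by rewrite finite_setU.
  by apply/seteqP; split=> y /in_succ.
by have /card_lt_not[] := cP _ mc; rewrite -smc; exact: succ_card_le.
Qed.

(* Goedel's well-ordering of [c * c]. *)
Lemma cardinal_setX (c : ZF) : cardinal c -> infinite_set c -> c `*` c #<= c.
Proof.
elim/(well_founded_ind mem_wf): c => c IH cc ic; have [oc cP] := cc.
pose mx (p : ZF * ZF) := if pselect (p.1 ∈ p.2) then p.2 else p.1.
have mxc p : (c `*` c) p -> mx p ∈ c by case: p => p1 p2 [] /=; rewrite /mx; case: pselect.
have mxP p : (c `*` c) p -> p.1 ∈ succ (mx p) /\ p.2 ∈ succ (mx p).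
  case: p => p1 p2 [/= p1c p2c]; rewrite /mx /=; case: pselect => p12.
    by split; apply/in_succ; [left|right].
  split; apply/in_succ; first by right.
  by have [//|->|] := ord_total (ord_in oc p1c) (ord_in oc p2c); [right|left].
pose L p q := mx p ∈ mx q \/ mx p = mx q /\ (p.1 ∈ q.1 \/ p.1 = q.1 /\ p.2 ∈ q.2).
pose R p q := [/\ (c `*` c) p, (c `*` c) q & L p q].
have Rw : well_founded R.
  suff W m a b p : mx p = m -> p.1 = a -> p.2 = b -> Acc R p by move=> p; exact: W.
  elim/(well_founded_ind mem_wf): m a b p => m IHm.
  elim/(well_founded_ind mem_wf) => a IHa; elim/(well_founded_ind mem_wf) => b IHb p pm pa pb.
  constructor=> q [_ _ [|[qm [|[qa]]]]]; rewrite ?pm ?pa ?pb.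
  - by move=> qm; exact: IHm qm _ _ _ erefl erefl erefl.
  - by move=> qa; apply: (IHa _ qa) => //; rewrite qm.
  - by move=> qb; apply: (IHb _ qb) => //; [rewrite qm|rewrite qa].
have [_ cne cs] := infinite_cardinal_limit cc ic.
(* A segment below [q] lies in the square of [succ (mx q)], an ordinal below [c], which is finite or
   covered by the induction hypothesis for its cardinal. *)
have seg q : [set p | R p q] #<= c /\ ([set p | R p q] !=set0 -> [set p | R p q] #< c).
  have [[p0 Rp0]|n0] := pselect ([set p | R p q] !=set0); last first.
    rewrite (_ : mkset _ = set0); first by split; [exact: card_ge0|move=> [] ].
    by apply/seteqP; split=> // p Rp; apply: n0; exists p.
  suff lt : [set p | R p q] #< c.
    split=> //; have [a ac ra] := card_lt_bound oc lt.
    by apply: card_le_trans ra _; apply: subset_card_le; exact: ord_in_sub.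
  have qc : (c `*` c) q by case: Rp0.
  pose m := succ (mx q); have mc : m ∈ c by exact/cs/mxc.
  have om := ord_in oc mc.
  have sm : [set p | R p q] #<= m `*` m.
    apply: subset_card_le => p [pc _ Lpq].
    have pq : succ (mx p) `<=` m.
      case: Lpq => [pq|[-> _]//]; apply: ord_in_sub => //.
      by apply: ord_succ_mono => //; exact/(ord_in oc)/mxc.
    by have [? ?] := mxP _ pc; split; apply: pq.
  apply: card_le_lt sm _.
  have [fm|im] := pselect (finite_set m).
    by apply/card_lt_not => cm; apply: ic; apply: card_le_finite cm _; exact: finite_setX.
  have [d cd md] := card_cardinal m.
  have dm : d `<=` m by apply: cardinal_sub => //; exact: card_eq_ler.
  have dc : d ∈ c.
    have [dm'|->//] := ord_sub cd.1 om dm; exact: ord_trans dm' mc.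
  apply: card_le_lt (cP _ dc); apply: card_le_trans (setX_mono (card_eq_lel md) (card_eq_lel md)) _.
  by apply: IH => //; apply: infinite_le im _; exact: card_eq_lel.
have Lt p q r : L p q -> L q r -> (c `*` c) r -> L p r.
  move=> pq qr [r1c r2c]; have omr : ordinal (mx r) by apply/(ord_in oc)/mxc.
  case: pq => [pq|[pqE pq]]; case: qr => [qr|[qrE qr]].
  - by left; exact: ord_trans qr.
  - by left; rewrite -qrE.
  - by left; rewrite pqE.
  right; split; first by rewrite pqE.
  case: pq => [pq|[pE pq]]; case: qr => [qr|[rE qr]].
  - by left; apply: ord_trans qr => //; exact: ord_in r1c.
  - by left; rewrite -rE.
  - by left; rewrite pE.
  right; split; first by rewrite pE.
  by apply: ord_trans qr => //; exact: ord_in r2c.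
have Rt p q r : R p q -> R q r -> R p r.
  by move=> [pc _ pq] [_ rc qr]; split=> //; exact: Lt qr _.
have Rtot p q : (c `*` c) p -> (c `*` c) q -> [\/ R p q, p = q | R q p].
  move=> pc qc; have omp := ord_in oc (mxc _ pc); have omq := ord_in oc (mxc _ qc).
  have [h|mE|h] := ord_total omp omq; [by constructor 1; split=> //;
    left| |by constructor 3; split=> //; left].
  have [h|e1|h] := ord_total (ord_in oc pc.1) (ord_in oc qc.1).
  - by constructor 1; split=> //; right; split=> //; left.
  - have [h|e2|h] := ord_total (ord_in oc pc.2) (ord_in oc qc.2).
    + by constructor 1; split=> //; right; split=> //; right.
    + by constructor 2; case: (p) (q) e1 e2 => ? ? [? ?] /= -> ->.
    + by constructor 3; split=> //; right; split=> //; right.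
  - by constructor 3; split=> //; right; split=> //; left.
have Rs q := (seg q).1.
apply: (@card_le_inj _ _ _ _ (rank Rw)) => [q qc|p q pc qc]; last exact: (rank_inj Rs Rtot).
(* A rank outside [c] would include [c], and the segment below [q] would then have at least [c]
   points. *)
apply: contrapT => /(ord_nin_sub (rank_ord Rw Rs Rt _) oc) cq.
have [x xc] := cne.
have := cq _ xc; move=> /(in_rank Rw Rs)[p Rp _].
have /card_lt_not[] := (seg q).2 (ex_intro _ p Rp).
apply: (@card_le_surj _ _ _ _ (rank Rw)) => w /cq/(in_rank Rw Rs)[z Rz ->].
by exists z.
Qed.

Lemma infinite_setX (x : ZF) : infinite_set x -> x `*` x #<= x.
Proof.
move=> ix; have [c cc xc] := card_cardinal x.
apply: card_le_trans (card_eq_ler xc); apply: card_le_trans (cardinal_setX cc _).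
  by apply: setX_mono; exact: card_eq_lel.
by apply: infinite_le ix _; exact: card_eq_lel.
Qed.

Section InfiniteArithmetic.
Variable x : ZF.
Hypothesis ix : infinite_set x.

Lemma card_setX T U (A : set T) (B : set U) : A #<= x -> B #<= x -> A `*` B #<= x.
Proof. by move=> Ax Bx; apply: card_le_trans (infinite_setX ix); exact: setX_mono. Qed.

Lemma card_nat : [set: nat] #<= x. Proof. exact/infiniteP. Qed.

Lemma card_bigcup T I (A : set I) (F : I -> set T) :
  A #<= x -> (forall i, A i -> F i #<= x) -> \bigcup_(i in A) F i #<= x.
Proof.
move=> Ax Fx; apply: card_le_trans (card_setX Ax (card_lexx x)).
have [g gP] : exists g : I -> T -> ZF, forall i, A i ->
    (forall t, F i t -> g i t ∈ x) /\ (forall s t, F i s -> F i t -> g i s = g i t -> s = t).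
  suff H i : exists g : T -> ZF, A i ->
    (forall t, F i t -> g t ∈ x) /\ (forall s t, F i s -> F i t -> g s = g t -> s = t).
    by have [g gP] := choice_ex H; exists g.
  have [Ai|nAi] := pselect (A i); last by exists (fun=> empty).
  by have [g ? ?] := card_le_ex empty (Fx _ Ai); exists g.
apply: (@card_le_rel _ _ _ _ (fun t p => [/\ A p.1, F p.1 t & g p.1 t = p.2])) => [t [i Ai Fit]|].
  by exists (i, g i t) => //; split=> //; exact: (gP _ Ai).1.
by move=> s t [i j] _ _ /= [Ai Fis <-] [_ Fit gs]; apply: (gP _ Ai).2.
Qed.

Lemma card_dsum T U (A : set T) (B : set U) : A #<= x -> B #<= x -> A ⊎ B #<= x.
Proof.
move=> Ax Bx; apply: card_le_trans (card_setX card_nat (card_lexx x)).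
have [f fx fi] := card_le_ex empty Ax; have [g gx gi] := card_le_ex empty Bx.
apply: (@card_le_inj _ _ _ _ (fun z => match z with
  inl a => (0%N, f a) | inr b => (1%N, g b) end)) => [[a|b] /= h|].
- by split=> //; exact: fx.
- by split=> //; exact: gx.
- by move=> [a|a] [b|b] //= ha hb []; [move/fi => ->|move/gi => ->].
Qed.

Lemma card_setU T (A B : set T) : A #<= x -> B #<= x -> A `|` B #<= x.
Proof.
move=> Ax Bx; apply: card_le_trans (card_dsum Ax Bx).
apply: (@card_le_surj _ _ _ _ (fun z => match z with inl a => a | inr a => a end)).
by move=> a [Aa|Ba]; [exists (inl a)|exists (inr a)].
Qed.

Lemma card_finite T (A : set T) : finite_set A -> A #<= x.
Proof. by move=> fA; apply: card_le_trans card_nat; exact: finite_set_countable. Qed.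

Lemma card_seq T : [set: T] #<= x -> [set: seq T] #<= x.
Proof.
move=> Tx; suff H n : [set s : seq T | size s = n] #<= x.
  apply: card_le_trans (card_bigcup card_nat (fun n _ => H n)).
  by apply: subset_card_le => s _; exists (size s).
elim: n => [|n IH].
  apply: card_le_trans card_nat; apply: (@card_le_inj _ _ _ _ size) => // s t /=.
  by move=> /size0nil -> /size0nil ->.
apply: card_le_trans (card_setX Tx IH).
apply: (@card_le_rel _ _ _ _ (fun s p => s = p.1 :: p.2)) => [[//|t s] [<-]|s t p _ _ -> -> //].
by exists (t, s).
Qed.

End InfiniteArithmetic.

(** * Structures *)

Section Facts.
Variable tau : vocabulary.
Implicit Types M N U : structure tau.

Inductive fact (T : Type) : Type :=
| FEq (t u : T)
| FFun (s : fsym tau) (a : 'I_(farity s) -> T) (t : T)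
| FRel (r : rsym tau) (a : 'I_(rarity r) -> T).

(** The values of [v] are arbitrary sets, and a statement about a point outside [M] is false. This
    allows one family of parameters to be evaluated in structures with different universes. *)
Definition holds T M (v : T -> ZF) (p : fact T) : Prop :=
  match p with
  | FEq t u => v t = v u /\ v t ∈ M
  | FFun s a t => exists2 b : 'I_(farity s) -> set_type M,
      forall i, val (b i) = v (a i) & val (fint b) = v t
  | FRel r a => exists2 b : 'I_(rarity r) -> set_type M,
      forall i, val (b i) = v (a i) & rint b
  end.

Definition fmap T T' (h : T -> T') (p : fact T) : fact T' :=
  match p with
  | FEq t u => FEq (h t) (h u)
  | FFun s a t => FFun (fun i => h (a i)) (h t)
  | FRel r a => FRel (fun i => h (a i))
  end.

Lemma holds_fmap T T' (h : T -> T') M v p : holds M v (fmap h p) <-> holds M (fun t => v (h t)) p.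
Proof. by case: p. Qed.

Lemma valM M (x : set_type M) : val x ∈ M. Proof. exact: set_valP. Qed.

Definition toM M x (Mx : x ∈ M) : set_type M := SigSub (mem_set Mx).

Lemma holds_fun M s (a : 'I_(farity s) -> set_type M) : holds M val (FFun a (fint a)).
Proof. by exists a. Qed.

Lemma holds_fun_uniq T M (v : T -> ZF) s (a : 'I_(farity s) -> T) t u :
  holds M v (FFun a t) -> holds M v (FFun a u) -> v t = v u.
Proof.
move=> [b ba <-] [c ca <-]; congr (val (fint _)); apply/funext => i.
by apply: val_inj; rewrite ba ca.
Qed.

Lemma embedding_holds f M N : embedding f M N ->
  forall T (v : T -> ZF) p, (forall t, v t ∈ M) ->
  holds M v p <-> holds N (fun t => f (v t)) p.
Proof.
move=> [fMN fi fF fR] T v [t u|s a t|r a] vM /=.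
- split=> [[-> _]|[fvv _]]; first by split=> //; exact: fMN.
  by split=> //; apply: fi => //; exact: mem_set.
- split=> [[b ba bt]|[c ca ct]].
    exists (fun i => toM (fMN _ (valM (b i)))) => [i|]; first by rewrite /= ba.
    by rewrite (@fF s b) -?bt.
  exists (fun i => toM (vM (a i))) => //.
  apply: fi; [exact/mem_set/valM|exact/mem_set|].
  by rewrite -ct (fF s (fun i => toM (vM (a i))) c).
- split=> [[b ba br]|[c ca cr]].
    exists (fun i => toM (fMN _ (valM (b i)))) => [i|]; first by rewrite /= ba.
    exact/(@fR r b).
  exists (fun i => toM (vM (a i))) => //.
  by apply/fR; last exact: cr.
Qed.

(** Converse of [embedding_holds]: reflecting [FEq] is injectivity, and preserving [FFun] at the
    actual value of a function is commutation with it. Embeddings are from now on handled through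
    facts only. *)
Lemma holds_embedding f M N : (forall x, x ∈ M -> f x ∈ N) ->
  (forall p : fact (set_type M), holds M val p <-> holds N (fun t => f (val t)) p) ->
  embedding f M N.
Proof.
move=> fMN H; split=> //.
- move=> x y /set_mem xM /set_mem yM fxy.
  by have [|] := (H (FEq (toM xM) (toM yM))).2; first by split=> //=; exact: fMN.
- move=> s a b ba; have /(H _).1[c ca <-] := holds_fun a.
  by congr (val (fint _)); apply/funext => i; apply: val_inj; rewrite ca.
- move=> r a b ba; split=> [br|ar].
    have /(H (FRel a)).2[c ca] : holds N (fun t => f (val t)) (FRel a) by exists b.
    by rewrite (_ : c = a)//; apply/funext => i; apply: val_inj; rewrite ca.
  have /(H (FRel a)).1[c ca] : holds M val (FRel a) by exists a.
  by rewrite (_ : c = b)//; apply/funext => i; apply: val_inj; rewrite ca.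
Qed.

Lemma embedding_mem f M N x : embedding f M N -> x ∈ M -> f x ∈ N.
Proof. by move=> [fMN _ _ _]; exact: fMN. Qed.

Lemma embedding_inj f M N x y : embedding f M N -> x ∈ M -> y ∈ M -> f x = f y -> x = y.
Proof. by move=> [_ fi _ _] xM yM; apply: fi; exact: mem_set. Qed.

Lemma embedding_comp f g M N U : embedding f M N -> embedding g N U ->
  embedding (fun x => g (f x)) M U.
Proof.
move=> fMN gNU; apply: holds_embedding => [x xM|p].
  by apply: (embedding_mem gNU); exact: (embedding_mem fMN).
rewrite (embedding_holds fMN _ (@valM M)); apply: (embedding_holds gNU) => t.
by apply: (embedding_mem fMN); exact: valM.
Qed.

Lemma embedding_eq f g M N : (forall x, x ∈ M -> f x = g x) -> embedding f M N -> embedding g M N.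
Proof.
move=> fg fMN; apply: holds_embedding => [x xM|p].
  by rewrite -fg//; exact: (embedding_mem fMN).
rewrite (embedding_holds fMN _ (@valM M)).
by rewrite (_ : (fun t : set_type M => f (val t)) = (fun t => g (val t)))//;
  apply/funext => t; rewrite fg//; exact: valM.
Qed.

Lemma iso_id M : isomorphism id M M.
Proof. by split=> [|x]; [exact: holds_embedding|exists x]. Qed.

Lemma substructure_refl M : substructure M M.
Proof. exact: (iso_id M).1. Qed.

Lemma substructure_between M N U : M `<=` N -> substructure M U -> substructure N U ->
  substructure M N.
Proof.
move=> MN MU NU; apply: holds_embedding => // p.
rewrite (embedding_holds MU _ (@valM M)).
by rewrite (embedding_holds NU (v := fun t => id (val t)))// => t; exact/MN/valM.
Qed.

Lemma iso_comp f g M N U : isomorphism f M N -> isomorphism g N U ->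
  isomorphism (fun x => g (f x)) M U.
Proof.
move=> [fMN fs] [gNU gs]; split; first exact: embedding_comp gNU.
by move=> z /gs[y /fs[x xM <-] <-]; exists x.
Qed.

Lemma iso_eq f g M N : (forall x, x ∈ M -> f x = g x) -> isomorphism f M N -> isomorphism g M N.
Proof.
move=> fg [fMN fs]; split; first exact: embedding_eq fMN.
by move=> z /fs[x xM <-]; exists x => //; rewrite fg.
Qed.

Lemma iso_inv f M N : isomorphism f M N -> exists g, [/\ isomorphism g N M,
  forall x, x ∈ M -> g (f x) = x & forall y, y ∈ N -> f (g y) = y].
Proof.
move=> [fMN fs].
have [g gP] : exists g : ZF -> ZF, forall y, y ∈ N -> g y ∈ M /\ f (g y) = y.
  suff H y : exists x, y ∈ N -> x ∈ M /\ f x = y by have [g gP] := choice_ex H; exists g.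
  by have [/fs[x xM fx]|yN] := pselect (y ∈ N); [exists x|exists y].
have gf x : x ∈ M -> g (f x) = x.
  move=> xM; have [gM fg] := gP _ (embedding_mem fMN xM).
  exact: (embedding_inj fMN).
exists g; split=> //; last by move=> y /gP[].
split; last by move=> x xM; exists (f x); [exact: (embedding_mem fMN)|exact: gf].
apply: holds_embedding => [y /gP[]//|p].
rewrite (embedding_holds fMN); last by move=> t; exact: (gP _ (valM t)).1.
rewrite (_ : (fun t : set_type N => f (g (val t))) = val)//.
by apply/funext => t; exact: (gP _ (valM t)).2.
Qed.

Lemma iso_image f M N : isomorphism f M N -> (N : set ZF) = f @` M.
Proof.
move=> [fMN fs]; apply/seteqP; split=> [y /fs//|_ [x xM <-]].
exact: (embedding_mem fMN).
Qed.

Lemma iso_card f M N : isomorphism f M N -> M #= N.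
Proof.
move=> fMN; apply: card_eq_le2.
  by apply: (card_le_inj (f := f)) => [x|x y];
    [exact: (embedding_mem fMN.1)|exact: (embedding_inj fMN.1)].
by rewrite (iso_image fMN); exact: card_image_le.
Qed.

Lemma embedding_image f M N : embedding f M N -> forall M', isomorphism f M M' -> substructure M' N.
Proof.
move=> fMN M' fM'; have [g [gM' gf fg]] := iso_inv fM'.
apply: (@embedding_eq (fun y => f (g y))) => [y /fg//|].
exact: embedding_comp gM'.1 fMN.
Qed.

(** The facts [FEq x x] determine the universe, and over a fixed universe the remaining ones
    determine the interpretations. Counting structures later becomes counting sets of facts. *)
Lemma structure_ext M N : (forall p : fact ZF, holds M id p <-> holds N id p) -> M = N.
Proof.
case: M N => [u F R] [w G S] H.
have uw : u = w.
  apply: ZF_ext => x; have := H (FEq x x) => /= -[h1 h2].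
  by split=> [xu|xw]; [have [|] := h1|have [|] := h2].
subst w; congr Structure.
  apply: functional_extensionality_dep => s; apply/funext => a; apply: val_inj.
  have [h _] := H (FFun (fun i => val (a i)) (val (F s a))).
  have [|b ba /= <-] := h; first by exists a.
  by congr (val (G s _)); apply/funext => i; apply: val_inj; rewrite ba.
apply: functional_extensionality_dep => r; apply/funext => a; apply/propext.
have [h1 h2] := H (FRel (fun i => val (a i))); split=> [ra|sa].
  have [|b ba] := h1; first by exists a.
  by rewrite (_ : b = a)//; apply/funext => i; apply: val_inj; rewrite ba.
have [|b ba] := h2; first by exists a.
by rewrite (_ : b = a)//; apply/funext => i; apply: val_inj; rewrite ba.
Qed.

Lemma holds_mem M (p : fact ZF) : holds M id p -> exists q : fact (set_type M), p = fmap val q.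
Proof.
case: p => [x y|s a t|r a] /= [].
- by move=> <- xM; exists (FEq (toM xM) (toM xM)).
- move=> b ba bt; exists (FFun b (fint b)) => /=; rewrite -bt.
  by congr FFun; apply/funext => i; rewrite ba.
- by move=> b ba br; exists (FRel b) => /=; congr FRel; apply/funext => i; rewrite ba.
Qed.

Lemma substructure_holds M N (p : fact ZF) : substructure M N -> holds M id p -> holds N id p.
Proof.
move=> MN pM; have [q qE] := holds_mem pM; move: pM; rewrite {}qE !holds_fmap.
by move/(embedding_holds MN _ (@valM M)).
Qed.

Lemma substructure_anti M N : substructure M N -> N `<=` M -> M = N.
Proof.
move=> MN NM; apply: structure_ext => p; split; first exact: substructure_holds.
by apply/substructure_holds/(substructure_between NM (substructure_refl N) MN).
Qed.

Lemma substructure_uniq M N U : substructure M U -> substructure N U -> (M : set ZF) = N -> M = N.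
Proof.
move=> MU NU MN; apply: substructure_anti; last by rewrite MN.
by apply: substructure_between NU => //; rewrite MN.
Qed.

(* [U] if no substructure of [U] has universe [P]. *)
Definition restr U (P : set ZF) : structure tau :=
  if pselect (exists A, substructure A U /\ (A : set ZF) = P) is left h
  then projT1 (cid h) else U.

Lemma restrE M U : substructure M U -> restr U M = M.
Proof.
move=> MU; rewrite /restr; case: pselect => [h|[]]; last by exists M.
by have [h1 h2] := projT2 (cid h); exact: (substructure_uniq h1 MU h2).
Qed.

Lemma iso_copy M (f : ZF -> ZF) :
  (forall x y, x ∈ M -> y ∈ M -> f x = f y -> x = y) -> exists N, isomorphism f M N.
Proof.
move=> fi; pose u := setof (f @` M).
have uP y : y ∈ u <-> (f @` M) y by apply: setofE; exact: is_set_image.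
have fu (x : set_type M) : f (val x) ∈ u by apply/uP; exists (val x) => //; exact: valM.
have gex (y : set_type u) : exists x : set_type M, f (val x) = val y.
  have /uP[x xM fx] : val y ∈ u by exact: set_valP.
  by exists (toM xM).
have [g gP] := choice_ex gex.
pose f' x : set_type u := SigSub (mem_set (fu x)).
have gf x : g (f' x) = x by apply: val_inj; apply: fi; [exact: valM|exact: valM|rewrite gP].
pose N : structure tau := {| univ := u;
  fint := fun s b => f' (fint (fun i => g (b i)));
  rint := fun r b => rint (fun i => g (b i)) |}.
exists N; split; last by move=> y /uP.
split.
- by move=> x xM; apply/uP; exists x.
- by move=> x y /set_mem xM /set_mem yM; exact: fi.
- move=> s a b ba /=; congr (f (val (fint _))); apply/funext => i.
  by rewrite -(gf (a i)); congr g; apply: val_inj; rewrite ba.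
- move=> r a b ba /=; rewrite (_ : (fun i => g (b i)) = a)//; apply/funext => i.
  by rewrite -(gf (a i)); congr g; apply: val_inj; rewrite ba.
Qed.

(* A supply of sets outside of [x], by foundation. *)
Definition fresh (x y : ZF) : ZF := setof [set x; y].

Lemma in_fresh x y z : z ∈ fresh x y <-> z = x \/ z = y.
Proof. exact: (setofE (is_set2 x y)). Qed.

Lemma fresh_nin x y : ~ fresh x y ∈ x.
Proof. by apply: mem_asym; apply/in_fresh; left. Qed.

Lemma fresh_inj x y z : fresh x y = fresh x z -> y = z.
Proof.
move=> yz; have : y ∈ fresh x z by rewrite -yz; apply/in_fresh; right.
have : z ∈ fresh x y by rewrite yz; apply/in_fresh; right.
by move=> /in_fresh[->|->//] /in_fresh[].
Qed.

Lemma chain_union d (M : ZF -> structure tau) : ordinal d ->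
  (forall i, i ∈ d -> succ i ∈ d) -> (exists i, i ∈ d) ->
  (forall i j, j ∈ d -> i ∈ j -> substructure (M i) (M j)) ->
  exists U, is_union d M U.
Proof.
move=> od sd [i0 i0d] Msub.
have up i j : i ∈ d -> j ∈ d ->
  exists k, [/\ k ∈ d, substructure (M i) (M k) & substructure (M j) (M k)].
  move=> di dj; have [ij|<-|ji] := ord_total (ord_in od di) (ord_in od dj).
  - by exists j; split=> //; [exact: Msub|exact: substructure_refl].
  - by exists i; split=> //; exact: substructure_refl.
  - by exists i; split=> //; [exact: substructure_refl|exact: Msub].
pose u := setof (\bigcup_(i in d) M i).
have uP y : y ∈ u <-> exists2 i, i ∈ d & y ∈ M i by apply: setofE; exact: is_set_bigcup.
(* By finite arity every tuple lies in one member of the chain. Functions and relations of the union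
   are read off there, and two members are compared inside a third one by [up]. *)
have fin n (a : 'I_n -> set_type u) : exists2 i, i ∈ d & forall m, val (a m) ∈ M i.
  have H (m : 'I_n) : exists i, i ∈ d /\ val (a m) ∈ M i.
    by have /uP[i di aM] : val (a m) ∈ u by [exact: set_valP]; exists i.
  have [g gP] := choice_ex H.
  suff [i di iP] : exists2 i, i ∈ d & forall m, m \in enum 'I_n -> val (a m) ∈ M i.
    by exists i => // m; apply: iP; rewrite mem_enum.
  elim: (enum 'I_n) => [|m s [i di iP]]; first by exists i0.
  have [k [dk ik mk]] := up _ _ di (gP m).1; exists k => // m'.
  rewrite inE => /orP[/eqP->|/iP]; first exact: (embedding_mem mk (gP m).2).
  exact: (embedding_mem ik).
have funP s (a : 'I_(farity s) -> set_type u) : exists y : set_type u,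
    exists2 i, i ∈ d & holds (M i) id (FFun (fun m => val (a m)) (val y)).
  have [i di iP] := fin _ a.
  have yu : val (@fint tau (M i) s (fun m => toM (iP m))) ∈ u by apply/uP; exists i => //;
    exact: valM.
  by exists (SigSub (mem_set yu)), i => //=; exists (fun m => toM (iP m)).
have [F FP] := choice_ex (fun sa : {s & 'I_(farity s) ->
  set_type u} => funP (projT1 sa) (projT2 sa)).
pose U : structure tau := {| univ := u;
  fint := fun s a => F (existT _ s a);
  rint := fun r a => exists2 i, i ∈ d & holds (M i) id (FRel (fun m => val (a m))) |}.
exists U; split=> // i di; apply: holds_embedding => [x xM|p]; first by apply/uP; exists i.
have uM (x : set_type (M i)) : val x ∈ u by apply/uP; exists i => //; exact: valM.
pose w (x : set_type (M i)) : set_type u := SigSub (mem_set (uM x)).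
case: p => [x y|s a y|r a].
- by split=> -[/= -> _]; split=> //; [exact: uM|exact: valM].
- set b := fun m => w (a m); have [j dj jP'] := FP (existT _ s b).
  have jP : holds (M j) id (FFun (fun m => val (a m)) (val (F (existT _ s b)))) by exact: jP'.
  have -> : holds U (fun t => id (val t)) (FFun a y) <-> val (F (existT _ s b)) = val y.
    split=> [[c ca <-]|Fy]; last by exists b.
    by congr (val (F (existT _ s _))); apply/funext => m; apply: val_inj; rewrite /= ca.
  have [k [dk ik jk]] := up _ _ di dj.
  have {}jP := substructure_holds jk jP.
  split=> [h|Fy].
    have {}h : holds (M i) id (fmap val (FFun a y)) by apply/holds_fmap.
    have {}h := substructure_holds ik h.
    exact: holds_fun_uniq jP h.
  rewrite Fy in jP.
  by apply/(embedding_holds ik _ (@valM (M i))); rewrite -(holds_fmap val _ id).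
- set b := fun m => w (a m).
  have -> : holds U (fun t => id (val t)) (FRel a) <->
      exists2 j, j ∈ d & holds (M j) id (FRel (fun m => val (a m))).
    split=> [[c ca cr]|Fy]; last by exists b.
    have cb : c = b by apply/funext => m; apply: val_inj; rewrite ca.
    by rewrite cb in cr.
  split=> [h|[j dj jP]]; first by exists i => //; apply/(holds_fmap val _ id (FRel a)).
  have [k [dk ik jk]] := up _ _ di dj.
  have {}jP := substructure_holds jk jP.
  by apply/(embedding_holds ik _ (@valM (M i))); rewrite -(holds_fmap val _ id).
Qed.

Lemma card_fact (x : ZF) T : infinite_set x -> [set: fsym tau] ⊎ [set: rsym tau] #<= x ->
  [set: T] #<= x -> [set: fact T] #<= x.
Proof.
move=> ix sx Tx.
have Sx : [set: unit] ⊎ ([set: fsym tau] ⊎ [set: rsym tau]) #<= x.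
  by apply: card_dsum => //; apply: card_le_trans (card_nat ix);
    apply: (card_le_inj (f := fun=> 0%N)) => // -[] [].
apply: card_le_trans (card_setX ix Sx (card_seq ix Tx)).
(* The symbol fixes the arity, so that the list of entries determines the tuple. *)
pose code (p : fact T) : (unit + (fsym tau + rsym tau)) * seq T :=
  match p with
  | FEq t u => (inl tt, [:: t; u])
  | FFun s a t => (inr (inl s), t :: codom a)
  | FRel r a => (inr (inr r), codom a)
  end.
have codom_inj n (a b : 'I_n -> T) : codom a = codom b -> a = b.
  by rewrite !codomE => /eq_in_map ab; apply/funext => i; apply: ab; rewrite mem_enum.
apply: (@card_le_inj _ _ _ _ code); first by move=> [t u|s a t|r a] _; split.
move=> [t u|s a t|r a] [t' u'|s' a' t'|r' a'] _ _ //= [].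
- by move=> -> ->.
- by move=> ss; subst s' => -> /codom_inj ->.
- by move=> rr; subst r' => /codom_inj ->.
Qed.

End Facts.

Lemma finite_join I (P : set I) (S : I -> set ZF) :
  P !=set0 ->
  (forall i j, P i -> P j -> exists k, [/\ P k, S i `<=` S k & S j `<=` S k]) ->
  forall n (a : 'I_n -> ZF), (forall m, exists2 i, P i & S i (a m)) ->
  exists2 i, P i & forall m, S i (a m).
Proof.
move=> [i0 Pi0] up n a aP.
suff [i Pi iP] : exists2 i, P i & forall m, m \in enum 'I_n -> S i (a m).
  by exists i => // m; apply: iP; rewrite mem_enum.
elim: (enum 'I_n) => [|m s [i Pi iP]]; first by exists i0.
have [j Pj jm] := aP m; have [k [Pk ik jk]] := up _ _ Pi Pj; exists k => // m'.
by rewrite inE => /orP[/eqP->|/iP]; [exact: jk|exact: ik].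
Qed.

Lemma sub_closed tau (U : structure tau) (P : set ZF) : P `<=` U ->
  (forall s (a : 'I_(farity s) -> set_type U), (forall i, P (val (a i))) -> P (val (fint a))) ->
  substructure (restr U P) U /\ (restr U P : set ZF) = P.
Proof.
move=> PU Pc; pose u := setof P.
have uP y : y ∈ u <-> P y by apply: setofE; exact: is_set_sub PU.
have uU (x : set_type u) : val x ∈ U by apply: PU; apply/uP; exact: (set_valP x).
have fu s (a : 'I_(farity s) -> set_type u) : val (fint (fun i => toM (uU (a i)))) ∈ u.
  by apply/uP; apply: Pc => i; apply/uP; exact: (set_valP (a i)).
pose N : structure tau := {| univ := u; fint := fun s a => SigSub (mem_set (fu s a));
  rint := fun r a => rint (fun i => toM (uU (a i))) |}.
have NU : substructure N U.
  split=> [x /uP/PU//|x y _ _ //|s a b ab|r a b ab].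
    by congr (val (fint _)); apply/funext => i; apply: val_inj; rewrite ab.
  rewrite (_ : b = fun i => toM (uU (a i)))//.
  by apply/funext => i; apply: val_inj; rewrite ab.
have NP : (N : set ZF) = P by apply/seteqP; split=> y /uP.
by rewrite -NP restrE.
Qed.

(** * Strong submodels and strong embeddings *)

Section AEC.
Variables (tau : vocabulary) (k : aec tau).
Implicit Types M N U V : structure tau.

Lemma le_substructure M N : le k M N -> substructure M N.
Proof. by move=> /le_sub[]. Qed.

Lemma le_Kl M N : le k M N -> K k M. Proof. by move=> /le_sub[]. Qed.
Lemma le_Kr M N : le k M N -> K k N. Proof. by move=> /le_sub[]. Qed.

Lemma le_subset M N : le k M N -> M `<=` N.
Proof. by move=> /le_substructure MN x; exact: (embedding_mem MN). Qed.

Lemma le_between M N U : M `<=` N -> le k M U -> le k N U -> le k M N.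
Proof.
move=> MN MU NU; apply: le_coherent (MU) (NU).
exact: substructure_between MN (le_substructure MU) (le_substructure NU).
Qed.

Lemma le_restrict_iso f M M' N : isomorphism f N M -> le k M' N ->
  exists2 M'', isomorphism f M' M'' & le k M'' M.
Proof.
move=> fNM M'N.
have [|M'' fM''] := @iso_copy _ M' f.
  by move=> x y xM yM; apply: (embedding_inj fNM.1); exact: (le_subset M'N).
by exists M'' => //; apply: le_iso M'N fNM fM''.
Qed.

Lemma le_embedding_trans f M N U : le_embedding k f M N -> le k N U -> le_embedding k f M U.
Proof. by move=> [M' fM M'N] NU; exists M' => //; exact: le_trans NU. Qed.

Lemma le_embedding_restrict f M N U : le k M N -> le_embedding k f N U -> le_embedding k f M U.
Proof.
move=> MN [N' fN N'U]; have [M' fM M'N'] := le_restrict_iso fN MN.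
by exists M' => //; exact: le_trans N'U.
Qed.

Lemma le_embedding_id M N : le k M N -> le_embedding k id M N.
Proof. by move=> MN; exists M => //; exact: iso_id. Qed.

Lemma le_embedding_iso f g M N U : le_embedding k f M N -> isomorphism g N U ->
  le_embedding k (fun x => g (f x)) M U.
Proof.
move=> [M' fM M'N] gN; have [M'' gM M''U] := le_restrict_iso gN M'N.
by exists M'' => //; exact: (iso_comp fM gM).
Qed.

Lemma le_embedding_comp f g M N U : le_embedding k f M N -> le_embedding k g N U ->
  le_embedding k (fun x => g (f x)) M U.
Proof.
by move=> fMN [N' gN N'U]; apply: le_embedding_trans N'U; exact: (le_embedding_iso fMN gN).
Qed.

Lemma le_embedding_embedding f M N : le_embedding k f M N -> embedding f M N.
Proof. by move=> [M' [fM _] M'N]; exact: (embedding_comp fM (le_substructure M'N)). Qed.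

Lemma le_embedding_Kr f M N : le_embedding k f M N -> K k N.
Proof. by move=> [M' _ /le_Kr]. Qed.

Lemma relabel g M N : le k M N -> (forall x y, x ∈ N -> y ∈ N -> g x = g y -> x = y) ->
  (forall x, x ∈ M -> g x = x) -> exists2 N', isomorphism g N N' & le k M N'.
Proof.
move=> MN gi gM; have [N' gN] := iso_copy gi; exists N' => //.
apply: le_iso MN gN _; apply: iso_eq (iso_id M) => x /gM ->//.
Qed.

(** The image of [M] in [N] is renamed back by the inverse of [f], and all other points become
    [fresh] over [M], so they cannot collide with it. This is how an embedding is turned into an
    inclusion. *)
Lemma extend_embedding f M N : le_embedding k f M N ->
  exists N' g, [/\ isomorphism g N N', le k M N' & forall x, x ∈ M -> g (f x) = x].
Proof.
move=> [M' fM M'N]; have [h [hM hf fh]] := iso_inv fM.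
pose g y := if pselect (y ∈ M') then h y else fresh M y.
have gh y : y ∈ M' -> g y = h y by rewrite /g; case: pselect.
have [|N' gN] := @iso_copy _ N g.
  move=> x y _ _; rewrite /g; case: pselect => /= xM; case: pselect => /= yM.
  - by move/(congr1 f); rewrite !fh.
  - by move=> E; case: (@fresh_nin M y); rewrite -E; exact: (embedding_mem hM.1).
  - by move=> E; case: (@fresh_nin M x); rewrite E; exact: (embedding_mem hM.1).
  - exact: fresh_inj.
exists N', g; split=> // [|x xM].
  by apply: le_iso M'N gN _; apply: iso_eq hM => y /gh.
by rewrite gh ?hf//; exact: (embedding_mem fM.1).
Qed.

(** * Directed unions indexed by finite sets *)

Section Directed.
Variables (X : choiceType) (r : X -> ZF) (U : structure tau) (B : {fset X} -> structure tau).
Hypothesis r_inj : injective r.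
Hypothesis B_sub : forall A, substructure (B A) U.
Hypothesis B_le : forall A A', (A `<=` A')%fset -> le k (B A) (B A').

Let join (Y : set X) : set ZF := [set x | exists2 A : {fset X}, [set` A] `<=` Y & x ∈ B A].
Let W Y := restr U (join Y).

Let joinP Y : substructure (W Y) U /\ (W Y : set ZF) = join Y.
Proof.
apply: sub_closed => [x [A _]|s a aP]; first exact: (embedding_mem (B_sub A)).
have [|||A AY aA] := @finite_join _ [set A :
  {fset X} | [set` A] `<=` Y] B _ _ _ (fun i => val (a i)).
- by exists fset0.
- move=> A A' /= AY A'Y; exists (A `|` A')%fset; split.
  + by move=> x /=; rewrite inE => /orP[/AY|/A'Y].
  + by apply/le_subset/B_le/fsubsetUl.
  + by apply/le_subset/B_le/fsubsetUr.
- by move=> m; have [A ? ?] := aP m; exists A.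
exists A => //; have [_ _ BF _] := B_sub A.
by rewrite (BF s (fun i => toM (aA i)) a)//; exact: valM.
Qed.

(** The two halves need each other in the induction: at a limit stage, the second half at an earlier
    index and the first half at a later one make the partial unions a chain, to which the axioms
    apply. *)
Let good Y := (forall A : {fset X}, [set` A] `<=` Y -> le k (B A) (W Y)) /\
  (forall V, (forall A : {fset X}, [set` A] `<=` Y -> le k (B A) V) -> le k (W Y) V).

Let good_fset (A : {fset X}) : good [set` A].
Proof.
rewrite /good; have -> : W [set` A] = B A.
  have [WU WE] := joinP [set` A]; apply: substructure_uniq WU (B_sub A) _.
  rewrite WE; apply/seteqP; split=> [x [A' AA' xA']|x xA]; last by exists A.
  by apply: (le_subset (B_le _)) xA'; apply/fsubsetP => y /AA'.
by split=> [A' AA'|V]; [apply: B_le; apply/fsubsetP => y /AA'|exact].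
Qed.

(* Induction on [d]: a successor moves one index to the finite part, and at a
   limit the union is that of a chain. *)
Lemma directed_union_below d (t : {fset X}) : ordinal d ->
  good ([set x | r x ∈ d] `|` [set` t]).
Proof.
elim/(well_founded_ind mem_wf): d t => d IH t od.
pose Y i := [set x | r x ∈ i] `|` [set` t].
have [dE|[e oe dE]|ld] := ord_cases od.
- have -> : [set x | r x ∈ d] `|` [set` t] = [set` t]; last exact: good_fset.
  by apply/seteqP; split=> [x [|//]|x]; [rewrite dE => /in_empty|right].
- have ed : e ∈ d by rewrite dE; exact: succ_self.
  have [[x0 x0e]|nx] := pselect (exists x, r x = e).
    have -> : [set x | r x ∈ d] `|` [set` t] = [set x | r x ∈ e] `|` [set` (x0 |` t)%fset].
      apply/seteqP; split=> x.
        rewrite dE => -[/in_succ[|]|xt]; first by left.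
          by rewrite -x0e => /r_inj ->; right; rewrite /= !inE eqxx.
        by right; rewrite /= !inE xt orbT.
      move=> [xe|]; first by left; rewrite dE; apply/in_succ; left.
      rewrite /= !inE => /orP[/eqP->|]; last by right.
      by left; rewrite dE x0e; exact: succ_self.
    exact: IH ed _ oe.
  have -> : [set x | r x ∈ d] `|` [set` t] = [set x | r x ∈ e] `|` [set` t]; last exact: IH ed _ oe.
  apply/seteqP; split=> x; rewrite dE; last first.
    by move=> [xe|]; [left; apply/in_succ; left|right].
  by move=> [/in_succ[|rx]|]; [left|case: nx; exists x|right].
have {}IH i : i ∈ d -> good (Y i) by move=> di; apply: IH => //; exact: ord_in di.
have Ymono i j : ordinal j -> i ∈ j -> Y i `<=` Y j.
  by move=> oj ij x [xi|]; [left; exact: ord_trans xi ij|right].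
have chain i j : j ∈ d -> i ∈ j -> le k (W (Y i)) (W (Y j)).
  move=> jd ij; apply: (IH i (ord_trans od ij jd)).2 => A AY.
  by apply: (IH j jd).1; apply: subset_trans AY _; apply: Ymono => //; exact: ord_in jd.
have Yfin j (A : {fset X}) : limit j -> [set` A] `<=` Y j -> exists2 i, i ∈ j & [set` A] `<=` Y i.
  move=> lj AY; have [oj _ sucj] := lj.
  suff H (s : seq X) : {in s, forall x, Y j x} -> exists2 i, i ∈ j & [set x | x \in s] `<=` Y i.
    by have [|i ij iP] := H (enum_fset A); [move=> x; exact: AY|exists i].
  elim: s => [_|y s IHs ys].
    by exists empty => //; exact: limit_empty.
  have [z zs|i ij iP] := IHs; first by apply: ys; rewrite inE zs orbT.
  have [|yj|yt] := ys y; first by rewrite inE eqxx.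
    have [e [ej ie ye]] : exists e, [/\ e ∈ j, Y i `<=` Y e & r y ∈ e].
      have oi := ord_in oj ij; have oy := ord_in oj yj.
      have [iy|iy|yi] := ord_total oi oy.
      - exists (succ (r y)); split; [exact: sucj| |exact: succ_self].
        by apply: Ymono; [exact: ord_succ|apply/in_succ; left].
      - exists (succ (r y)); split; [exact: sucj| |exact: succ_self].
        by apply: Ymono; [exact: ord_succ|rewrite iy; exact: succ_self].
      - by exists i; split.
    exists e => // z /=; rewrite inE => /orP[/eqP->|zs]; first by left.
    by apply: ie; exact: iP.
  exists i => // z /=; rewrite inE => /orP[/eqP->|zs]; first by right.
  exact: iP.
have Wunion j : limit j -> (forall i, i ∈ j -> substructure (W (Y i)) (W (Y j))) ->
    is_union j (fun i => W (Y i)) (W (Y j)).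
  move=> lj sj; split=> // x; rewrite {1}(joinP (Y j)).2; split; last first.
    by move=> [i ij xi]; rewrite -(joinP (Y j)).2; exact: (embedding_mem (sj _ ij)).
  move=> [A AY xA].
  suff [i ij iP] : exists2 i, i ∈ j & [set` A] `<=` Y i.
    by exists i => //; rewrite (joinP (Y i)).2; exists A.
  exact: Yfin.
have Wsub i j : ordinal j -> i ∈ j -> substructure (W (Y i)) (W (Y j)).
  move=> oj ij; apply: substructure_between (joinP _).1 (joinP _).1.
  rewrite (joinP _).2 (joinP _).2 => x [A AY xA]; exists A => //.
  by apply: subset_trans AY _; exact: Ymono.
have Wd := Wunion _ ld (fun i => @Wsub i d od).
have inc : inc_continuous (le k) d (fun i => W (Y i)).
  split=> // j jd lj; apply: Wunion => // i ij; exact: Wsub (ord_in od jd) ij.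
split=> [A AY|V VP].
  have [i di iP] := Yfin _ _ ld AY.
  by apply: le_trans ((IH i di).1 A iP) _; exact: (le_union ld inc Wd).
apply: (union_le ld inc Wd) => i di; apply: (IH i di).2 => A AY.
by apply: VP; apply: subset_trans AY _; exact: Ymono.
Qed.

(** The injection [r] lists the indices along an ordinal for the induction. [U] is merely an ambient
    structure: this lemma is what will put the quotient into the class. *)
Lemma directed_union (d : ZF) : ordinal d -> (forall x, r x ∈ d) ->
  exists V, [/\ substructure V U, (V : set ZF) = [set x | exists A, x ∈ B A],
    forall A, le k (B A) V & forall N, (forall A, le k (B A) N) -> le k V N].
Proof.
move=> od rd; have := directed_union_below fset0 od.
have -> : [set x | r x ∈ d] `|` [set` fset0 : {fset X}] = setT.
  by apply/seteqP; split=> // x _; left; exact: rd.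
move=> [H1 H2]; have [WU WE] := joinP setT; exists (W setT); split=> //.
- by rewrite WE; apply/seteqP; split=> x; [move=> [A _ xA]; exists A|move=> [A xA]; exists A].
- by move=> A; exact: H1.
- by move=> N NP; apply: H2 => A _; exact: NP.
Qed.

End Directed.

(** * Monotone systems of small strong submodels *)

Section Skolem.
Variable l : ZF.
Hypothesis linf : infinite_set l.
Hypothesis lLS : forall N (A : set ZF), K k N -> A `<=` N ->
  exists M, [/\ le k M N, A `<=` M & M #<= l ⊎ A].

Lemma small_submodel N (A : set ZF) : K k N -> A `<=` N -> A #<= l ->
  exists M, [/\ le k M N, A `<=` M & M #<= l].
Proof.
move=> KN AN Al; have [M [MN AM Ml]] := lLS KN AN; exists M; split=> //.
by apply: card_le_trans Ml _; exact: card_dsum.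
Qed.

(** Substitute for Skolem hulls: the model for [A] is chosen to contain the models for all sets [A]
    minus one point. By coherence the inclusions obtained in this way are strong. *)
Lemma skolem_system (X : choiceType) N x0 (R : {fset X} -> set ZF) : K k N -> x0 ∈ N ->
  (forall A, R A `<=` N) -> (forall A, R A #<= l) ->
  exists m : {fset X} -> structure tau, [/\ forall A, le k (m A) N,
    forall A, x0 ∈ m A, forall A, m A #<= l, forall A, R A `<=` m A &
    forall A A', (A `<=` A')%fset -> m A `<=` m A'].
Proof.
move=> KN x0N RN Rl.
have H (B : set ZF) : exists M, B `<=` N -> B #<= l -> [/\ le k M N, B `<=` M & M #<= l].
  have [[BN Bl]|nB] := pselect (B `<=` N /\ B #<= l); last by exists N => BN Bl; case: nB.
  by have [M MP] := small_submodel KN BN Bl; exists M.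
have [pick pickP] := choice_ex H.
pose S (m : {fset X} -> structure tau) (A : {fset X}) : set ZF :=
  [set x0] `|` R A `|` \bigcup_(x in [set` A]) m (A `\ x)%fset.
have [M0 [M0N _ M0l]] := small_submodel KN (@sub0set _ N) (card_ge0 _ l).
pose mm n := iter n (fun m A => pick (S m A)) (fun=> M0).
have pickS m A : (forall A, le k (m A) N /\ m A #<= l) ->
    [/\ le k (pick (S m A)) N, S m A `<=` pick (S m A) & pick (S m A) #<= l].
  move=> mP; apply: pickP => [x [[->|/RN]|[y _]]//|].
    by apply: le_subset; exact: (mP _).1.
  apply: card_setU => //; first by apply: card_setU; rewrite ?Rl//; exact/card_finite/finite_set1.
  apply: card_bigcup => // [|x _]; last exact: (mP _).2.
  exact/card_finite/finite_fset.
have mmP n A : le k (mm n A) N /\ mm n A #<= l.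
  by elim: n A => [|n IH] A //=; have [] := pickS _ A IH.
(* The stage is one more than the size of [A]. The step leading to it looks at sets with one point
   fewer exactly at their own stage, and even the empty [A] has been through one step, so it
   contains [x0] and [R A]. *)
exists (fun A => mm (#|` A|).+1 A); split.
- by move=> A; exact: (mmP _ _).1.
- by move=> A; have [_ /(_ x0) + _] := pickS _ A (mmP #|` A|); apply; left; left.
- by move=> A; exact: (mmP _ _).2.
- by move=> A x Rx; have [_ /(_ x) + _] := pickS _ A (mmP #|` A|); apply; left; right.
move=> A A' AA'; move En : #|` A'| => n; elim: n A' AA' En => [|n IH] A' AA' En.
  move/eqP: En; rewrite cardfs_eq0 => /eqP A'0; move: AA'; rewrite A'0 fsubset0 => /eqP ->.
  by rewrite cardfs0.
have [->|nAA'] := eqVneq A A'; first by rewrite En.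
have /fsubsetPn[y yA' yA] : ~~ (A' `<=` A)%fset by move: nAA'; rewrite eqEfsubset AA'.
apply: (@subset_trans _ (mm n.+1 (A' `\ y)%fset)).
  apply: IH; last by apply/eqP; rewrite -eqSS -En (cardfsD1 y A') yA' add1n.
  by apply/fsubsetP => z zA; rewrite !inE (fsubsetP AA')// andbT; apply: contraNneq yA => <-.
move=> z zm; have [_ /(_ z) + _] := pickS _ A' (mmP n.+1); apply.
by right; exists y.
Qed.

End Skolem.
End AEC.

(** * Limits of structures along a filter *)

Record lfilter (l : ZF) I (D : set_system I) : Prop := LFilter {
  lfilterT : D setT;
  lfilter0 : ~ D set0;
  lfilterS : forall S S' : set I, S `<=` S' -> D S -> D S';
  lfilter_complete : forall F : ZF -> set I, (forall x, x ∈ l -> D (F x)) ->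
    D [set i | forall x, x ∈ l -> F x i] }.

Section Filter.
Variables (l : ZF) (I : Type) (D : set_system I).
Hypotheses (linf : infinite_set l) (Df : lfilter l D).

Lemma lfilter_all T (X : set T) (F : T -> set I) : X #<= l ->
  (forall t, X t -> D (F t)) -> D [set i | forall t, X t -> F t i].
Proof.
move=> Xl XF; have [X0|[t0 Xt0]] : X `<=` set0 \/ X !=set0.
  have [|nX] := pselect (X !=set0); [by right|left => t Xt].
  by case: nX; exists t.
  by apply: (lfilterS Df) (lfilterT Df) => i _ t /X0.
have [g gX gs] := card_le_onto Xl (ex_intro _ t0 Xt0).
apply: (lfilterS Df) (lfilter_complete Df (F := fun x => F (g x)) _) => [i gi t /gs[x xl <-]|x xl].
  exact: gi.
exact/XF/gX.
Qed.

Lemma lfilterI (S S' : set I) : D S -> D S' -> D (S `&` S').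
Proof.
move=> DS DS'; apply: (lfilterS Df) (lfilter_all (X := [set: bool]) (F :=
  fun b => if b then S else S') _ _).
- by move=> i H; split; [exact: (H true)|exact: (H false)].
- by apply: card_finite => //.
- by case.
Qed.

Lemma lfilter_ex (S : set I) : D S -> exists i, S i.
Proof.
move=> DS; apply: contrapT => nS; apply: (lfilter0 Df); apply: (lfilterS Df) DS => i Si.
by apply: nS; exists i.
Qed.

Lemma lfilterC (S : set I) : D S -> ~ D (~` S).
Proof. by move=> DS DC; have [i []] := lfilter_ex (lfilterI DS DC). Qed.

(** If [D] contained every complement, it would contain their intersection, which misses the cover.
    This makes a witness that varies with the index independent of it. *)
Lemma lfilter_piece T (X : set T) (F : T -> set I) : X #<= l ->
  D [set i | exists2 t, X t & F t i] -> (forall t, X t -> D (F t) \/ D (~` F t)) ->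
  exists2 t, X t & D (F t).
Proof.
move=> Xl DX dec; apply: contrapT => nX.
have /(lfilterI DX)/lfilter_ex[i [[t Xt Fti] /(_ t Xt)]] : D [set i | forall t, X t -> (~` F t) i].
  by apply: lfilter_all => // t Xt; have [Ft|//] := dec t Xt; case: nX; exists t.
exact.
Qed.

Lemma lfilter_iff (p : Prop) (S : set I) : D [set i | p <-> S i] -> p <-> D S.
Proof.
move=> H; split=> [hp|DS]; first by apply: (lfilterS Df) H => i [] /(_ hp).
by have [i [[_ ] ]] := lfilter_ex (lfilterI H DS).
Qed.

End Filter.

Section LimitStructure.
Variables (tau : vocabulary) (l nu : ZF) (I : Type) (D : set_system I).
Hypotheses (linf : infinite_set l) (Df : lfilter l D).
Variables (P : I -> structure tau) (T : Type) (ev : I -> T -> ZF).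
Hypothesis ev_in : forall i t, ev i t ∈ P i.
Hypothesis T_nu : [set: T] #<= nu.
Hypothesis ev_closed : forall s (a : 'I_(farity s) -> T),
  exists t, D [set i | holds (P i) (ev i) (FFun a t)].

Let E t u := D [set i | ev i t = ev i u].

Let E_sym t u : E t u -> E u t.
Proof. by apply: (lfilterS Df) => i /esym. Qed.

Let E_trans t u w : E t u -> E u w -> E t w.
Proof. by move=> tu uw; apply: (lfilterS Df) (lfilterI linf Df tu uw) => i [/= -> ->]. Qed.

Let all_E n (a b : 'I_n -> T) : (forall m, E (a m) (b m)) ->
  D [set i | forall m, ev i (a m) = ev i (b m)].
Proof.
move=> ab; have := lfilter_all Df (X := [set: 'I_n]) _ (fun m _ => ab m).
move=> H; apply: (lfilterS Df) (H _) => [i iP m|]; first exact: iP.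
exact: card_finite.
Qed.

(** The part of the reduced product given by the functions in [T]. For atomic statements Łoś's
    equivalence is built into the quotient; their negations are transferred in [limit_facts], where
    [D] decides them. *)
Lemma limit_structure : exists (U : structure tau) (q : T -> ZF), (U : set ZF) = range q /\
  forall p : fact tau T, holds U q p <-> D [set i | holds (P i) (ev i) p].
Proof.
have [j jnu j_inj] := card_le_ex empty T_nu.
(* The choice depends on the set alone by proof irrelevance ([FE]), so equal classes get equal
   representatives. *)
pose F (S : set T) (h : S !=set0) : T := projT1 (cid h).
have FE S S' (h : S !=set0) (h' : S' !=set0) : S = S' -> F S h = F S' h'.
  by move=> SS; subst S'; congr F; exact: Prop_irrelevance.
have ne t : E t !=set0 by exists t; apply: (lfilterS Df) (lfilterT Df).
pose rep t := F (E t) (ne t).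
have repE t : E t (rep t) := projT2 (cid (ne t)).
have rep_eq t u : E t u -> rep t = rep u.
  move=> tu; apply: FE; apply/seteqP; split=> w; first exact/E_trans/E_sym.
  exact: E_trans.
pose q t := j (rep t).
have qE t u : q t = q u <-> E t u.
  split=> [/j_inj ru|tu]; last by rewrite /q (rep_eq _ _ tu).
  by apply: E_trans (repE t) _; rewrite ru //; exact/E_sym/repE.
pose u := setof (range q).
have uP y : y ∈ u <-> range q y.
  by apply: setofE; apply: (@is_set_sub nu) => _ [t _ <-]; exact: jnu.
have [p pP] : exists p : set_type u -> T, forall y, q (p y) = val y.
  suff H (y : set_type u) : exists t, q t = val y by have [p pP] := choice_ex H; exists p.
  by have /uP[t _ <-] := set_valP y; exists t.
have [clos closP] := choice_ex (fun sa : {s & 'I_(farity s) -> T} => ev_closed (projT2 sa)).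
have qu t : q t ∈ u by apply/uP; exists t.
pose U : structure tau := {| univ := u;
  fint := fun s b => SigSub (mem_set (qu (clos (existT _ s (fun m => p (b m))))));
  rint := fun r b => D [set i | holds (P i) (ev i) (FRel (fun m => p (b m)))] |}.
have pq n (b : 'I_n -> set_type u) (a : 'I_n -> T) :
    (forall m, val (b m) = q (a m)) -> forall m, E (p (b m)) (a m).
  by move=> ba m; apply/qE; rewrite pP ba.
pose Q t : set_type u := SigSub (mem_set (qu t)).
exists U, q; split; first by apply/seteqP; split=> y /uP.
case=> [t w|s a t|r a].
- rewrite /= qE; split=> [[tw _]|tw].
    by apply: (lfilterS Df) tw => i /= ->; split=> //; exact: ev_in.
  by split; [apply: (lfilterS Df) tw => i /= []|exact: qu].
- have key (b : 'I_(farity s) -> set_type u) : (forall m, val (b m) = q (a m)) ->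
      D [set i | holds (P i) (ev i) (FFun a (clos (existT _ s (fun m => p (b m)))))].
    move=> ba; apply: (lfilterS Df) (lfilterI linf Df (all_E (pq _ _ _ ba)) (closP (existT
      _ s (fun m => p (b m))))).
    by move=> i [/= ab [c ca cE]]; exists c => // m; rewrite ca ab.
  split=> [[b ba /qE bt]|at_].
    apply: (lfilterS Df) (lfilterI linf Df (key b ba) bt) => i [/= [c ca cE] iE].
    by exists c => //; rewrite cE.
  have bq m : val (Q (a m)) = q (a m) by [].
  exists (fun m => Q (a m)) => //; apply/qE.
  apply: (lfilterS Df) (lfilterI linf Df (key _ bq) at_) => i [/= h1 h2].
  exact: holds_fun_uniq h1 h2.
- have key (b : 'I_(rarity r) -> set_type u) : (forall m, val (b m) = q (a m)) ->
      D [set i | holds (P i) (ev i) (FRel (fun m =>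
        p (b m)))] <-> D [set i | holds (P i) (ev i) (FRel a)].
    move=> /pq/all_E ab; split=> h;
      apply: (lfilterS Df) (lfilterI linf Df ab h) => i [/= iE [c ca cr]];
      by exists c => // m; rewrite ca iE.
  split=> [[b ba /key]|h]; first exact.
  by exists (fun m => Q (a m)) => //; apply/key.
Qed.

End LimitStructure.

Definition entries tau T (p : fact tau T) : set T :=
  match p with
  | FEq t u => [set t; u]
  | FFun s a t => t |` range a
  | FRel r a => range a
  end.

Lemma finite_entries tau T (p : fact tau T) : finite_set (entries p).
Proof.
case: p => [t u|s a t|r a] /=; rewrite ?finite_setU.
- by split; exact: finite_set1.
- by split; [exact: finite_set1|exact/finite_image/finite_finset].
- exact/finite_image/finite_finset.
Qed.

Lemma holds_congr tau (M : structure tau) T (v w : T -> ZF) (p : fact tau T) :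
  (forall t, entries p t -> v t = w t) -> holds M v p -> holds M w p.
Proof.
case: p => [t u|s a t|r a] /= vw.
- by rewrite !vw; [|right|left].
- move=> [b ba bt]; exists b => [m|]; last by rewrite bt vw//; left.
  by rewrite ba vw//; right; exists m.
- by move=> [b ba br]; exists b => // m; rewrite ba vw//; exists m.
Qed.

(** * Strong submodels of the limit structure *)

Section Charts.
Variables (tau : vocabulary) (k : aec tau) (l : ZF) (I : Type) (D : set_system I).
Hypotheses (linf : infinite_set l) (Df : lfilter l D).
Hypothesis ltau : [set: fsym tau] ⊎ [set: rsym tau] #<= l.
Variables (P : I -> structure tau) (T : Type) (ev : I -> T -> ZF).
Variables (U : structure tau) (q : T -> ZF).
Hypothesis qU : forall p : fact tau T, holds U q p <-> D [set i | holds (P i) (ev i) p].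
Hypothesis dec : forall p : fact tau T,
  D [set i | holds (P i) (ev i) p] \/ D (~` [set i | holds (P i) (ev i) p]).

(** There are at most [l] facts over [L]. Each is decided by [D], and completeness collects the
    decisions on one set of indices. *)
Lemma limit_facts L (c : L -> T) : [set: L] #<= l ->
  D [set i | forall p : fact tau L, holds (P i) (fun x =>
    ev i (c x)) p <-> holds U (fun x => q (c x)) p].
Proof.
move=> Ll; pose G (p :
  fact tau L) := [set i | holds (P i) (fun x => ev i (c x)) p <-> holds U (fun x => q (c x)) p].
have DG p : [set: fact tau L] p -> D (G p).
  move=> _; have [h|h] := dec (fmap c p).
    apply: (lfilterS Df) (h) => i /holds_fmap hi; split=> // _.
    by apply/holds_fmap/qU.
  apply: (lfilterS Df) (h) => i hi; split=> [/holds_fmap/hi//|/holds_fmap/qU h'].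
  by case: (lfilterC linf Df h').
by apply: (lfilterS Df) (lfilter_all Df (card_fact linf ltau Ll) DG) => i iP p; exact: iP.
Qed.

Definition chart (L : Type) (b : L -> T) : Prop :=
  D [set i | exists2 Q, le k Q (P i) & (Q : set ZF) = range (fun x => ev i (b x))].

(** Equalities are facts too, so sending the value of [c x] at the index [i] to its class is well
    defined; preservation of the other facts makes it an embedding on each substructure covered by
    the tuple. *)
Let chart_of i L (c : L -> T) :
  (forall p : fact tau L, holds (P i) (fun x => ev i (c x)) p <-> holds U (fun x => q (c x)) p) ->
  exists h, (forall x, ev i (c x) ∈ P i -> h (ev i (c x)) = q (c x)) /\
   forall Q, substructure Q (P i) -> Q `<=` range (fun x => ev i (c x)) -> embedding h Q U.
Proof.
move=> H; have [h hP] : exists h : ZF -> ZF, forall x, ev i (c x) ∈ P i -> h (ev i (c x)) = q (c x).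
  suff K y : exists w, forall x, ev i (c x) ∈ P i -> ev i (c x) = y -> q (c x) = w.
    by have [h hP] := choice_ex K; exists h => x xP; rewrite (hP (ev i (c x)) x).
  have [[x [xP xy]]|nx] := pselect (exists x, ev i (c x) ∈ P i /\ ev i (c x) = y).
    exists (q (c x)) => x' x'P x'y.
    by have [|] := (H (FEq _ x' x)).1; first by split; rewrite ?xy.
  by exists y => x xP xy; case: nx; exists x.
exists h; split=> // Q' Q'P Q'c.
have QP y : y ∈ Q' -> y ∈ P i by exact: (embedding_mem Q'P).
have [s sP] : exists s : set_type Q' -> L, forall y, ev i (c (s y)) = val y.
  suff K (y : set_type Q') : exists x, ev i (c x) = val y by have [s sP] := choice_ex K; exists s.
  by have [x _ xy] := Q'c _ (valM y); exists x.
have hs (y : set_type Q') : h (val y) = q (c (s y)).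
  by rewrite -sP hP// sP; exact/QP/valM.
apply: holds_embedding => [y yQ|p].
  rewrite (hs (toM yQ)).
  have [|//] := (H (FEq _ (s (toM yQ)) (s (toM yQ)))).1.
  by split=> //; rewrite sP; exact: QP.
rewrite (embedding_holds Q'P _ (@valM _ Q')).
have := H (fmap s p); rewrite !holds_fmap => E.
rewrite (_ : (fun t : set_type Q' => id (val t)) = fun t => ev i (c (s t)));
  last by apply/funext => y.
by rewrite E (_ : (fun t => q (c (s t))) = fun t : set_type Q' => h (val t))//; apply/funext => y.
Qed.

(** The two tuples are joined into one tuple [c], and a single index is taken at which its diagram
    is that of the limit and both ranges are strong submodels, one inside the other. The map of
    [chart_of] copies both into [U], and [le] is invariant under isomorphism. *)
Lemma chart_le L L' (b : L -> T) (b' : L' -> T) : [set: L] #<= l -> [set: L'] #<= l ->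
  chart b -> chart b' ->
  D [set i | range (fun x => ev i (b x)) `<=` range (fun x => ev i (b' x))] ->
  [/\ le k (restr U (range (fun x => q (b x)))) (restr U (range (fun x => q (b' x)))),
      substructure (restr U (range (fun x => q (b x)))) U &
      (restr U (range (fun x => q (b x))) : set ZF) = range (fun x => q (b x))].
Proof.
move=> Ll L'l cb cb' Dbb'.
pose c (z : L + L') := match z with inl x => b x | inr x => b' x end.
have LL : [set: L + L'] #<= l.
  by apply: card_le_trans (card_dsum linf Ll L'l); apply: subset_card_le => -[].
have [i [[[/= Hi [Q QP QE]] [Q' Q'P Q'E]] bb']] :=
  lfilter_ex Df (lfilterI linf Df (lfilterI linf Df (lfilterI linf Df (limit_facts c LL)
    cb) cb') Dbb').
have [h [hP hE]] := chart_of Hi.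
have QsP := le_substructure QP; have Q'sP := le_substructure Q'P.
have img L0 (g : L0 -> L + L') (R : structure tau) :
    substructure R (P i) -> (R : set ZF) = range (fun x => ev i (c (g x))) ->
    exists B, [/\ isomorphism h R B, substructure B U & (B :
      set ZF) = range (fun x => q (c (g x)))].
  move=> RP RE; have eR : embedding h R U by apply: hE => //; rewrite RE => _ [x _ <-];
    exists (g x).
  have [B hB] := iso_copy (fun x y => @embedding_inj _ _ _ _ x y eR); exists B; split=> //.
    exact: embedding_image eR _ hB.
  have hg x : h (ev i (c (g x))) = q (c (g x)).
    by rewrite hP//; apply: (embedding_mem RP); rewrite RE; exists x.
  rewrite (iso_image hB) RE; apply/seteqP; split=> [_ [_ [x _ <-] <-]|_ [x _ <-]].
    by exists x.
  by exists (ev i (c (g x))) => //; exists x.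
have [B [hB BU BE]] := img _ inl Q QsP QE; have [B' [hB' B'U B'E]] := img _ inr Q' Q'sP Q'E.
rewrite -[range (fun x => q (b x))]BE -[range (fun x => q (b' x))]B'E !restrE//; split=> //.
apply: le_iso hB' hB; apply: le_between QP Q'P.
by rewrite QE Q'E.
Qed.

End Charts.

(* [D] may depend on [F]: on a weakly compact cardinal no single filter decides
   all sets. *)
Definition limit_filters (l nu : ZF) I (B : set_system I) : Prop :=
  forall F : ZF -> set I, exists D : set_system I,
    [/\ lfilter l D, B `<=` D & forall a, a ∈ nu -> D (F a) \/ D (~` F a)].

(** * Gluing partial amalgams along a filter *)

Section Amalgamation.
Variables (tau : vocabulary) (k : aec tau) (l nu : ZF).
Hypothesis linf : infinite_set l.
Hypothesis ltau : [set: fsym tau] ⊎ [set: rsym tau] #<= l.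
Hypothesis lLS : forall N (A : set ZF), K k N -> A `<=` N ->
  exists M, [/\ le k M N, A `<=` M & M #<= l ⊎ A].
Hypotheses (nuo : ordinal nu) (lnu : l #<= nu).
Variables (I : Type) (B : set_system I).
Hypothesis Bfilters : limit_filters l nu B.
Variables (M : structure tau) (N : bool -> structure tau) (x0 : ZF).
Hypotheses (x0M : x0 ∈ M) (MN : forall e, le k M (N e)) (Nnu : forall e, N e #<= nu).
Variables (P : I -> structure tau) (d : bool -> I -> structure tau) (f : bool -> I -> ZF -> ZF).
Hypotheses (Pne : forall i, exists y, y ∈ P i)
  (dN : forall e i, le k (d e i) (N e))
  (fP : forall e i, le_embedding k (f e i) (d e i) (P i))
  (Nd : forall e x, x ∈ N e -> B [set i | x ∈ d e i])
  (fM : forall x, x ∈ M -> B [set i | f true i x = f false i x]).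

Let X : choiceType := {classic {e : bool & set_type (N e)}}.
Let L := set_type l.
(** The functions of the reduced product. [inr y] follows a point [y] of [N true] or [N false]
    through the partial embeddings; [inl (A, x)] is the entry number [x] in an enumeration of the
    small strong submodel of [P i] attached to the finite set [A]. *)
Let T : Type := ({fset X} * L + X)%type.

Let nuinf : infinite_set nu. Proof. exact: infinite_le linf lnu. Qed.

Let xin e x (xN : x ∈ N e) : X := existT (fun e => set_type (N e)) e (toM xN).

Let X_nu : [set: X] #<= nu.
Proof.
have Hinj e : exists g : ZF -> ZF, (forall x, x ∈ N e -> g x ∈ nu) /\
    (forall x y, x ∈ N e -> y ∈ N e -> g x = g y -> x = y).
  by have [g g1 g2] := card_le_ex empty (Nnu e); exists g.
have [g gP] := choice_ex Hinj.
have bnu : [set: bool] #<= nu by apply: card_finite.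
apply: card_le_trans (card_setX nuinf bnu (card_lexx nu)).
apply: (@card_le_inj _ _ _ _ (fun y : X => (projT1 y, g (projT1 y) (val (projT2 y))))).
  by move=> [e x] _; split=> //=; apply: (gP e).1; exact: valM.
move=> [e x] [e' y] _ _ /= [ee]; subst e' => /(gP e).2 xy.
by congr existT; apply: val_inj; apply: xy; exact: valM.
Qed.

Let T_nu : [set: T] #<= nu.
Proof.
have Fnu : [set: {fset X}] #<= nu.
  apply: card_le_trans (card_seq nuinf X_nu).
  apply: (@card_le_inj _ _ _ _ (fun A : {fset X} => enum_fset A)) => // A A' _ _ AA'.
  by apply/fsetP => x; rewrite -[x \in A]/(x \in enum_fset A) AA'.
have Lnu : [set: L] #<= nu by apply: card_le_trans lnu; apply: card_eq_lel; exact: card_setT.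
apply: card_le_trans (card_dsum nuinf (card_setX nuinf Fnu Lnu) X_nu).
by apply: subset_card_le => -[].
Qed.

Let enumL (A : set ZF) : A #<= l -> A !=set0 -> exists e : L -> ZF, A = range e.
Proof.
move=> Al Ane; have [g gA gs] := card_le_onto Al Ane.
exists (fun x => g (val x)); apply/seteqP; split=> [y /gs[x xl <-]|_ [x _ <-]]; last exact: gA.
by exists (SigSub (mem_set xl)).
Qed.

(** Two families of charts are compared. Those made of [inl] functions have strong submodels [BA A]
    of [U] as images and exhaust [U]. Those made of [inr] functions have images [BM e A], which
    exhaust the copy of [N e], and satisfy [le] between [BM e A] and [BA A]; hence the copy of [N e]
    is strong in [U]. *)
Lemma amalgamation_limit : exists M3, le k M M3 /\ forall e, embeds_over k M (N e) M3.
Proof.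
have L_l : [set: L] #<= l by apply: card_eq_lel; exact: card_setT.
have x0N e : x0 ∈ N e by exact: (le_subset (MN e)).
have [ms msP] : exists ms : bool -> {fset X} -> structure tau, forall e,
    [/\ forall A, le k (ms e A) (N e), forall A, x0 ∈ ms e A, forall A, ms e A #<= l,
      forall A x (xN : x ∈ N e), xin xN \in A -> x ∈ ms e A &
      forall A A', (A `<=` A')%fset -> ms e A `<=` ms e A'].
  suff H e : exists m : {fset X} -> structure tau,
    [/\ forall A, le k (m A) (N e), forall A, x0 ∈ m A, forall A, m A #<= l,
      forall A x (xN : x ∈ N e), xin xN \in A -> x ∈ m A &
      forall A A', (A `<=` A')%fset -> m A `<=` m A'].
    by have [ms msP] := choice_ex H; exists ms.
  pose R (A : {fset X}) : set ZF := [set x | exists2 xN : x ∈ N e, xin xN \in A & True].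
  have [A x []//|A|m [m1 m2 m3 m4 m5]] := skolem_system linf lLS (le_Kr (MN e)) (x0N e) (R := R).
    apply: (card_le_trans (B := [set` A])); last exact/card_finite/finite_fset.
    apply: (@card_le_rel _ _ _ _ (fun x y => exists xN : x ∈ N e, y = xin xN)).
      by move=> x [xN xA _]; exists (xin xN) => //; exists xN.
    by move=> x y _ _ _ [xN ->] [yN] /(congr1 (fun z : X => val (projT2 z))).
  by exists m; split=> // A x xN xA; apply: m4; exists xN.
have msN e A : le k (ms e A) (N e) by have [] := msP e.
have ms0 e A : x0 ∈ ms e A by have [] := msP e.
have msl e A : ms e A #<= l by have [] := msP e.
have msX e A x (xN : x ∈ N e) : xin xN \in A -> x ∈ ms e A by have [_ _ _ + _] := msP e; apply.
have msS e (A A' : {fset X}) : (A `<=` A')%fset ->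
  ms e A `<=` ms e A' by have [_ _ _ _] := msP e; apply.
(* The submodel of [P i] attached to [A] must contain the images of both small submodels attached to
   [A]; this makes [bMA] true. *)
pose R i (A : {fset X}) : set ZF := [set y | exists e x, [/\ x ∈ ms e A, x ∈ d e i & f e i x = y]].
have [pm pmP] : exists pm : I -> {fset X} -> structure tau, forall i,
    [/\ forall A, le k (pm i A) (P i), forall A, pm i A !=set0, forall A, pm i A #<= l,
      forall A, R i A `<=` pm i A &
      forall A A', (A `<=` A')%fset -> pm i A `<=` pm i A'].
  suff H i : exists m : {fset X} -> structure tau,
    [/\ forall A, le k (m A) (P i), forall A, m A !=set0, forall A, m A #<= l,
      forall A, R i A `<=` m A &
      forall A A', (A `<=` A')%fset -> m A `<=` m A'].
    by have [pm pmP] := choice_ex H; exists pm.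
  have [p pP] := Pne i.
  have [A y [e [x [_ xd <-]]]|A|m [m1 m2 m3 m4 m5]] :=
      skolem_system linf lLS (le_embedding_Kr (fP true i)) pP (R := R i).
  - exact: (embedding_mem (le_embedding_embedding (fP e i))).
  - have -> : R i A = \bigcup_(e in [set: bool]) (f e i @` (ms e A `&` d e i)).
      apply/seteqP; split=> [y [e [x [xm xd xy]]]|y [e _ [x [xm xd] xy]]].
        by exists e => //; exists x.
      by exists e, x.
    apply: card_bigcup => // [|e _]; first exact: card_finite.
    apply: card_le_trans (card_image_le _ _) _.
    by apply: card_le_trans (msl e A); apply: subset_card_le => x [].
  - by exists m; split=> // A; exists p.
have pmPi i A : le k (pm i A) (P i) by have [] := pmP i.
have pmR i A e x : x ∈ ms e A -> x ∈ d e i -> f e i x ∈ pm i A.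
  by move=> xm xd; have [_ _ _ H _] := pmP i; apply: H; exists e, x.
have pmS i (A A' : {fset X}) : (A `<=` A')%fset -> pm i A `<=` pm i A'.
  by have [_ _ _ _] := pmP i; apply.
have pmE i A : exists e : L -> ZF, (pm i A : set ZF) = range e.
  by apply: enumL; have [] := pmP i.
have [en enE] := choice_ex (fun z : I * {fset X} => pmE z.1 z.2).
have [p0 p0P] := choice_ex Pne.
(* The default [p0 i] stands in while the point is outside the domain [d e i]. By [Nd] this happens,
   for each point, only off a set of the filter. *)
pose ev i (t : T) : ZF := match t with
  | inl (A, x) => en (i, A) x
  | inr y => if pselect (val (projT2 y) ∈ d (projT1 y) i) then f (projT1 y) i (val (projT2
    y)) else p0 i
  end.
have ev_inr e i x (xN : x ∈ N e) : x ∈ d e i -> ev i (inr (xin xN)) = f e i x.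
  by rewrite /=; case: pselect.
have ev_inl i A x : ev i (inl (A, x)) ∈ pm i A by rewrite (enE (i, A)) /=; exists x.
have ev_in i t : ev i t ∈ P i.
  case: t => [[A x]|[e x]]; first exact: (le_subset (pmPi i A)).
  rewrite /=; case: pselect => // xd.
  exact: (embedding_mem (le_embedding_embedding (fP e i))).
have fact_nu : [set: fact tau T] #<= nu by apply: card_fact => //; exact: card_le_trans lnu.
have [x00 xl0] : exists x, x ∈ l by have [x] := infinite_setN0 linf; exists x.
pose t0 : T := inl (fset0, SigSub (mem_set xl0)).
have [fa _ fas] := card_le_onto fact_nu (ex_intro _ (FEq tau t0 t0) Logic.I).
(* Only now, with [ev] fixed and the facts over [T] listed along [nu], can the filter be chosen. *)
have [D [Df BD dec']] := Bfilters (fun a => [set i | holds (P i) (ev i) (fa a)]).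
have dec (p : fact tau T) :
  D [set i | holds (P i) (ev i) p] \/ D (~` [set i | holds (P i) (ev i) p]).
  by have [a anu <-] := fas p Logic.I; exact: dec'.
have dec_eq t u : D [set i | ev i t = ev i u] \/ D (~` [set i | ev i t = ev i u]).
  have [h|h] := dec (FEq tau t u); [left|right]; apply: (lfilterS Df) h => i //=; first by case.
  by move=> h tu; apply: h; split.
have ev_pm t : exists A : {fset X}, D [set i | ev i t ∈ pm i A].
  case: t => [[A x]|[e x]].
    by exists A; apply: (lfilterS Df) (lfilterT Df) => i _; exact: ev_inl.
  have xN : val x ∈ N e by exact: valM.
  have xE : existT (fun e => set_type (N e)) e x = xin xN by congr existT; exact: val_inj.
  exists [fset xin xN]%fset; rewrite xE.
  apply: (lfilterS Df) (BD _ (Nd xN)) => i xd; rewrite /mkset ev_inr//.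
  by apply: pmR => //; apply: (msX _ _ _ xN); rewrite inE.
have closed s (a : 'I_(farity s) -> T) : exists t, D [set i | holds (P i) (ev i) (FFun a t)].
  have [A AP] := choice_ex (fun m => ev_pm (a m)).
  have [A' A'A] : exists A' : {fset X}, forall m, (A m `<=` A')%fset.
    suff [A' H] : exists A' : {fset X}, forall m, m \in enum 'I_(farity s) -> (A m `<=` A')%fset.
      by exists A' => m; apply: H; rewrite mem_enum.
    elim: (enum 'I_(farity s)) => [|m r [A' H]]; first by exists fset0.
    exists (A m `|` A')%fset => m'; rewrite inE => /orP[/eqP->|/H h]; first exact: fsubsetUl.
    by apply: fsubset_trans h _; exact: fsubsetUr.
  have Da : D [set i | forall m, [set: 'I_(farity s)] m -> ev i (a m) ∈ pm i A'].
    apply: (lfilter_all Df) => [|m _]; first exact: card_finite.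
    by apply: (lfilterS Df) (AP m) => i; exact: pmS.
  (* At almost every index the value of the function lies in [pm i A'], so it is one of the [l]
     entries there. The entry depends on the index; deciding [l] statements makes it constant. *)
  have [x _ xP] : exists2 x : L, [set: L] x & D [set i | holds (P i) (ev i) (FFun a (inl (A', x)))].
    apply: (lfilter_piece linf Df L_l) => [|x _]; last exact: dec.
    apply: (lfilterS Df) Da => i am.
    have am' m : ev i (a m) ∈ pm i A' by exact: am.
    have : val (@fint tau (pm i A') s (fun m => toM (am' m))) ∈ pm i A' by exact: valM.
    rewrite {1}(enE (i, A')) => -[x _ xE]; exists x => //.
    have [_ _ F _] := le_substructure (pmPi i A').
    exists (fun m => toM (ev_in i (a m))) => //.
    by rewrite (F s (fun m => toM (am' m))) //= xE.
  by exists (inl (A', x)).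
have [U [q [UE qU]]] := limit_structure linf Df ev_in T_nu closed.
have qeq t u : q t = q u <-> D [set i | ev i t = ev i u].
  have h := qU (FEq tau t u); split=> [tu|tu].
    have : holds U q (FEq tau t u) by split=> //; rewrite UE; exists t.
    by move/h; apply: (lfilterS Df) => i [].
  by have [|//] := h.2; apply: (lfilterS Df) tu => i /= ->; split.
pose bA (A : {fset X}) (x : L) : T := inl (A, x).
have pmrange i A : (pm i A : set ZF) = range (fun x => ev i (bA A x)) by exact: (enE (i, A)).
have chA A : chart k D P ev (bA A).
  by apply: (lfilterS Df) (lfilterT Df) => i _; exists (pm i A).
have bAle (A A' : {fset X}) : (A `<=` A')%fset ->
    D [set i | range (fun x => ev i (bA A x)) `<=` range (fun x => ev i (bA A' x))].
  by move=> AA'; apply: (lfilterS Df) (lfilterT Df) => i _; rewrite /mkset -!pmrange; exact: pmS.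
have cle := chart_le (k := k) linf Df ltau qU dec L_l L_l.
have [g gnu gi] := card_le_ex empty X_nu.
have gi' : injective g by move=> x y; exact: gi.
have gnu' x : g x ∈ nu by exact: gnu.
pose BA A := restr U (range (fun x => q (bA A x))).
have BAsub A : substructure (BA A) U by have [] :=
  cle _ _ (chA A) (chA A) (bAle _ _ (fsubset_refl A)).
have BAE A : (BA A : set ZF) = range (fun x => q (bA A x)).
  by have [] := cle _ _ (chA A) (chA A) (bAle _ _ (fsubset_refl A)).
have BAle (A A' : {fset X}) : (A `<=` A')%fset -> le k (BA A) (BA A').
  by move=> AA'; have [] := cle _ _ (chA A) (chA A') (bAle _ _ AA').
(* The directed union of the [BA A] is all of [U], since each function agrees almost everywhere with
   an entry of some chart. Thus [U] is in the class. *)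
have BAU A : le k (BA A) U.
  have [V [VU VE BAV _]] := directed_union gi' BAsub BAle nuo gnu'.
  suff <- : V = U by [].
  apply: substructure_anti => //; rewrite UE VE => _ [t _ <-].
  have [C Ct] := ev_pm t; exists C; rewrite BAE.
  have [|x _ /qeq tx] := lfilter_piece linf Df L_l (F :=
    fun x => [set i | ev i t = ev i (bA C x)]) _ (fun x _ => dec_eq _ _).
    by apply: (lfilterS Df) Ct => i; rewrite /mkset pmrange => -[x _ xE]; exists x.
  by exists x.
have [en' en'E] : exists en' : bool -> {fset X} -> L ->
  ZF, forall e A, (ms e A : set ZF) = range (en' e A).
  have H z : exists h : L -> ZF, (ms z.1 z.2 : set ZF) = range h.
    by apply: enumL => //; exists x0.
  by have [h hP] := choice_ex H; exists (fun e A => h (e, A)) => e A; exact: (hP (e, A)).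
have en'N e A x : en' e A x ∈ N e.
  by apply: (le_subset (msN e A)); rewrite /= en'E; exists x.
(* The small submodel of [N e] is enumerated in length [l] as well, but by functions of the second
   kind. *)
pose bM e (A : {fset X}) (x : L) : T := inr (xin (en'N e A x)).
have bMrange e A : D [set i | ms e A `<=` d e i /\
    range (fun x => ev i (bM e A x)) = f e i @` ms e A].
  have : D [set i | forall x, x ∈ ms e A -> x ∈ d e i].
    apply: (lfilter_all Df) => // x xm.
    exact/BD/Nd/(le_subset (msN e A)).
  apply: (lfilterS Df) => i iP; split=> //; rewrite en'E; apply/seteqP;
    split=> [_ [x _ <-]|_ [_ [x _ <-] <-]].
    exists (en' e A x); first by exists x.
    by rewrite ev_inr//; apply: iP; rewrite en'E; exists x.
  by exists x => //; rewrite ev_inr//; apply: iP; rewrite en'E; exists x.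
have chM e A : chart k D P ev (bM e A).
  apply: (lfilterS Df) (bMrange e A) => i [msd h1]; rewrite /mkset h1.
  have md : le k (ms e A) (d e i) by apply: le_between msd (msN e A) (dN e i).
  have [Q fQ QP] := le_embedding_restrict md (fP e i).
  by exists Q => //; exact: iso_image fQ.
have bMle e (A A' : {fset X}) : (A `<=` A')%fset ->
    D [set i | range (fun x => ev i (bM e A x)) `<=` range (fun x => ev i (bM e A' x))].
  move=> AA'; apply: (lfilterS Df) (lfilterI linf Df (bMrange e A) (bMrange e A')) => i.
  move=> [[_ h1] [_ h2]]; rewrite /mkset h1 h2 => _ [x xm <-]; exists x => //.
  exact: (msS e _ _ AA').
have bMA e A : D [set i | range (fun x => ev i (bM e A x)) `<=` range (fun x => ev i (bA A x))].
  apply: (lfilterS Df) (bMrange e A) => i [msd h1].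
  rewrite /mkset h1 -pmrange => _ [x xm <-].
  by apply: pmR => //; exact: msd.
pose BM e A := restr U (range (fun x => q (bM e A x))).
have BMsub e A : substructure (BM e A) U by have [] := cle _ _ (chM e A) (chA A) (bMA e A).
have BME e A : (BM e A : set ZF) = range (fun x => q (bM e A x)).
  by have [] := cle _ _ (chM e A) (chA A) (bMA e A).
have BMle e (A A' : {fset X}) : (A `<=` A')%fset -> le k (BM e A) (BM e A').
  by move=> AA'; have [] := cle _ _ (chM e A) (chM e A') (bMle e _ _ AA').
have BMU e A : le k (BM e A) U.
  by apply: le_trans (BAU A); have [] := cle _ _ (chM e A) (chA A) (bMA e A).
pose h e x : ZF := if pselect (x ∈ N e) is left xN then q (inr (xin xN)) else x.
have hE e x (xN : x ∈ N e) : h e x = q (inr (xin xN)).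
  rewrite /h; case: pselect => // xN'; congr (q (inr _)).
  by rewrite /xin; congr existT; exact: val_inj.
have hemb e : embedding (h e) (N e) U.
  apply: holds_embedding => [x xN|p]; first by rewrite hE UE; exists (inr (xin xN)).
  have -> : (fun t : set_type (N e) => h e (val t)) = fun t => q (inr (existT _ e t : X)).
    apply/funext => t; rewrite (hE _ _ (valM t)); congr (q (inr _)).
    by rewrite /xin; congr existT; exact: val_inj.
  rewrite -(holds_fmap (fun t : set_type (N e) => inr (existT _ e t : X) : T)) qU.
  apply: (lfilter_iff linf Df).
  (* The point [x0] is added to the parameters of [p] because [v] uses it as a value inside [d e i]
     for the points outside. *)
  have Dp : D [set i | forall t, (entries p `|` [set toM (x0N e)]) t -> val t ∈ d e i].
    apply: (lfilter_all Df) => [|t _]; last by exact/BD/Nd/valM.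
    by apply: card_finite => //; rewrite finite_setU; split;
      [exact: finite_entries|exact: finite_set1].
  apply: (lfilterS Df) Dp => i ip.
  have x0d : x0 ∈ d e i by apply: (ip (toM (x0N e))); right.
  pose v (t : set_type (N e)) := if pselect (val t ∈ d e i) then val t else x0.
  have vd t : v t ∈ d e i by rewrite /v; case: pselect.
  have vE t : entries p t -> v t = val t by move=> pt; rewrite /v; case: pselect => // -[];
    apply: ip; left.
  have h1 : holds (N e) val p <-> holds (N e) v p.
    by split; apply: holds_congr => t /vE.
  have h2 := embedding_holds (le_embedding_embedding (fP e i)) p vd.
  have h3 := embedding_holds (le_substructure (dN e i)) p vd.
  have h4 t : entries p t -> f e i (v t) = ev i (inr (existT _ e t : X)).
    move=> pt; rewrite vE// -(ev_inr e i (val t) (valM t)); last by apply: ip; left.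
    by congr (ev i (inr _)); rewrite /xin; congr existT; exact: val_inj.
  rewrite /mkset h1 -h3 h2 holds_fmap; split; apply: holds_congr => t /h4 //.
have hle e : le_embedding k (h e) (N e) U.
  have [V [VU VE _ VP]] := directed_union gi' (BMsub e) (BMle e) nuo gnu'.
  exists V; last exact: VP.
  have hV : h e @` N e = V.
    apply/seteqP; rewrite VE; split=> [_ [x xN <-]|y [A]].
      exists [fset xin xN]%fset; rewrite BME hE.
      have : x ∈ ms e [fset xin xN]%fset by apply: (msX _ _ _ xN); rewrite inE.
      rewrite en'E => -[y _ yx]; exists y => //.
      by congr (q (inr _)); rewrite /xin; congr existT; exact: val_inj.
    by rewrite BME => -[x _ <-]; exists (en' e A x) => //; rewrite hE.
  have [V' hV'] := iso_copy (fun x y => @embedding_inj _ _ _ _ x y (hemb e)).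
  suff <- : V' = V by [].
  apply: substructure_uniq (embedding_image (hemb e) hV') VU _.
  by rewrite (iso_image hV').
(* Renaming [U] turns [h true] into the identity on [M]. By [fM] the map [h false] has the same
   classes as [h true] on [M], so it becomes the identity there as well. *)
have [U' [w [wU MU wh]]] := extend_embedding (le_embedding_restrict (MN true) (hle true)).
exists U'; split=> // e; exists (fun x => w (h e x)); first exact: le_embedding_iso wU.
move=> x xM; rewrite -[RHS](wh x)//; congr w.
have xN e' := le_subset (MN e') xM.
rewrite (hE e _ (xN e)) (hE true _ (xN true)); apply/qeq.
apply: (lfilterS Df) (lfilterI linf Df (BD _ (fM xM)) (lfilterI linf Df (BD _ (Nd (xN e)))
  (BD _ (Nd (xN true))))).
by move=> i [fx [xd xd']]; rewrite /mkset (ev_inr e)// (ev_inr true)//; case: (e);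
  last exact/esym/fx.
Qed.
End Amalgamation.

(** * Regular, measurable and weakly compact cardinals *)

(** Regularity in the form in which it is used: short sequences are bounded. *)
Definition bounded_maps (c : ZF) : Prop := forall a g, a ∈ c ->
  (forall x, x ∈ a -> g x ∈ c) -> exists2 j, j ∈ c & forall x, x ∈ a -> g x ∈ j.

Lemma bounded_maps_regular c : cardinal c -> infinite_set c -> bounded_maps c -> regular c.
Proof.
move=> cc ic bc; have oc := cc.1; split=> //; split=> //.
  by exists id; split=> // y yc; exists y => //; right.
move=> a f oa [fc fcof]; apply: ord_nin_sub => // ac.
have [j jc fj] := bc a f ac fc; have [x xa [jf|jf]] := fcof _ jc.
  by have := fj _ xa; exact: mem_asym.
by have := fj _ xa; rewrite jf; exact: mem_irr.
Qed.

(** The base for gluing along [c]: a condition in [tails c] holds from some index on, and the limit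
    filters have to respect this. *)
Definition tails (c : ZF) : set_system (set_type c) :=
  [set S | exists2 j, j ∈ c & [set i | ~ val i ∈ j] `<=` S].

Arguments tails : clear implicits.

Lemma uncountable_infinite T (A : set T) : ~ countable A -> infinite_set A.
Proof. by move=> nA /finite_set_countable. Qed.

Section Measurable.
Variable c : ZF.
Hypothesis cm : measurable_cardinal c.

Lemma measurable_cardinal_cardinal : cardinal c. Proof. by case: cm. Qed.

Lemma measurable_infinite : infinite_set c.
Proof. by case: cm => _ /uncountable_infinite. Qed.

Let ultra := exists D :
  set_system (set_type c), [/\ UltraFilter D, complete_filter c D & tails c `<=` D].

(** An end segment of [c] is the intersection of fewer than [c] complements of points, each of which
    is in the nonprincipal ultrafilter. *)
Let measurable_tails : ultra.
Proof.
have [[oc cP] _ [D [Du Dc Dn]]] := cm; exists D; split=> // S [j jc jS].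
apply: filterS jS _.
pose Q : set (set (set_type c)) := (fun i => ~` [set i]) @` [set i | val i ∈ j].
have -> : [set i : set_type c | ~ val i ∈ j] = \bigcap_(X in Q) X.
  apply/seteqP; split=> [i ij _ [i' i'j <-] /= ii'|i iQ ij]; first by rewrite ii' in ij.
  by apply: (iQ (~` [set i])) => //; exists i.
apply: Dc.
  apply: card_le_lt (cP _ jc); apply: card_le_trans (card_image_le _ _) _.
  by apply: (@card_le_inj _ _ _ _ val) => // x y _ _; exact: val_inj.
by move=> _ [i _ <-]; have [/Dn|//] := in_ultra_setVsetC [set i] Du.
Qed.

(** The end segments past the values of [g] are fewer than [c] many members of the ultrafilter. Any
    common point is a bound. *)
Lemma measurable_bounded_maps : bounded_maps c.
Proof.
move=> a g ac gc; have [D [Du Dc Dt]] := measurable_tails.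
have [oc cP] := measurable_cardinal_cardinal.
have [_ _ sc] := infinite_cardinal_limit measurable_cardinal_cardinal measurable_infinite.
pose Q : set (set (set_type c)) := (fun x => [set i | ~ val i ∈ succ (g x)]) @` a.
have DQ : D (\bigcap_(X in Q) X).
  apply: Dc => [|_ [x xa <-]].
    by apply: card_le_lt (cP _ ac); exact: card_image_le.
  by apply: Dt; exists (succ (g x)) => //; exact/sc/gc.
have [i iQ] := filter_ex DQ.
exists (val i); first exact: set_valP.
move=> x xa; have /= : [set i | ~ val i ∈ succ (g x)] i by apply: iQ; exists x.
move=> ix; have [//|gi|ig] := ord_total (ord_in oc (gc _ xa)) (ord_in oc (set_valP i)).
  by case: ix; rewrite gi; exact: succ_self.
by case: ix; exact: succ_sub.
Qed.

Lemma measurable_limit_filters l nu : l ∈ c -> limit_filters l nu (tails c).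
Proof.
move=> lc F; have [D [Du Dc Dt]] := measurable_tails; exists D; split=> //.
  split=> [|/filter_not_empty//|S S' SS'|G GD]; first exact: filterT.
    exact: filterS.
  have -> : [set i | forall x, x ∈ l -> G x i] = \bigcap_(X in G @` l) X.
    apply/seteqP; split=> [i iG _ [x xl <-]|i iG x xl]; first exact: iG.
    by apply: iG; exists x.
  apply: Dc => [|_ [x xl <-]]; last exact: GD.
  by apply: card_le_lt (measurable_cardinal_cardinal.2 _ lc); exact: card_image_le.
by move=> a _; exact: in_ultra_setVsetC.
Qed.

End Measurable.

Section WeaklyCompact.
Variable c : ZF.
Hypothesis cw : weakly_compact c.

Lemma weakly_compact_cardinal : cardinal c. Proof. by case: cw. Qed.

Lemma weakly_compact_infinite : infinite_set c.
Proof. by case: cw => _ /uncountable_infinite. Qed.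

Let cc := weakly_compact_cardinal.
Let oc := cc.1.

Let unbounded (H : set ZF) : H `<=` c -> H #= c ->
  forall j j', j ∈ c -> j' ∈ c -> exists y, [/\ H y, j ∈ y & j' ∈ y].
Proof.
move=> Hc Heq.
have [_ _ sc] := infinite_cardinal_limit cc weakly_compact_infinite.
have one j : j ∈ c -> exists2 y, H y & j ∈ y.
  move=> jc; apply: contrapT => nH.
  have Hj : H `<=` succ j.
    move=> y Hy; have [jy|->|yj] := ord_total (ord_in oc jc) (ord_in oc (Hc _ Hy)).
    - by case: nH; exists y.
    - exact: succ_self.
    - exact: succ_sub.
  have /card_lt_not[] := cc.2 _ (sc _ jc).
  by apply: card_le_trans (card_eq_ler Heq) _; exact: subset_card_le.
move=> j j' jc j'c; have [jj|jj|jj] := ord_total (ord_in oc jc) (ord_in oc j'c).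
- have [y Hy j'y] := one _ j'c; exists y; split=> //.
  exact: ord_trans (ord_in oc (Hc _ Hy)) jj j'y.
- by have [y Hy jy] := one _ jc; exists y; split; rewrite -?jj.
- have [y Hy jy] := one _ jc; exists y; split=> //.
  exact: ord_trans (ord_in oc (Hc _ Hy)) jj jy.
Qed.

(** If [g] is unbounded, let [r j] be an argument with value at least [j], and colour a pair by
    whether [r] agrees on it. If [r] is constant on [H], a single value of [g] exceeds every element
    of [H]; if [r] is injective on [H], it embeds [c] into [a]. *)
Lemma weakly_compact_bounded_maps : bounded_maps c.
Proof.
move=> a g ac gc; apply: contrapT => nb.
have H0 j : exists x, j ∈ c -> x ∈ a /\ ~ g x ∈ j.
  have [jc|nj] := pselect (j ∈ c); last by exists j.
  apply: contrapT => nx; apply: nb; exists j => // x xa; apply: contrapT => xj.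
  by apply: nx; exists x.
have [r rP] := choice_ex H0.
have [_ _ /(_ (fun x y => `[< r x = r y >]))[H [[] [Hc Heq Hh]]]] := cw.
- have [x0 x0c] := infinite_setN0 weakly_compact_infinite.
  have [h [Hh0 _ _]] := unbounded Hc Heq x0c x0c.
  have hc := Hc _ Hh0; have [rha _] := rP _ hc.
  have [y [Hy hy gy]] := unbounded Hc Heq hc (gc _ rha).
  have /asboolP rr := Hh _ _ Hh0 Hy hy.
  by have [_ []] := rP _ (Hc _ Hy); rewrite -rr.
- have /card_lt_not[] := cc.2 _ ac.
  apply: card_le_trans (card_eq_ler Heq) _.
  apply: (@card_le_inj _ _ _ _ r) => [x /Hc/rP[]//|x y Hx Hy rxy].
  have [xy|//|yx] := ord_total (ord_in oc (Hc _ Hx)) (ord_in oc (Hc _ Hy)).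
    by have /negP[] := negbT (Hh _ _ Hx Hy xy); apply/asboolP.
  by have /negP[] := negbT (Hh _ _ Hy Hx yx); apply/asboolP.
Qed.

(* Order the points [x < c] lexicographically by their traces
   [{a | A a x}]: along a homogeneous set the traces are monotone, so each
   coordinate is eventually constant. *)
Lemma weakly_compact_stable (A : ZF -> set ZF) : exists H : set ZF,
  [/\ H `<=` c, H #= c & forall a, a ∈ c -> exists2 j, j ∈ c &
    forall x y, H x -> H y -> ~ x ∈ j -> ~ y ∈ j -> A a x <-> A a y].
Proof.
pose lex x y := exists a, [/\ a ∈ c, ~ A a x, A a y & forall b, b ∈ a -> A b x <-> A b y].
have [_ _ /(_ (fun x y => `[< lex x y >]))[H [e [Hc Heq Hh]]]] := cw.
exists H; split=> //.
have [_ _ sc] := infinite_cardinal_limit cc weakly_compact_infinite.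
(* By induction and regularity one [j] works for all coordinates below [a]: past it the traces agree
   there, so the lexicographic order is decided at [a] or later. *)
elim/(well_founded_ind mem_wf) => a IH ac.
have IH' b : exists j, b ∈ a -> j ∈ c /\
    forall x y, H x -> H y -> ~ x ∈ j -> ~ y ∈ j -> A b x <-> A b y.
  have [ba|nb] := pselect (b ∈ a); last by exists b.
  by have [j jc jP] := IH _ ba (ord_trans oc ba ac); exists j.
have [g gP] := choice_ex IH'.
have [j jc jP] := weakly_compact_bounded_maps ac (fun b ba => (gP b ba).1).
have agree x y : H x -> H y -> ~ x ∈ j -> ~ y ∈ j -> forall b, b ∈ a -> A b x <-> A b y.
  move=> Hx Hy xj yj b ba; apply: (gP b ba).2 => // h; [apply: xj|apply: yj];
    by apply: ord_trans h (jP _ ba); exact: ord_in jc.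
have mono x y : H x -> H y -> x ∈ y -> ~ x ∈ j -> ~ y ∈ j ->
    if e then A a x -> A a y else A a y -> A a x.
  move=> Hx Hy xy xj yj; have := Hh _ _ Hx Hy xy; have ag := agree _ _ Hx Hy xj yj.
  case: (e) => [/asboolP[b [bc Abx Aby bP]] Aax|/asboolP nl Aay]; last first.
    by apply: contrapT => nAx; apply: nl; exists a.
  have [ba|ba|ab] := ord_total (ord_in oc bc) (ord_in oc ac).
  - by case: Abx; exact/(ag _ ba).
  - by rewrite ba in Abx.
  - exact/(bP _ ab).
(* [p] is the truth value that monotonicity does not allow to be left once it is reached. If it is
   never reached past [j], the coordinate is constant there anyway. *)
have key (p : Prop) : (exists x, [/\ H x, ~ x ∈ j & (A a x <-> p)]) ->
    (forall x y, H x -> H y -> x ∈ y -> ~ x ∈ j -> ~ y ∈ j -> (A a x <-> p) -> (A a y <-> p)) ->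
    exists2 j', j' ∈ c & forall x y, H x -> H y -> ~ x ∈ j' -> ~ y ∈ j' -> A a x <-> A a y.
  move=> [x0 [Hx0 x0j Ax0]] up; exists x0; first exact: Hc.
  suff U y : H y -> ~ y ∈ x0 -> A a y <-> p by move=> x y Hx Hy /(U _ Hx) -> /(U _ Hy) ->.
  move=> Hy yx; have [xy|<-//|//] := ord_total (ord_in oc (Hc _ Hx0)) (ord_in oc (Hc _ Hy)).
  apply: (up x0 y Hx0 Hy xy x0j _ Ax0) => yj; apply: x0j.
  exact: ord_trans (ord_in oc jc) xy yj.
case: e mono Hh => mono Hh.
- have [[x [Hx xj Ax]]|nx] := pselect (exists x, [/\ H x, ~ x ∈ j & A a x]).
    apply: (key True); first by exists x.
    move=> y z Hy Hz yz yj zj Ay; split=> // _.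
    exact: (mono y z Hy Hz yz yj zj (Ay.2 Logic.I)).
  exists j => // x y Hx Hy xj yj; split=> Aa; case: nx; [by exists x|by exists y].
- have [[x [Hx xj Ax]]|nx] := pselect (exists x, [/\ H x, ~ x ∈ j & ~ A a x]).
    apply: (key False); first by exists x; split=> //; split.
    move=> y z Hy Hz yz yj zj Ay; split=> // Az.
    exact: (Ay.1 (mono y z Hy Hz yz yj zj Az)).
  exists j => // x y Hx Hy xj yj.
  by split=> _; apply: contrapT => nA; apply: nx; [exists y|exists x].
Qed.

Lemma weakly_compact_limit_filters l : l ∈ c -> limit_filters l c (tails c).
Proof.
move=> lc F.
have [H [Hc Heq HP]] := weakly_compact_stable (fun a => [set x | exists2 i, val i = x & F a i]).
have [_ _ sc] := infinite_cardinal_limit cc weakly_compact_infinite.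
have beyond j : j ∈ c -> exists i : set_type c, H (val i) /\ ~ val i ∈ j.
  move=> jc; have [y [Hy jy _]] := unbounded Hc Heq jc jc.
  exists (SigSub (mem_set (Hc _ Hy))); split=> //=; exact: mem_asym.
exists [set S | exists2 j, j ∈ c & forall i : set_type c, H (val i) -> ~ val i ∈ j -> S i]; split.
- split.
  + by have [x xc] := infinite_setN0 weakly_compact_infinite; exists x.
  + by move=> [j /beyond[i [Hi ij]] /(_ i Hi ij)].
  + by move=> S S' SS' [j jc jS]; exists j => // i Hi ij; exact/SS'/jS.
  + move=> G GD.
    have GD' x : exists j, x ∈ l -> j ∈ c /\ forall i : set_type c, H (val i) ->
      ~ val i ∈ j -> G x i.
      have [xl|nx] := pselect (x ∈ l); last by exists x.
      by have [j jc jP] := GD _ xl; exists j.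
    have [g gP] := choice_ex GD'.
    have [j jc jP] := weakly_compact_bounded_maps lc (fun b ba => (gP b ba).1).
    exists j => // i Hi ij x xl; apply: (gP x xl).2 => // h; apply: ij.
    by apply: ord_trans h (jP _ xl); exact: ord_in jc.
- by move=> S [j jc jS]; exists j => // i _ /jS.
- move=> a ac; have [j jc jP] := HP a ac; have [i0 [Hi0 i0j]] := beyond j jc.
  have key i : H (val i) -> ~ val i ∈ j -> F a i <-> F a i0.
    move=> Hi ij; have [h1 h2] := jP _ _ Hi Hi0 ij i0j.
    split=> h; [have [|i' /val_inj <-//] := h1|have [|i' /val_inj <-//] := h2].
      by exists i.
    by exists i0.
  have [Fi|nF] := pselect (F a i0); [left|right]; exists j => // i Hi ij; [exact/(key i)|].
  by move/(key i Hi ij).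
Qed.

(** Given [c] many distinct subsets [g x] of [a], membership of each point of [a] is eventually
    constant along a set [H] of size [c], and by regularity from a common point on. Two later
    members of [H] then have the same subset. *)
Lemma weakly_compact_strong_limit : strong_limit c.
Proof.
split=> // [|a ac]; first exact: weakly_compact_infinite.
apply/card_lt_not => /(card_le_ex set0)[g ga gi].
have [H [Hc Heq HP]] := weakly_compact_stable (fun b => [set x | b ∈ a /\ g x b]).
have HP' b : exists j, b ∈ a -> j ∈ c /\ forall x y, H x -> H y -> ~ x ∈ j -> ~ y ∈ j ->
  g x b <-> g y b.
  have [ba|nb] := pselect (b ∈ a); last by exists b.
  have [j jc jP] := HP b (ord_trans oc ba ac); exists j => _; split=> // x y Hx Hy xj yj.
  by have [h1 h2] := jP x y Hx Hy xj yj; split=> h; [have [] := h1|have [] := h2].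
have [r rP] := choice_ex HP'.
have [j jc jP] := weakly_compact_bounded_maps ac (fun b ba => (rP b ba).1).
have [x [Hx jx _]] := unbounded Hc Heq jc jc.
have [y [Hy jy xy]] := unbounded Hc Heq jc (Hc _ Hx).
have xc := Hc _ Hx; have yc := Hc _ Hy.
suff xyE : x = y by rewrite xyE in xy; exact: mem_irr xy.
apply: gi => //; apply/seteqP.
have nj b z : b ∈ a -> j ∈ z -> ~ z ∈ r b.
  move=> ba jz zr; apply: (mem_asym jz); apply: ord_trans zr (jP _ ba).
  exact: ord_in jc.
split=> b gb.
  have ba := ga _ xc _ gb; exact/((rP b ba).2 x y Hx Hy (nj _ _ ba jx) (nj _ _ ba jy)).
have ba := ga _ yc _ gb; exact/((rP b ba).2 x y Hx Hy (nj _ _ ba jx) (nj _ _ ba jy)).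
Qed.

End WeaklyCompact.

(** * Dense amalgamation bases *)

Lemma ord_double a : ordinal a -> ordinal (double a).
Proof.
elim/(well_founded_ind mem_wf): a => a IH oa.
have os b : b ∈ a -> ordinal (succ (succ (double b))).
  by move=> ba; apply/ord_succ/ord_succ/IH => //; exact: ord_in ba.
split=> [z /in_double[b [ba zb]] w wz|z /in_double[b [ba zb]]].
  by apply/in_double; exists b; split=> //; apply: ord_trans wz zb; exact: os.
by have [] := ord_in (os _ ba) zb.
Qed.

Lemma sub_double a : ordinal a -> a `<=` double a.
Proof.
elim/(well_founded_ind mem_wf): a => a IH oa b ba.
have ob := ord_in oa ba; apply/in_double; exists b; split=> //; apply: succ_sub.
by apply/in_succ; exact: ord_sub (ord_double ob) (IH _ ba ob).
Qed.

Lemma double_in c a : limit c -> bounded_maps c -> a ∈ c -> double a ∈ c.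
Proof.
move=> [oc _ sc] bc; elim/(well_founded_ind mem_wf): a => a IH ac.
have [|j jc jP] := bc a (fun b => succ (succ (double b))) ac.
  by move=> b ba; apply/sc/sc/IH => //; exact: ord_trans ac.
have dj : double a `<=` j.
  by move=> z /in_double[b [ba zb]]; apply: ord_trans zb (jP _ ba); exact: ord_in jc.
have [|dj'|->//] := ord_sub (ord_double (ord_in oc ac)) _ dj; first exact: ord_in jc.
exact: ord_trans dj' jc.
Qed.

(** The least ordinal that does not inject into [l] is a cardinal above [l], so [a] lies below
    it. *)
Lemma lt_succ_card_le (a l : ZF) : ordinal a -> lt_succ_card a l -> ordinal l -> a #<= l.
Proof.
move=> oa al ol; apply: contrapT => nal.
have [b [ob nlb bmin]] := ord_least (P := fun b => ~ (b #<= l)) oa nal.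
have cb : cardinal b.
  split=> // e eb; apply/card_lt_not => be; apply: (bmin e eb) => el.
  by apply: nlb; exact: card_le_trans be el.
have lb : l ∈ b.
  apply: contrapT => /(ord_nin_sub ol ob) bl; apply: nlb; exact: subset_card_le.
exact: (bmin a (al b cb lb)).
Qed.

Lemma card_eq_lt_succ (a l : ZF) : ordinal a -> a #<= l -> lt_succ_card a l.
Proof.
move=> oa al m cm lm; apply: cardinal_in => //.
exact: card_le_lt al (cardinal_lt cm lm).
Qed.

(** * From dense amalgamation bases to a majority *)

Section Dense.
Variables (tau : vocabulary) (k : aec tau) (lst : ZF).
Hypothesis hlst : LST_number k lst.
Implicit Types M N : structure tau.

Lemma lst_infinite : infinite_set lst.
Proof.
case: hlst => -[_ h _] _; apply/infiniteP; apply: card_le_trans h.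
exact: dsum_ler.
Qed.

Lemma lst_vocabulary : [set: fsym tau] ⊎ [set: rsym tau] #<= lst.
Proof. by case: hlst => -[_ h _] _; apply: card_le_trans h; exact: dsum_lel. Qed.

Lemma lst_LS N (A : set ZF) : K k N -> A `<=` N ->
  exists M, [/\ le k M N, A `<=` M & M #<= lst ⊎ A].
Proof. by case: hlst => -[_ _ h] _; exact: h. Qed.

(** Density provides bases with arbitrary universes, whereas the values of the function [F] must
    have ordinals as universes. *)
Lemma amalgamation_base_iso chi1 chi2 f M N :
  amalgamation_base k chi1 chi2 M -> isomorphism f M N -> amalgamation_base k chi1 chi2 N.
Proof.
move=> [KM M1 M2 Ma] fMN; have eMN := iso_card fMN.
have KN := K_iso KM fMN; have [g [gNM gf fg]] := iso_inv fMN.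
have NM := card_eq_ler eMN; split=> //.
- exact: card_le_trans NM M1.
- exact: card_le_trans NM M2.
move=> N1 N2 NN1 [K1 c1] NN2 [K2 c2].
have ext N' : le k N N' ->
  exists M' h, [/\ isomorphism h N' M', le k M M' & forall y, y ∈ N -> h y = g y].
  move=> NN'; have [M' [h [hN' MM' hf]]] := extend_embedding (ex_intro2 _ _ N fMN NN').
  by exists M', h; split=> // y yN; rewrite -{1}(fg _ yN) hf//; exact: (embedding_mem gNM.1).
have [M1' [h1 [h1N MM1 h1g]]] := ext _ NN1; have [M2' [h2 [h2N MM2 h2g]]] := ext _ NN2.
have [||M3 [MM3 [e1 e1P e1M] [e2 e2P e2M]]] := Ma M1' M2' MM1 _ MM2.
- split; first exact: le_Kr MM1.
  by rewrite card_eq_sym in c1; rewrite card_eq_sym; apply: card_eq_trans c1 (iso_card h1N).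
- split; first exact: le_Kr MM2.
  by rewrite card_eq_sym in c2; rewrite card_eq_sym; apply: card_eq_trans c2 (iso_card h2N).
have [N3 [w [wN3 NN3 wg]]] := extend_embedding (ex_intro2 _ _ M gNM MM3).
exists N3; split=> //.
- exists (fun x => w (e1 (h1 x))); last first.
    by move=> x xN; rewrite h1g// e1M ?wg//; exact: (embedding_mem gNM.1).
  apply: (le_embedding_iso (f := fun x => e1 (h1 x))) wN3.
  by apply: (le_embedding_comp (N := M1')) e1P; exists M1' => //; apply: le_refl; exact: le_Kr MM1.
- exists (fun x => w (e2 (h2 x))); last first.
    by move=> x xN; rewrite h2g// e2M ?wg//; exact: (embedding_mem gNM.1).
  apply: (le_embedding_iso (f := fun x => e2 (h2 x))) wN3.
  by apply: (le_embedding_comp (N := M2')) e2P; exists M2' => //; apply: le_refl; exact: le_Kr MM2.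
Qed.

Lemma majority_dom_card c M : ordinal c -> majority_dom k c M -> K_card k c M.
Proof.
move=> oc [KM oM cM Mc]; split=> //; apply: card_eq_le2; first exact: lt_succ_card_le.
exact: subset_card_le.
Qed.

Lemma ordinal_extension c M N : majority_dom k c M -> le k M N -> K_card k c N ->
  exists f N', [/\ isomorphism f N N', le k M N' & majority_dom k c N'].
Proof.
move=> [KM oM cM Mc] MN [KN Nc].
have [a [f [oa fa fi fs fM]]] := ordinal_numbering oM (le_subset MN).
have [N' fN MN'] := relabel MN fi fM.
have N'a : univ N' = a.
  apply: ZF_ext => y; have := iso_image fN => /(congr1 (fun S => S y)) /= ->.
  by split=> [[x xN <-]|/fs[x xN <-]]; [exact: fa|exists x].
exists f, N'; split=> //; split; [exact: le_Kr MN'|by rewrite N'a| |].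
  by move=> x /cM; exact: (le_subset MN').
apply: card_eq_lt_succ; first by rewrite N'a.
by apply: card_le_trans (card_eq_lel Nc); apply: card_eq_ler; exact: iso_card fN.
Qed.

(** [F] extends a model to a base. A measurable [theta] has the required filters for every [nu], so
    [chi1] and [chi2] may lie far above [c]. *)
Lemma dense_amalgamation_bases c theta chi1 chi2 :
  cardinal c -> cardinal chi1 -> cardinal chi2 ->
  lst ∈ theta -> theta ∈ c -> measurable_cardinal theta ->
  (forall M, K_card k c M ->
     exists N, [/\ K_card k c N, amalgamation_base k chi1 chi2 N & le k M N]) ->
  has_amalgamation_bases2 k chi1 chi2 c theta.
Proof.
move=> cc cchi1 cchi2 lt tc mt dense; have [oc _] := cc.
have ct := measurable_cardinal_cardinal mt; have it := measurable_infinite mt.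
have bt := measurable_bounded_maps mt.
have lim := infinite_cardinal_limit ct it.
split; first exact: bounded_maps_regular.
have ic : infinite_set c.
  by apply: infinite_le it _; apply: subset_card_le; exact: ord_in_sub.
have HF M : exists N, majority_dom k c M ->
    [/\ le k M N, majority_dom k c N & amalgamation_base k chi1 chi2 N].
  have [dM|nM] := pselect (majority_dom k c M); last by exists M.
  have [N [cN aN MN]] := dense M (majority_dom_card oc dM).
  have [f [N' [fN MN' dN']]] := ordinal_extension dM MN cN.
  by exists N' => _; split=> //; exact: amalgamation_base_iso fN.
have [F FP] := choice_ex HF; exists F; split=> [M /FP[]//|M [Mle Mcont] Mdom MF].
(* The stages produced by [F]. They are cofinal in [theta], since [double a] includes [a] and stays
   below [theta] by regularity. *)
pose s a := succ (succ (double a)).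
have [ot _ st] := lim.
have sd a : a ∈ theta -> succ (double a) ∈ theta by move=> at_; exact/st/double_in.
have st' a : a ∈ theta -> s a ∈ theta by move=> at_; exact/st/sd.
have Ms a : a ∈ theta -> amalgamation_base k chi1 chi2 (M (s a)).
  move=> at_; rewrite /s MF//; have [|] := FP (M (succ (double a))) _ => //.
  exact/Mdom/succ_sub/sd.
have Mt a : a ∈ theta -> le k (M a) (M theta) by move=> at_; apply: Mle => //; exact: succ_self.
have [Mu _] := Mcont _ (succ_self theta) lim.
have e0 := limit_empty lim.
have [KMt Mtc] := majority_dom_card oc (Mdom _ (succ_self theta)).
have [Ks0 s1 s2 _] := Ms _ e0.
have [_ Ms0] := majority_dom_card oc (Mdom _ (succ_sub (st' _ e0))).
have cchi1' : c #<= chi1 by apply: card_le_trans s1; exact: card_eq_ler.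
have cchi2' : c #<= chi2 by apply: card_le_trans s2; exact: card_eq_ler.
split=> //; [exact: card_le_trans (card_eq_lel Mtc) _|exact: card_le_trans (card_eq_lel Mtc) _|].
move=> N1 N2 MN1 [KN1 N1c] MN2 [KN2 N2c].
pose N e := if e then N1 else N2.
have MN e : le k (M theta) (N e) by case: e.
(* The larger of [chi1] and [chi2] bounds both models. *)
have [nu [onu cnu Nnu]] : exists nu, [/\ ordinal nu, c #<= nu & forall e, N e #<= nu].
  have [h|h|h] := ord_total cchi1.1 cchi2.1.
  - exists chi2; split=> //; [exact: cchi2.1|]; case=> /=; last exact: card_eq_lel.
    apply: card_le_trans (card_eq_lel N1c) _; apply: subset_card_le.
    by apply: ord_in_sub h; exact: cchi2.1.
  - exists chi2; split=> //; [exact: cchi2.1|]; case=> /=; last exact: card_eq_lel.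
    by rewrite -h; exact: card_eq_lel.
  - exists chi1; split=> //; [exact: cchi1.1|]; case=> /=; first exact: card_eq_lel.
    apply: card_le_trans (card_eq_lel N2c) _; apply: subset_card_le.
    by apply: ord_in_sub h; exact: cchi1.1.
have lnu : lst #<= nu.
  apply: card_le_trans cnu; apply: subset_card_le; apply: (ord_in_sub oc).
  exact: ord_trans oc lt tc.
have am (i : set_type theta) : exists Pf : structure tau * (bool -> ZF -> ZF),
    le k (M (s (val i))) Pf.1 /\ forall e, le_embedding k (Pf.2 e) (N e) Pf.1 /\
      forall x, x ∈ M (s (val i)) -> Pf.2 e x = x.
  have it' : val i ∈ theta by exact: set_valP.
  have [_ _ _ A] := Ms _ it'.
  have le_i e : le k (M (s (val i))) (N e) by apply: le_trans (MN e); exact/Mt/st'.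
  have [M3 [MM3 [f1 f1P f1M] [f2 f2P f2M]]] :=
    A N1 N2 (le_i true) (conj KN1 N1c) (le_i false) (conj KN2 N2c).
  by exists (M3, fun e => if e then f1 else f2); split=> // -[].
have [Pf PfP] := choice_ex am.
have [x0 x0M] : exists x, x ∈ M theta.
  have [x xc] := infinite_setN0 ic; exists x.
  by have [_ _ cM _] := Mdom _ (succ_self theta); exact: cM.
have tailT (S : set (set_type theta)) : S = setT -> tails theta S.
  by move=> ->; exists empty.
(* Both models are embedded as a whole at each index. Only the agreement of the two embeddings on
   [M theta] is partial, and it improves with the index. *)
have [|||||M3 [MM3 M3P]] := amalgamation_limit lst_infinite lst_vocabulary lst_LS onu lnu
   (measurable_limit_filters mt nu lt) x0M MN Nnu
   (P := fun i => (Pf i).1) (d := fun e _ => N e) (f := fun e i => (Pf i).2 e).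
- move=> i; have [/le_subset MP _] := PfP i.
  have [x xc] := infinite_setN0 ic; exists x; apply: MP.
  have [_ _ cM _] := Mdom _ (succ_sub (st' _ (set_valP i))); exact: cM.
- by move=> e i; apply: le_refl; exact: le_Kr (MN e).
- by move=> e i; have [_ /(_ e)[]] := PfP i.
- by move=> e x xN; apply: tailT; apply/seteqP; split.
- move=> x; rewrite Mu => -[j jt xj]; exists j => // i ij.
  have xs : x ∈ M (s (val i)).
    apply: (le_subset (Mle j (s (val i)) _ _)) xj.
      exact/succ_sub/st'/set_valP.
    have oi : ordinal (val i) by apply: ord_in ot _; exact: set_valP.
    have ji : j ∈ succ (val i).
      have [h|h|h] := ord_total (ord_in ot jt) oi; [exact: succ_sub|rewrite h;
        exact: succ_self|by []].
    apply: (ord_in_sub (b := s (val i))) ji; first exact/ord_succ/ord_succ/ord_double.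
    apply: ord_succ_mono; first exact/ord_succ/ord_double.
    by apply/in_succ; apply: ord_sub => //; [exact: ord_double|exact: sub_double].
  by have [_ h] := PfP i; rewrite /mkset (h true).2// (h false).2.
- by exists M3; split=> //; [exact: (M3P true)|exact: (M3P false)].
Qed.

End Dense.

(** The history is passed as a total function with the value [x0] beyond the current stage, which
    spares the steps any membership proofs. *)
Lemma transfinite_recursion A (F : ZF -> (ZF -> A) -> A) (x0 : A) :
  exists N : ZF -> A, forall a, N a = F a (fun b => if pselect (b ∈ a) then N b else x0).
Proof.
pose G a (rec : forall b, b ∈ a -> A) : A :=
  F a (fun b => if pselect (b ∈ a) is left ba then rec b ba else x0).
exists (Fix mem_wf (fun=> A) G) => a; rewrite Fix_eq => [|x f g fg].
  by congr (F a _); apply/funext => b; case: pselect.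
by congr (F x _); apply/funext => b; case: pselect.
Qed.

(** * Continuous chains of models of a fixed cardinality *)

Section Chains.
Variables (tau : vocabulary) (k : aec tau) (c : ZF).
Hypothesis ic : infinite_set c.
Implicit Types M N : structure tau.

Lemma K_card_union d (N : ZF -> structure tau) U : limit d -> d #<= c ->
  inc_continuous (le k) d N -> is_union d N U -> (forall i, i ∈ d -> K_card k c (N i)) ->
  K_card k c U.
Proof.
move=> ld dc Ninc NU KN; have e0 := limit_empty ld.
have leU := le_union ld Ninc NU.
split; first exact: le_Kr (leU _ e0).
apply: card_eq_le2.
  have UE : U `<=` \bigcup_(i in d) N i by move=> x; rewrite /= NU.1 => -[i id xi]; exists i.
  apply: card_le_trans (subset_card_le UE) _; apply: card_bigcup => // i id.
  by have [_ /card_eq_lel] := KN i id.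
have [_ /card_eq_ler] := KN _ e0; move/card_le_trans; apply.
by apply: subset_card_le; apply: le_subset; exact: leU.
Qed.

Variables (d : ZF) (step : ZF -> (ZF -> structure tau) -> structure tau) (M : structure tau).
Hypotheses (ld : limit d) (dc : d #<= c) (KM : K_card k c M).
Hypothesis stepP : forall i h, i ∈ d -> (forall j, j ∈ succ i -> K_card k c (h j)) ->
  (forall j, j ∈ i -> le k (h j) (h i)) -> le k (h i) (step i h) /\ K_card k c (step i h).

(** The recursion shows [step] a history cut off after [i]. It is therefore described by some [h]
    that agrees with the chain up to [i], and [stepP] is required for all such histories. *)
Lemma chain_exists : exists N : ZF -> structure tau,
  [/\ N empty = M, forall i j, j ∈ succ d -> i ∈ j -> le k (N i) (N j),
    forall i, i ∈ succ d -> K_card k c (N i),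
    forall j, j ∈ succ d -> limit j -> is_union j N (N j) &
    forall i, i ∈ d -> exists2 h, (forall j, j ∈ succ i -> h j = N j) & N (succ i) = step i h].
Proof.
(* The last case serves the stage [empty]; at limits the union is shown to exist, so the default
   does not occur. *)
pose F a (h : ZF -> structure tau) : structure tau :=
  if pselect (exists i, a = succ i) is left e then step (projT1 (cid e)) h
  else if pselect (limit a /\ exists U, is_union a h U) is left e then projT1 (cid e.2) else M.
have [N NE] := transfinite_recursion F M.
have N0 : N empty = M.
  rewrite NE /F; case: pselect => [e|_]; last by case: pselect => // e; case: (limit_not_empty e.1).
  exfalso; case: e => i ei; apply: (@in_empty i); rewrite ei; exact: succ_self.
have Nsucc i : exists2 h, (forall j, j ∈ succ i -> h j = N j) & N (succ i) = step i h.
  eexists; last first.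
    rewrite NE /F; case: pselect => [e|[]]; last by exists i.
    by rewrite -(succ_inj (projT2 (cid e))).
  by move=> j ji /=; case: pselect.
have Nlim j : limit j -> (exists U, is_union j N U) -> is_union j N (N j).
  move=> lj [U NU]; pose H b := if pselect (b ∈ j) then N b else M.
  have HE b : b ∈ j -> H b = N b by rewrite /H; case: pselect.
  have agree V : is_union j H V <-> is_union j N V.
    split=> -[V1 V2]; split=> [x|i ij].
    - by rewrite V1; split=> -[i ij xi]; exists i => //; rewrite ?HE// -?HE.
    - by rewrite -HE//; exact: V2.
    - by rewrite V1; split=> -[i ij xi]; exists i => //; rewrite ?HE// -?HE.
    - by rewrite HE//; exact: V2.
  rewrite [N j]NE /F; case: pselect => [e|_].
    by exfalso; case: e => i ji; rewrite ji in lj; exact: limit_not_succ lj.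
  case: pselect => [e|[]]; last by split=> //; exists U; apply/agree.
  exact/agree/(projT2 (cid e.2)).
have [od _ sd] := ld.
have main j : j ∈ succ d -> [/\ K_card k c (N j), forall i, i ∈ j -> le k (N i) (N j) &
    limit j -> is_union j N (N j)].
  elim/(well_founded_ind mem_wf): j => j IH jd.
  have oj : ordinal j by apply: ord_in jd; exact: ord_succ.
  have IH' i : i ∈ j -> [/\ K_card k c (N i), forall i', i' ∈ i -> le k (N i') (N i) &
      limit i -> is_union i N (N i)].
    by move=> ij; apply: IH => //; apply: ord_trans ij jd; exact: ord_succ.
  have [jE|[i oi jE]|lj] := ord_cases oj.
  - rewrite jE N0; split=> // [i /in_empty//|/limit_not_empty//].
  - have ij : i ∈ j by rewrite jE; exact: succ_self.
    have id_ : i ∈ d.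
      move: jd => /in_succ[jd|jd]; last by rewrite -jd.
      exact: ord_trans ij jd.
    have [h hN NsE] := Nsucc i.
    have [h1 h2] : le k (h i) (step i h) /\ K_card k c (step i h).
      apply: stepP => // [i' i'i|i' i'i].
        by rewrite hN//; have [] := IH' i' _ => //; rewrite jE.
      rewrite !hN; [|exact: succ_self|exact: succ_sub].
      by have [_ /(_ _ i'i)] := IH' _ ij.
    rewrite jE NsE; split=> // [i' /in_succ[i'i|->]|/limit_not_succ//].
      apply: le_trans h1; rewrite hN; last exact: succ_self.
      by have [_ /(_ _ i'i)] := IH' _ ij.
    by rewrite -hN//; exact: succ_self.
  - have inc : inc_continuous (le k) j N.
      split=> [i i' i'j ii'|i ij li]; first by have [_ /(_ _ ii')] := IH' _ i'j.
      by have [_ _ /(_ li)] := IH' _ ij.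
    have [_ [x xj] sj] := lj.
    have NU : is_union j N (N j).
      apply: Nlim => //; apply: chain_union => //; first by exists x.
      by move=> i i' i'j ii'; apply: le_substructure; exact: inc.1.
    split=> // [|i ij]; last exact: le_union lj inc NU _ ij.
    apply: K_card_union lj _ inc NU _ => [|i /IH'[]//].
    apply: card_le_trans dc; apply: subset_card_le.
    by move: jd => /in_succ[/(ord_in_sub od)|->].
exists N; split=> // [i j /main[_ H _]|i /main[]|j /main[_ _]]; by [exact: H|].
Qed.

End Chains.

(** * Density of amalgamation bases at a strong limit cardinal *)

Section Density.
Variables (tau : vocabulary) (k : aec tau) (lst : ZF).
Hypothesis hlst : LST_number k lst.
Variables (c kap : ZF).
Hypotheses (csl : strong_limit c) (kapcof : cofinality c kap).
Hypotheses (kapl : limit kap) (lkap : lst ∈ kap) (kapc : kap `<=` c).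
Hypothesis kapF : limit_filters lst c (tails kap).
Implicit Types M N : structure tau.

Let cc : cardinal c. Proof. by case: csl. Qed.
Let ic : infinite_set c. Proof. by case: csl. Qed.
Let oc : ordinal c := cc.1.
Let cl : limit c := infinite_cardinal_limit cc ic.
Let linf := lst_infinite hlst.

Let lc : lst ∈ c. Proof. exact: kapc. Qed.

Let small_bound T U (X : set T) (Y : set U) : X #< c -> Y #< c ->
  exists m, [/\ m ∈ c, infinite_set m, lst #<= m, X #<= m & Y #<= m].
Proof.
move=> /(card_lt_bound oc)[a ac Xa] /(card_lt_bound oc)[b bc Yb].
have [m [mc am bm lm]] : exists m, [/\ m ∈ c, a `<=` m, b `<=` m & lst `<=` m].
  have j x y : x ∈ c -> y ∈ c -> exists z, [/\ z ∈ c, x `<=` z & y `<=` z].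
    move=> xc yc; have [h|h|h] := ord_total (ord_in oc xc) (ord_in oc yc).
    - by exists y; split=> //; apply: (ord_in_sub _ h); exact: ord_in yc.
    - by exists y; split=> //; rewrite h.
    - by exists x; split=> //; apply: (ord_in_sub _ h); exact: ord_in xc.
  have [z [zc az bz]] := j a b ac bc; have [m [mc zm lm]] := j z lst zc lc.
  by exists m; split=> // x; [move/az/zm|move/bz/zm].
exists m; split=> //.
- by apply: infinite_le linf _; exact: subset_card_le.
- exact: subset_card_le.
- by apply: card_le_trans Xa _; exact: subset_card_le.
- by apply: card_le_trans Yb _; exact: subset_card_le.
Qed.

Let small m : m ∈ c -> m #< c. Proof. by case: cc => _; exact. Qed.

Let powerset_le T a : a ∈ c -> [set: T] #<= a -> [set: set T] #<= c.
Proof.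
move=> ac Ta; have [_ _ sl] := csl.
have [b bc Pb] := card_lt_bound oc (sl a ac).
apply: card_le_trans (_ : _ #<= b) _; last by apply: subset_card_le; exact: ord_in_sub.
apply: card_le_trans Pb; have [g ga gi] := card_le_ex empty Ta.
apply: (@card_le_inj _ _ _ _ (fun S : set T => g @` S)) => [S _ _ [t _ <-]|S S' _ _ SS];
  first exact: ga.
apply/seteqP; split=> t St.
  have : (g @` S) (g t) by exists t.
  by rewrite SS => -[u Su /gi <-].
have : (g @` S') (g t) by exists t.
by rewrite -SS => -[u Su /gi <-].
Qed.

(** By [structure_ext] a structure inside [W] is determined by the facts over [W] that it satisfies.
    There are at most [2^m] sets of such facts, and [c] is a strong limit. *)
Let structures_on (W : ZF) m : m ∈ c -> infinite_set m -> lst #<= m -> W #<= m ->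
  [set N : structure tau | N `<=` W] #<= c.
Proof.
move=> mc im lm Wm.
have tm : [set: fsym tau] ⊎ [set: rsym tau] #<= m.
  by apply: card_le_trans lm; exact: lst_vocabulary hlst.
have Wm' : [set: set_type W] #<= m by apply: card_le_trans Wm; apply: card_eq_lel; exact: card_setT.
apply: card_le_trans (powerset_le mc (card_fact im tm Wm')).
apply: (@card_le_inj _ _ _ _ (fun N => [set p :
  fact tau (set_type W) | holds N val p])) => // N N' NW N'W NN.
have H (A B : structure tau) : A `<=` W ->
    [set p : fact tau (set_type W) | holds A val p] = [set p | holds B val p] ->
    forall p, holds A id p -> holds B id p.
  move=> AW AB p pA; have [q' qE] := holds_mem pA; move: pA; rewrite {}qE.
  pose inc (x : set_type A) : set_type W := SigSub (mem_set (AW _ (valM x))).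
  have -> : fmap val q' = fmap val (fmap inc q') :> fact tau ZF by case: q'.
  rewrite !(holds_fmap val) => h.
  have : [set p : fact tau (set_type W) | holds A val p] (fmap inc q') by exact: h.
  by rewrite AB.
apply: structure_ext => p; split; first exact: H NW NN p.
exact: H N'W (esym NN) p.
Qed.

(** Up to isomorphism over [M0], a small extension lives on one of the standard sets [W a], each of
    which carries at most [c] structures. The list [t] runs through all these structures, whether
    they extend [M0] or not. *)
Let tasks M0 : K k M0 -> M0 #< c -> exists t : ZF -> structure tau,
  forall N0, le k M0 N0 -> N0 #< c -> exists xi h, [/\ xi ∈ c, isomorphism h N0 (t xi),
    le k M0 (t xi) & forall x, x ∈ M0 -> h x = x].
Proof.
move=> KM0 M0c.
pose W (a : ZF) := setof (M0 `|` fresh M0 @` a).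
have WE a y : y ∈ W a <-> y ∈ M0 \/ exists2 x, x ∈ a & fresh M0 x = y.
  apply: setofE; have [v vE] := is_set_image a (fresh M0).
  have [w wE] := is_set2 M0 v.
  apply: is_set_subset (is_set_bigcup w id) => z [zM|/vE zv].
    by exists (univ M0) => //; apply/wE; left.
  by exists v => //; apply/wE; right.
pose S := \bigcup_(a in c) [set N : structure tau | N `<=` W a].
have Sc : S #<= c.
  apply: card_bigcup => // a ac.
  have [m [mc im lm M0m am]] := small_bound M0c (small ac).
  apply: (structures_on mc im lm).
  have -> : (W a : set ZF) = M0 `|` fresh M0 @` a by apply/seteqP; split=> y /WE.
  by apply: card_setU => //; apply: card_le_trans (card_image_le _ _) am.
have [x0 x0c] := infinite_setN0 ic.
have [|t _ tS] := card_le_onto Sc.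
  by exists M0, x0 => // y yM; apply/WE; left.
exists t => N0 MN0 N0c; have [a ac N0a] := card_lt_bound oc N0c.
have [g ga gi] := card_le_ex empty N0a.
pose h x := if pselect (x ∈ M0) then x else fresh M0 (g x).
have hM x : x ∈ M0 -> h x = x by rewrite /h; case: pselect.
have hN x : ~ x ∈ M0 -> h x = fresh M0 (g x) by rewrite /h; case: pselect.
have [|N' hN' MN'] := relabel MN0 (g := h) _ hM.
  move=> x y xN yN; have [xM|xM] := pselect (x ∈ M0); have [yM|yM] := pselect (y ∈ M0).
  - by rewrite !hM.
  - by rewrite hM// hN// => E; case: (@fresh_nin M0 (g y)); rewrite -E.
  - by rewrite (hM y)// hN// => E; case: (@fresh_nin M0 (g x)); rewrite E.
  - by rewrite !hN// => /fresh_inj; exact: gi.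
have [|xi xic tE] := tS N'.
  exists a => // y; rewrite (iso_image hN') => -[x xN <-]; apply/WE.
  have [xM|xM] := pselect (x ∈ M0); first by left; rewrite hM.
  by right; exists (g x); [exact: ga|rewrite hN].
by exists xi, h; rewrite tE.
Qed.

(** The chain meets every task once and performs it if some extension of size [c] does. Whatever an
    extension [P] of the last model can do was possible when its turn came, and so it has been
    done. *)
Let saturated_step N M0 : K_card k c N -> le k M0 N -> M0 #< c -> exists N',
  [/\ le k N N', K_card k c N' & forall N0 P, le k M0 N0 -> N0 #< c ->
    K_card k c P -> le k N' P -> embeds_over k M0 N0 P -> embeds_over k M0 N0 N'].
Proof.
move=> KN MN M0c; have [t tP] := tasks (le_Kl MN) M0c.
pose good xi N P := [/\ K_card k c P, le k N P & embeds_over k M0 (t xi) P].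
pose step xi (h : ZF -> structure tau) :=
  if pselect (exists P, good xi (h xi) P) is left e then projT1 (cid e) else h xi.
have [|C [C0 Cle CK _ Cs]] := chain_exists ic (d := c) (step := step) cl (card_lexx c) KN.
  move=> i h ic' hK _; rewrite /step; case: pselect => [e|_]; last first.
    have Ki := hK i (succ_self i); split=> //; apply: le_refl; exact: Ki.1.
  by have [] := projT2 (cid e).
have [_ _ sc] := cl.
have Cc i : i ∈ c -> le k (C i) (C c) by move=> ?; apply: Cle => //; exact: succ_self.
exists (C c); split.
- by rewrite -C0; apply: Cc; exact: limit_empty.
- by apply: CK; exact: succ_self.
move=> N0 P MN0 N0c KP CP [f fP fM].
have [xi [h [xic hN0 Mt hM]]] := tP N0 MN0 N0c.
have [g [gt gh hg]] := iso_inv hN0.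
have tP' : embeds_over k M0 (t xi) P.
  exists (fun x => f (g x)) => [|x xM]; last first.
    by rewrite -{1}(hM _ xM) gh ?fM//; exact: (le_subset MN0).
  apply: (le_embedding_comp (N := N0)) fP; exists N0 => //; apply: le_refl; exact: le_Kr MN0.
have [w wC CE] := Cs xi xic.
(* [P] extends the model at stage [xi], so it was itself a candidate there and the step cannot have
   been idle. *)
have [e eP eM] : embeds_over k M0 (t xi) (C (succ xi)).
  rewrite CE /step; case: pselect => [e|[]]; last first.
    exists P; split=> //; rewrite wC; last exact: succ_self.
    exact: le_trans (Cc _ xic) CP.
  by have [] := projT2 (cid e).
exists (fun x => e (h x)) => [|x xM]; last by rewrite hM// eM.
apply: (le_embedding_trans (N := C (succ xi))); last exact/Cc/sc.
apply: (le_embedding_comp (N := t xi)) eP; exists (t xi) => //; apply: le_refl; exact: le_Kr Mt.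
Qed.

(** [lam i] collects what the cofinal map covers up to the index [i], so a point that has entered
    stays. It is not all of [c], because [succ i] is below the cofinality. *)
Let levels : exists lam : ZF -> ZF, [/\ forall i, i ∈ kap -> lam i ∈ c &
  forall x, x ∈ c -> exists2 i, i ∈ kap & forall i', i' ∈ kap -> ~ i' ∈ i -> x ∈ lam i'].
Proof.
have [okap [f [fc fcof]] kmin] := kapcof.
have [_ _ sk] := kapl.
pose Q i := [set x | x ∈ c /\ exists2 j, j ∈ succ i & x ∈ f j \/ x = f j].
have sQ i : is_set (Q i) by apply: (@is_set_sub c) => x [].
have QE i y : y ∈ setof (Q i) <-> Q i y by exact: setofE.
exists (fun i => setof (Q i)); split=> [i ik|x xc].
  have oQ : ordinal (setof (Q i)).
    apply: ord_of_set => // [x [xc _]|x y [xc [j ji xf]] yx]; first exact: ord_in xc.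
    have jk : j ∈ kap by apply: ord_trans ji (sk _ ik).
    split; first exact: ord_trans xc.
    exists j => //; left; case: xf => [xf|<-//]; apply: ord_trans yx xf.
    exact: ord_in (fc _ jk).
  have [y /QE[]//|//|QcE] := ord_sub oQ oc.
  have : kap `<=` succ i.
    apply: (kmin _ f); first by apply: ord_succ; exact: ord_in ik.
    split=> [j ji|y yc]; first by apply: fc; exact: ord_trans ji (sk _ ik).
    by rewrite -QcE in yc; have /QE[_ [j ji jy]] := yc; exists j.
  by move=> /(_ _ (sk _ ik))/mem_irr.
have [j jk xj] := fcof _ xc; exists j => // i' i'k i'j.
apply/QE; split=> //; exists j => //.
have [h|->|//] := ord_total (ord_in okap jk) (ord_in okap i'k); last exact: succ_self.
exact: succ_sub.
Qed.

Let small_image (f : ZF -> ZF -> ZF) (A B : ZF) : A #< c -> B #< c ->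
  exists m, [/\ m ∈ c, infinite_set m, lst #<= m &
    [set y | exists x u, [/\ x ∈ A, u ∈ B & f x u = y]] #<= m].
Proof.
move=> Ac Bc; have [m [mc im lm Am Bm]] := small_bound Ac Bc; exists m; split=> //.
apply: card_le_trans (card_setX im Am Bm).
apply: (@card_le_surj _ _ _ _ (fun p => f p.1 p.2)) => y [x [u [xA uB <-]]].
by exists (x, u).
Qed.

(** The extension is the union of a chain of length [kap] whose step at [i] is existentially closed
    over a small submodel [Mi i]. With [c] equal to [kap] this serves a weakly compact cardinal, and
    with [kap] the cofinality of [c] a singular one. *)
Lemma dense_amalgamation_base M : K_card k c M -> exists N,
  [/\ K_card k c N, amalgamation_base k c c N & le k M N].
Proof.
move=> KM; have [lam [lamc lamP]] := levels.
have [okap _ sk] := kapl.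
have [en enP] : exists en : structure tau -> ZF -> ZF, forall N, K_card k c N ->
    (forall u, en N u ∈ N) /\ forall x, x ∈ N -> exists2 u, u ∈ c & en N u = x.
  suff H N : exists g : ZF -> ZF, K_card k c N ->
      (forall u, g u ∈ N) /\ forall x, x ∈ N -> exists2 u, u ∈ c & g u = x.
    by have [en enP] := choice_ex H; exists en.
  have [KN|nK] := pselect (K_card k c N); last by exists id.
  have [x0 x0c] := infinite_setN0 ic.
  have [h hN _] := card_le_ex empty (card_eq_ler KN.2).
  have [|g g1 g2] := card_le_onto (card_eq_lel KN.2); first by exists (h x0); exact: hN.
  by exists g.
(* Bookkeeping: the points with number in [lam i] in all models up to stage [i]. There are fewer
   than [c] of them, and every point of the chain is eventually included. *)
pose base i (h : ZF -> structure tau) :=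
  [set y | exists j u, [/\ j ∈ succ i, u ∈ lam i & en (h j) u = y]].
pose inc i (h : ZF -> structure tau) := (forall j, j ∈ succ i -> K_card k c (h j)) /\
  (forall j, j ∈ i -> le k (h j) (h i)).
have [sub subP] : exists sub : ZF -> (ZF -> structure tau) -> structure tau, forall i h,
    i ∈ kap -> inc i h -> [/\ le k (sub i h) (h i), base i h `<=` sub i h & sub i h #< c].
  suff H (z : ZF * (ZF -> structure tau)) : exists S, z.1 ∈ kap -> inc z.1 z.2 ->
      [/\ le k S (z.2 z.1), base z.1 z.2 `<=` S & S #< c].
    have [sub subP] := choice_ex H; exists (fun i h => sub (i, h)) => i h.
    exact: (subP (i, h)).
  case: z => i h /=; have [[ik [hK hle]]|n] := pselect (i ∈ kap /\ inc i h); last first.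
    by exists M => ik ih; case: n.
  have bi : base i h `<=` h i.
    move=> _ [j [u [/[dup] ji /in_succ[j_i|jE] ul <-]]]; have [e1 _] := enP _ (hK _ ji).
      exact: (le_subset (hle _ j_i)).
    by rewrite /= -jE.
  have si : succ i #< c by apply/small/kapc/sk.
  have [m [mc im lm bm]] := small_image (fun j => en (h j)) si (small (lamc _ ik)).
  have [S [Sh bS Sm]] := lst_LS hlst (hK i (succ_self i)).1 bi.
  exists S => _ _; split=> //; apply: card_le_lt (small mc).
  by apply: card_le_trans Sm _; exact: card_dsum.
have [step stepP] : exists step : ZF -> (ZF -> structure tau) -> structure tau, forall i h,
    i ∈ kap -> inc i h -> [/\ le k (h i) (step i h), K_card k c (step i h) &
      forall N0 P, le k (sub i h) N0 -> N0 #< c -> K_card k c P -> le k (step i h) P ->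
        embeds_over k (sub i h) N0 P -> embeds_over k (sub i h) N0 (step i h)].
  suff H (z : ZF * (ZF -> structure tau)) : exists S, z.1 ∈ kap -> inc z.1 z.2 ->
      [/\ le k (z.2 z.1) S, K_card k c S &
      forall N0 P, le k (sub z.1 z.2) N0 -> N0 #< c -> K_card k c P -> le k S P ->
        embeds_over k (sub z.1 z.2) N0 P -> embeds_over k (sub z.1 z.2) N0 S].
    have [step stepP] := choice_ex H; exists (fun i h => step (i, h)) => i h.
    exact: (stepP (i, h)).
  case: z => i h /=; have [[ik ih]|n] := pselect (i ∈ kap /\ inc i h); last first.
    by exists M => ik ih; case: n.
  have [s1 _ s3] := subP i h ik ih.
  have [S SP] := saturated_step (ih.1 i (succ_self i)) s1 s3.
  by exists S.
have kapc' : kap #<= c by exact: subset_card_le.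
have [|C [C0 Cle CK Cu Cs]] := chain_exists ic (step := step) kapl kapc' KM.
  by move=> i h ik h1 h2; have [] := stepP i h ik (conj h1 h2).
have Ck i : i ∈ kap -> le k (C i) (C kap) by move=> ik; apply: Cle => //; exact: succ_self.
have [Cun _] := Cu _ (succ_self kap) kapl.
have Cs' i : exists h, i ∈ kap -> (forall j, j ∈ succ i -> h j = C j) /\ C (succ i) = step i h.
  have [ik|nk] := pselect (i ∈ kap); last by exists C.
  by have [h h1 h2] := Cs i ik; exists h.
have [h hP] := choice_ex Cs'.
have hinc i : i ∈ kap -> inc i (h i).
  move=> ik; have [hC _] := hP i ik; split=> j ji; rewrite !hC //.
  - by apply: CK; apply/succ_sub; apply: ord_trans ji (sk _ ik).
  - by apply: Cle => //; exact: succ_sub.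
  - exact: succ_self.
  - exact: succ_sub.
pose Mi i := sub i (h i).
have MiP i : i ∈ kap -> [/\ le k (Mi i) (C kap), base i (h i) `<=` Mi i & Mi i #< c].
  move=> ik; have [s1 s2 s3] := subP i (h i) ik (hinc i ik); split=> //.
  have [hC _] := hP i ik; rewrite hC in s1; last exact: succ_self.
  exact: le_trans s1 (Ck i ik).
(* What was achieved over [Mi i] at step [i] persists to the end of the chain, and every extension
   of the last model also extends that step. *)
have realize i N0 P : i ∈ kap -> le k (Mi i) N0 -> N0 #< c -> K_card k c P -> le k (C kap) P ->
    embeds_over k (Mi i) N0 P -> embeds_over k (Mi i) N0 (C kap).
  move=> ik MN0 N0c KP CP NP; have [_ CE] := hP i ik.
  have [_ _ sP] := stepP i (h i) ik (hinc i ik).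
  have CsC : le k (step i (h i)) (C kap) by rewrite -CE; exact/Ck/sk.
  have [f fP fM] := sP N0 P MN0 N0c KP (le_trans CsC CP) NP.
  by exists f => //; exact: le_embedding_trans fP CsC.
(* The [Mi i] need not increase with [i], but each point belongs to them from some index on, which
   is what [tails kap] asks for. *)
have cover x : x ∈ C kap -> exists2 i0, i0 ∈ kap & forall i, i ∈ kap -> ~ i ∈ i0 -> x ∈ Mi i.
  rewrite Cun => -[j jk xj].
  have [_ /(_ _ xj)[u uc ux]] := enP _ (CK j (succ_sub jk)).
  have [i1 i1k i1P] := lamP u uc.
  have [i0 [i0k ji0 i10]] : exists i0, [/\ i0 ∈ kap, j `<=` i0 & i1 `<=` i0].
    have [e|e|e] := ord_total (ord_in okap jk) (ord_in okap i1k).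
    - by exists i1; split=> //; apply: (ord_in_sub _ e); exact: ord_in i1k.
    - by exists i1; split=> //; rewrite e.
    - by exists j; split=> //; apply: (ord_in_sub _ e); exact: ord_in jk.
  exists i0 => // i ik ii0; have [_ + _] := MiP i ik; apply.
  have ji : j ∈ succ i.
    have [e|->|e] := ord_total (ord_in okap jk) (ord_in okap ik);
      [exact: succ_sub|exact: succ_self|].
    by case: ii0; exact: ji0.
  exists j, u; split=> //; first by apply: i1P => // e; apply: ii0; exact: i10.
  by have [hC _] := hP i ik; rewrite hC.
have KC := CK _ (succ_self kap).
have MC : le k M (C kap) by rewrite -C0; apply: Ck; exact: limit_empty.
exists (C kap); split=> //; split; [exact: KC.1|exact: card_eq_lel KC.2|exact: card_eq_lel KC.2|].
move=> N1 N2 CN1 KN1 CN2 KN2.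
have fi (i : set_type kap) : exists Nf : structure tau * (ZF -> ZF), [/\ le k Nf.1 N1,
    forall u, u ∈ lam (val i) -> en N1 u ∈ Nf.1, le_embedding k Nf.2 Nf.1 (C kap) &
    forall x, x ∈ Mi (val i) -> Nf.2 x = x].
  have ik : val i ∈ kap by exact: set_valP.
  have [MiC _ Mic] := MiP _ ik.
  have [e1 _] := enP _ KN1.
  have [m [mc im lm Mm lamm]] := small_bound Mic (small (lamc _ ik)).
  pose A : set ZF := Mi (val i) `|` en N1 @` lam (val i).
  have AN1 : A `<=` N1 by move=> x [/(le_subset MiC)/(le_subset CN1)//|[u _ <-]]; exact: e1.
  have [N1i [N1iN AN1i N1im]] := lst_LS hlst KN1.1 AN1.
  have MN1i : le k (Mi (val i)) N1i.
    apply: le_between (le_trans MiC CN1) N1iN.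
    by move=> x xM; apply: AN1i; left.
  have N1ic : N1i #< c.
    apply: card_le_lt (small mc); apply: card_le_trans N1im _; apply: card_dsum => //.
    by apply: card_setU => //; apply: card_le_trans (card_image_le _ _) lamm.
  (* [N1] itself contains the small piece over [Mi], hence the piece already embeds into [C kap]
     over [Mi]. *)
  have [|f fP fM] := realize _ N1i N1 ik MN1i N1ic KN1 CN1.
    by exists id => //; exact: le_embedding_id.
  by exists (N1i, f); split=> // u ul; apply: AN1i; right; exists u.
have [Nf NfP] := choice_ex fi.
pose N (e : bool) := if e then N1 else N2.
have CN e : le k (C kap) (N e) by case: e.
have Nc e : N e #<= c by case: e; [exact: card_eq_lel KN1.2|exact: card_eq_lel KN2.2].
have [x0 x0C] : exists x, x ∈ C kap.
  have [x xc] := infinite_setN0 ic; have [g gC _] := card_le_ex empty (card_eq_ler KC.2).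
  by exists (g x); exact: gC.
have lc' : lst #<= c by apply: subset_card_le; exact: ord_in_sub.
(* The amalgam at every index is [N2]: it is mapped by the identity, and the pieces of [N1] reach it
   through [C kap]. *)
have [|||||M3 [MM3 M3P]] := amalgamation_limit linf (lst_vocabulary hlst) (lst_LS hlst) oc lc'
   kapF x0C CN Nc (P := fun=> N2) (d := fun e i => if e then (Nf i).1 else N2)
   (f := fun e i => if e then (Nf i).2 else id).
- by move=> _; exists x0; exact: (le_subset CN2).
- move=> [] i; first by have [] := NfP i.
  exact: le_refl KN2.1.
- move=> [] i; last by apply: le_embedding_id; exact: le_refl KN2.1.
  by have [_ _ H _] := NfP i; exact: le_embedding_trans H CN2.
- move=> [] x xN; last first.
    by exists empty => //; exact: limit_empty.
  have [_ /(_ _ xN)[u uc <-]] := enP _ KN1.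
  have [i0 i0k i0P] := lamP u uc; exists i0 => // i ii0.
  have [_ H _ _] := NfP i; apply: H; apply: i0P => //; exact: set_valP.
- move=> x /cover[i0 i0k i0P]; exists i0 => // i ii0.
  have [_ _ _ H] := NfP i; apply: H; apply: i0P => //; exact: set_valP.
by exists M3; split=> //; [exact: (M3P true)|exact: (M3P false)].
Qed.

End Density.

Lemma cardinal_mem_of_lt (a c : ZF) T (X : set T) : ordinal a -> cardinal c -> a #<= X ->
  X #< c -> a ∈ c.
Proof. by move=> oa cc aX Xc; apply: cardinal_in => //; exact: card_le_lt aX Xc. Qed.

Theorem claim1p12 (tau : vocabulary) (k : aec tau) (lst : ZF)
    (hlst : LST_number k lst) :
  (forall kappa theta : ZF,
     lst ∈ theta -> theta ∈ kappa ->
     measurable_cardinal theta -> weakly_compact kappa ->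
     has_amalgamation_bases k kappa theta)
  /\
  (forall kappa theta mu : ZF,
     measurable_cardinal kappa -> measurable_cardinal theta ->
     lst ∈ kappa -> lst ∈ theta ->
     kappa ⊎ theta #< mu ->
     strong_limit mu -> singular mu -> cofinality mu kappa ->
     has_amalgamation_bases k mu theta)
  /\
  (forall kappa theta chi1 chi2 : ZF,
     cardinal kappa -> cardinal chi1 -> cardinal chi2 ->
     lst ∈ theta -> theta ∈ kappa ->
     measurable_cardinal theta ->
     (forall M, K_card k kappa M ->
        exists N, [/\ K_card k kappa N, amalgamation_base k chi1 chi2 N &
                      le k M N]) ->
     has_amalgamation_bases2 k chi1 chi2 kappa theta).
Proof.
split; [|split].
- move=> kappa theta lt tk mt wk; have ck := weakly_compact_cardinal wk.
  have ik := weakly_compact_infinite wk; have bk := weakly_compact_bounded_maps wk.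
  have lk : lst ∈ kappa by apply: ord_trans lt tk; exact: ck.1.
  apply: (dense_amalgamation_bases hlst) => // M KM.
  apply: (dense_amalgamation_base hlst (kap := kappa)) KM => //.
  + exact: weakly_compact_strong_limit.
  + by have [] := bounded_maps_regular ck ik bk.
  + exact: infinite_cardinal_limit.
  + exact: weakly_compact_limit_filters.
- move=> kappa theta mu mk mt lk lt kt sl _ cofmu.
  have [cmu _ _] := sl.
  have ck := measurable_cardinal_cardinal mk.
  have kmu : kappa ∈ mu by apply: cardinal_mem_of_lt kt => //; [exact: ck.1|exact: dsum_lel].
  have tmu : theta ∈ mu.
    by apply: cardinal_mem_of_lt kt => //;
      [exact: (measurable_cardinal_cardinal mt).1|exact: dsum_ler].
  apply: (dense_amalgamation_bases hlst) => // M KM.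
  apply: (dense_amalgamation_base hlst (kap := kappa)) KM => //.
  + by apply: infinite_cardinal_limit => //; exact: measurable_infinite.
  + by apply: ord_in_sub => //; exact: cmu.1.
  + exact: measurable_limit_filters.
- move=> kappa theta chi1 chi2 ck cchi1 cchi2 lt tk mt dense.
  exact: (dense_amalgamation_bases hlst).
Qed.
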